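(* Let $\mathbb{P}$ be a finite quantum space and $\mathbb{O}$ a compact quantum space such that $C(\mathbb{O})$ is separable and has the lifting property. Then the operator system $\mathbb{S}_{\mathbb{P},\mathbb{O}}$ has the lifting property: given a unital C*-algebra $B$ with an ideal $J\subset B$ and a unital completely positive map $\varphi\colon\mathbb{S}_{\mathbb{P},\mathbb{O}}\to B/J$, there exists a unital completely positive lift $\widetilde{\varphi}\colon\mathbb{S}_{\mathbb{P},\mathbb{O}}\to B$ of $\varphi$.
   Context: A C*-algebra $A$ has the lifting property if for any C*-algebra $B$ with a (closed two-sided) ideal $J\subset B$, any contractive completely positive map $A\to B/J$ admits a contractive completely positive lift $A\to B$. (For unital $A$ this is equivalent to the analogous property with ''contractive completely positive'' replaced by ''unital completely positive''.) A quantum space $\mathbb{X}$ is an object of the category dual to the category of C*-algebras; the corresponding C*-algebra is denoted $C_0(\mathbb{X})$, or $C(\mathbb{X})$ when it is unital. $\mathbb{X}$ is compact if $C(\mathbb{X})$ is unital and finite if $C(\mathbb{X})$ is finite-dimensional. For C*-algebras $A,B$, $\mathrm{Mor}(A,B)$ is the set of non-degenerate $*$-homomorphisms from $A$ to the multiplier algebra $M(B)$ (unital $*$-homomorphisms $A\to B$ if both are unital). $\otimes$ is the minimal tensor product. For $\mathbb{P}$ finite and $\mathbb{O}$ compact, $(C(\mathbb{M}_{\mathbb{P},\mathbb{O}}),\boldsymbol{\Phi}_{\mathbb{P},\mathbb{O}})$ denotes the (existing, unique up to isomorphism) pair consisting of a unital C*-algebra and a unital $*$-homomorphism $\boldsymbol{\Phi}_{\mathbb{P},\mathbb{O}}\colon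 C(\mathbb{O})\to C(\mathbb{P})\otimes C(\mathbb{M}_{\mathbb{P},\mathbb{O}})$ with the universal property: for every quantum space $\mathbb{X}$ and every $\Psi\in\mathrm{Mor}(C(\mathbb{O}),C(\mathbb{P})\otimes C_0(\mathbb{X}))$ there is a unique $\Lambda\in\mathrm{Mor}(C(\mathbb{M}_{\mathbb{P},\mathbb{O}}),C_0(\mathbb{X}))$ with $\Psi=(\mathrm{id}\otimes\Lambda)\circ\boldsymbol{\Phi}_{\mathbb{P},\mathbb{O}}$. The C*-algebra $C(\mathbb{M}_{\mathbb{P},\mathbb{O}})$ is generated by the slices $(\omega\otimes\mathrm{id})\boldsymbol{\Phi}_{\mathbb{P},\mathbb{O}}(a)$, $a\in C(\mathbb{O})$, $\omega\in C(\mathbb{P})^*$, and $\mathbb{S}_{\mathbb{P},\mathbb{O}}\subset C(\mathbb{M}_{\mathbb{P},\mathbb{O}})$ is the operator system defined as the closed linear span of these slices. *)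

(* Defs.v *)
From HB Require Import structures.
From mathcomp Require Import all_boot all_order all_algebra.
From mathcomp Require Import all_classical all_reals all_analysis.
From mathcomp Require Import complex.

Set Implicit Arguments.
Unset Strict Implicit.
Unset Printing Implicit Defensive.

Import Order.TTheory GRing.Theory Num.Theory.
Import numFieldNormedType.Exports.
Local Open Scope classical_set_scope.
Local Open Scope ring_scope.

(* A C*-algebra need not be unital, so its product cannot come from the ring
   hierarchy of MathComp. The scalars are R[i], hence norms take (real,
   nonnegative) values in R[i]. *)
HB.mixin Record isCstarAlgebra (R : realType) A
    of CompleteNormedModule R[i] A := {
  cmul : A -> A -> A;
  cstar : A -> A;
  cmulA : associative cmul;
  cmul_linearl : forall y, linear (fun x => cmul x y);
  cmul_linearr : forall x, linear (cmul x);
  cstarK : involutive cstar;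
  cstar_conj_linear : forall (k : R[i]) x y,
    cstar (k *: x + y) = Num.conj k *: cstar x + cstar y;
  cstarM : forall x y, cstar (cmul x y) = cmul (cstar y) (cstar x);
  normr_cmul_le : forall x y, `|cmul x y| <= `|x| * `|y|;
  cstar_identity : forall x, `|cmul (cstar x) x| = `|x| ^+ 2
}.

#[short(type="cstarAlgType")]
HB.structure Definition CstarAlgebra (R : realType) :=
  { A of isCstarAlgebra R A & CompleteNormedModule R[i] A }.

(* The zero algebra, where cone = 0, is allowed. *)
HB.mixin Record isUnitalCstarAlgebra (R : realType) A of CstarAlgebra R A := {
  cone : A;
  cmul1x : left_id cone cmul;
  cmulx1 : right_id cone cmul
}.

#[short(type="unitalCstarAlgType")]
HB.structure Definition UnitalCstarAlgebra (R : realType) :=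
  { A of isUnitalCstarAlgebra R A & CstarAlgebra R A }.

Arguments cone {R s}.
Notation "x ** y" := (cmul x y) (at level 40, left associativity) : ring_scope.

Definition lin_span (R : realType) (V : normedModType R[i]) (X : set V) :
    set V :=
  [set v | exists n (c : 'I_n -> R[i]) (x : 'I_n -> V),
     (forall i, X (x i)) /\ v = \sum_i c i *: x i].

Definition lin_indep (R : realType) (V : normedModType R[i]) (n : nat)
    (x : 'I_n -> V) : Prop :=
  forall c : 'I_n -> R[i], \sum_i c i *: x i = 0 -> forall i, c i = 0.

Definition finite_dim (R : realType) (V : normedModType R[i]) : Prop :=
  exists n (x : 'I_n -> V), lin_span (range x) = setT.

Definition separable (T : topologicalType) : Prop :=
  exists2 D : set T, countable D & dense D.

Section Maps.
Variables (R : realType) (A B : cstarAlgType R).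
Implicit Types (f : A -> B) (S : set A).

Definition star_hom f : Prop :=
  [/\ linear f, forall x y, f (x ** y) = f x ** f y
    & forall x, f (cstar x) = cstar (f x)].

(* Positive elements of M_n(A): those of the form Y^* Y. *)
Definition mx_pos (D : cstarAlgType R) (n : nat) (X : 'M[D]_n) : Prop :=
  exists Y : 'M[D]_n, forall i j, X i j = \sum_k cstar (Y k i) ** Y k j.

(* Linear maps and completely positive maps on a subspace S of A are
   represented by functions on A, of which only the values on S matter; the
   matrix order of S is that induced from A. *)
Definition linear_on S f : Prop :=
  forall (k : R[i]) x y, S x -> S y -> f (k *: x + y) = k *: f x + f y.

Definition cp_on S f : Prop :=
  linear_on S f /\
  forall n (X : 'M[A]_n),
    (forall i j, S (X i j)) -> mx_pos X -> mx_pos (map_mx f X).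

Definition ccp f : Prop := cp_on setT f /\ forall x, `|f x| <= `|x|.

End Maps.

Definition ucp_on (R : realType) (A B : unitalCstarAlgType R) (S : set A)
    (f : A -> B) : Prop :=
  cp_on S f /\ f cone = cone.

Definition closed_ideal (R : realType) (B : cstarAlgType R) (J : set B) :
    Prop :=
  [/\ closed J, J 0, forall (k : R[i]) x y, J x -> J y -> J (k *: x + y)
    & forall b x, J x -> J (b ** x) /\ J (x ** b)].

(* Q, together with q, is the C*-algebra B/J; the last clause says that the
   norm of q b is the infimum of the norms of b + j for j in J. *)
Definition is_quotient (R : realType) (B Q : cstarAlgType R) (J : set B)
    (q : B -> Q) : Prop :=
  [/\ star_hom q, set_surj setT setT q, forall b, q b = 0 <-> J b
    & forall b (r : R[i]), r <= `|q b| <-> forall j, J j -> r <= `|b + j|].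

Definition lifting_property (R : realType) (A : cstarAlgType R) : Prop :=
  forall (B Q : cstarAlgType R) (J : set B) (q : B -> Q),
    closed_ideal J -> is_quotient J q ->
  forall f : A -> Q, ccp f ->
  exists g : A -> B, ccp g /\ forall a, q (g a) = f a.

Definition operator_system_lifting_property (R : realType)
    (A : unitalCstarAlgType R) (S : set A) : Prop :=
  forall (B Q : unitalCstarAlgType R) (J : set B) (q : B -> Q),
    closed_ideal J -> is_quotient J q ->
  forall f : A -> Q, ucp_on S f ->
  exists g : A -> B, ucp_on S g /\ forall x, S x -> q (g x) = f x.

(* The multiplier algebra M(B) is realized as the algebra of adjointable maps
   T : B -> B, those having T' with (T x)^* y = x^* (T' y); the product is the
   composition, T' is the (unique) adjoint of T, and b in B acts by left
   multiplication. A map from A to M(B) is thus a function A -> B -> B. *)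
Definition adjoint_maps (R : realType) (B : cstarAlgType R) (T T' : B -> B) :
    Prop :=
  forall x y, cstar (T x) ** y = cstar x ** T' y.

(* Nondegenerate *-homomorphisms from A to M(B). *)
Record is_mor (R : realType) (A B : cstarAlgType R) (F : A -> B -> B) : Prop :=
  IsMor {
  mor_linear : forall b, linear (fun a => F a b);
  mor_mul : forall a a' b, F (a ** a') b = F a (F a' b);
  mor_star : forall a, adjoint_maps (F a) (F (cstar a));
  mor_nondegenerate :
    closure (lin_span [set y | exists a b, y = F a b]) = setT
}.

(* t induces an injective *-homomorphism from the algebraic tensor product of
   A and B to E. *)
Record alg_tensor_embedding (R : realType) (A B E : cstarAlgType R)
    (t : A -> B -> E) : Prop := AlgTensorEmbedding {
  ten_linearl : forall b, linear (fun a => t a b);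
  ten_linearr : forall a, linear (t a);
  ten_mul : forall a a' b b', t (a ** a') (b ** b') = t a b ** t a' b';
  ten_star : forall a b, t (cstar a) (cstar b) = cstar (t a b);
  ten_inj : forall n (a : 'I_n -> A) (b : 'I_n -> B),
    lin_indep a -> \sum_i t (a i) (b i) = 0 -> forall i, b i = 0
}.

(* E is the completion of the algebraic tensor product of A and B in the least
   C*-norm. *)
Record is_min_tensor (R : realType) (A B E : cstarAlgType R)
    (t : A -> B -> E) : Prop := IsMinTensor {
  min_ten_alg : alg_tensor_embedding t;
  min_ten_dense : closure (lin_span [set z | exists a b, z = t a b]) = setT;
  min_ten_norm : forall (E' : cstarAlgType R) (t' : A -> B -> E'),
    alg_tensor_embedding t' ->
    forall n (a : 'I_n -> A) (b : 'I_n -> B),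
      `|\sum_i t (a i) (b i)| <= `|\sum_i t' (a i) (b i)|
}.

(* H = id (x) L, as a morphism between the minimal tensor products with P. *)
Definition is_id_tensor (R : realType) (P A B E F : cstarAlgType R)
    (t : P -> A -> E) (u : P -> B -> F) (L : A -> B -> B) (H : E -> F -> F) :
    Prop :=
  is_mor H /\ forall p a p' b, H (t p a) (u p' b) = u (p ** p') (L a b).

(* With C(P) = P, C(O) = O and E = P (x) M, the pair (M, Phi) is
   (C(M_{P,O}), Phi_{P,O}). *)
Definition is_universal_map (R : realType) (P O M E : unitalCstarAlgType R)
    (t : P -> M -> E) (Phi : O -> E) : Prop :=
  [/\ star_hom Phi, Phi cone = cone
    & forall (X F : cstarAlgType R) (u : P -> X -> F), is_min_tensor u ->
      forall Psi : O -> F -> F, is_mor Psi ->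
      exists! L : M -> X -> X, is_mor L /\
        exists2 H, is_id_tensor t u L H & forall a z, Psi a z = H (Phi a) z].

(* s = omega (x) id. *)
Definition is_slice (R : realType) (P M E : cstarAlgType R) (t : P -> M -> E)
    (omega : P -> R[i]^o) (s : E -> M) : Prop :=
  [/\ linear s, continuous s & forall p m, s (t p m) = omega p *: m].

Definition slice_system (R : realType) (P O M E : cstarAlgType R)
    (t : P -> M -> E) (Phi : O -> E) : set M :=
  closure (lin_span [set x | exists (omega : P -> R[i]^o) (s : E -> M) (a : O),
    [/\ linear omega, continuous omega, is_slice t omega s & x = s (Phi a)]]).

(* Main.v *)
From HB Require Import structures.
From mathcomp Require Import all_boot all_order all_algebra.
From mathcomp Require Import all_classical all_reals all_analysis.
From mathcomp Require Import complex.
From mathcomp Require Import ring lra.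
Require Import Defs.

(** Let [e_i] be an orthonormal basis of [P] for the trace of left
    multiplication, and identify an element of [P (x) M] with its coordinates;
    the slices of [Phi] are then spanned by the coordinates [Phi(a)_i].
    Applying a ucp map [f : S -> B/J] to coordinates gives a ucp map from [O]
    to [P (x) B/J], because the matrix coefficients of [Phi(a)] as an operator
    on the first leg lie in [S]. It lifts to a ccp map [g] from [O] to
    [P (x) B], and, [w] being a state of [O], to the ucp map
    [Theta(a) = g(a) + w(a)(1 - g(1))]. The Stinespring-Kasparov construction
    yields a Hilbert [B]-module [N], a vector [eta] with [<eta, eta> = 1] and a
    unital *-homomorphism [Pi : O -> P (x) L(N)] with
    [<eta, Pi(a)_i eta> = Theta(a)_i]. By the universal property [Pi] is
    [(id (x) l) Phi] for some [l : M -> L(N)], and [m |-> <eta, l(m) eta>] is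
    a ucp map on all of [M] which lifts [f] on [S]. *)

Set Implicit Arguments.
Unset Strict Implicit.
Unset Printing Implicit Defensive.

Import Order.TTheory GRing.Theory Num.Theory.
Import numFieldNormedType.Exports.
Local Open Scope classical_set_scope.
Local Open Scope ring_scope.
Local Open Scope complex_scope.

(** * Norms and sequences *)

(** The obstacle is that [B] need not be injective, so a ucp map on an operator system with values
    in [B] cannot be extended to [M] directly. Lifting is possible on [O], but the lift [Theta] says
    nothing about products of slices; only after it has been replaced by a star-homomorphism does
    the universal property of [M] apply. A dilation of [Theta] over [P (x) B] would not have the
    required target [P (x) L(N)], with the first leg left intact. Therefore [Theta] is first cut
    into [B]-valued blocks by the trace of [P], the blocks are dilated over [B], and an element [V]
    of [P (x) L(N)] puts them together again. Compression by [V] is not multiplicative, but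
    conjugation by a unitary extending [V] is; the block of the state supplies the orthogonal vector
    that makes such a unitary exist. Positivity is treated without spectral theory: a positive
    element is the square of a self-adjoint one, and is recognized by the norm estimate
    [nrm (t - a) <= t]. *)

Section RealNorm.
Variables (R : realType) (V : normedModType R[i]).
Implicit Types (x y : V).

(** Norms take values in [R[i]], whose order is partial; a real-valued norm gives access to suprema,
    square roots and [lra]. *)
Definition nrm x : R := complex.Re `|x|.

Lemma normE x : `|x| = (nrm x)%:C.
Proof.
by rewrite /nrm; have := normr_ge0 x; case: `|x| => a b; rewrite lecE /= => /andP[/eqP -> _].
Qed.

Lemma nrm_ge0 x : 0 <= nrm x.
Proof. by have := normr_ge0 x; rewrite normE lecE /= => /andP[_]. Qed.

Lemma nrm0 : nrm 0 = 0.
Proof. by rewrite /nrm normr0. Qed.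

Lemma nrm0_eq0 x : nrm x = 0 -> x = 0.
Proof. by move=> h; apply/eqP; rewrite -normr_eq0 normE h. Qed.

Lemma nrmN x : nrm (- x) = nrm x.
Proof. by rewrite /nrm normrN. Qed.

Lemma nrmD x y : nrm (x + y) <= nrm x + nrm y.
Proof. by have := ler_normD x y; rewrite !normE -rmorphD lecR. Qed.

Lemma nrmB x y : nrm (x - y) <= nrm x + nrm y.
Proof. by rewrite -(nrmN y) nrmD. Qed.

Lemma nrmZ (k : R[i]) x : nrm (k *: x) = complex.Re `|k| * nrm x.
Proof.
have := normrZ k x; rewrite !normE.
have -> : `|k| = (complex.Re `|k|)%:C.
  by have := normr_ge0 k; case: `|k| => a b; rewrite lecE /= => /andP[/eqP -> _].
by rewrite -rmorphM => /complexI.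
Qed.

Lemma nrmZr (k : R) x : nrm (k%:C *: x) = `|k| * nrm x.
Proof. by rewrite nrmZ normc_def /= expr0n addr0 sqrtr_sqr. Qed.

End RealNorm.

Section Sequences.
Variables (R : realType) (V : zmodType) (n : V -> R).

(** Limits are developed for a bare function on a group because they are applied to the Hilbert
    module norm [hn], the operator norm [opn] and the norm [tnorm], on carriers without a declared
    norm. *)
Record seminorm : Prop := Seminorm {
  seminormN : forall x, n (- x) = n x;
  seminormD : forall x y, n (x + y) <= n x + n y;
  seminorm0 : n 0 = 0 }.

Definition tends (u : nat -> V) (l : V) : Prop :=
  forall e : R, 0 < e -> exists N, forall k, (N <= k)%N -> n (u k - l) < e.

Definition fundamental (u : nat -> V) : Prop :=
  forall e : R, 0 < e -> exists N, forall j k, (N <= j)%N -> (N <= k)%N ->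
    n (u j - u k) < e.

Hypothesis hn : seminorm.

Lemma seminorm_ge0 x : 0 <= n x.
Proof.
have := seminormD hn x (- x); rewrite subrr seminorm0 // seminormN //; lra.
Qed.

Lemma seminorm_dist x y : n (x - y) = n (y - x).
Proof. by rewrite -opprB seminormN. Qed.

Lemma seminorm_triangle z x y : n (x - y) <= n (x - z) + n (z - y).
Proof. by have := seminormD hn (x - z) (z - y); rewrite addrA subrK. Qed.

Lemma tends_cst l : tends (fun=> l) l.
Proof. by move=> e e0; exists 0%N => k _; rewrite subrr seminorm0. Qed.

Lemma tendsD u v l m : tends u l -> tends v m ->
  tends (fun k => u k + v k) (l + m).
Proof.
move=> hu hv e e0; have e2 : 0 < e / 2 by lra.
have [N hN] := hu _ e2; have [M hM] := hv _ e2.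
exists (maxn N M) => k; rewrite geq_max => /andP[/hN h1 /hM h2].
have -> : u k + v k - (l + m) = (u k - l) + (v k - m).
  by rewrite opprD addrACA.
have := seminormD hn (u k - l) (v k - m); lra.
Qed.

Lemma tendsN u l : tends u l -> tends (fun k => - u k) (- l).
Proof.
move=> hu e /hu[N hN]; exists N => k /hN.
by rewrite -opprD seminormN.
Qed.

Lemma tendsB u v l m : tends u l -> tends v m ->
  tends (fun k => u k - v k) (l - m).
Proof. by move=> hu hv; apply: tendsD => //; apply: tendsN. Qed.

Lemma tends_fundamental u l : tends u l -> fundamental u.
Proof.
move=> hu e e0; have e2 : 0 < e / 2 by lra.
have [N hN] := hu _ e2; exists N => j k /hN h1 /hN h2.
have := seminorm_triangle l (u j) (u k); rewrite (seminorm_dist l); lra.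
Qed.

Lemma tends_bounded u l : tends u l -> exists C, forall k, n (u k) <= C.
Proof.
move=> /(_ 1 ltr01)[N hN].
exists (n l + 1 + \sum_(k < N) n (u k)) => k.
have s0 (P : pred 'I_N) : 0 <= \sum_(k < N | P k) n (u k).
  by apply: sumr_ge0 => i _; apply: seminorm_ge0.
have [/hN h|kN] := leqP N k.
  have := seminormD hn (u k - l) l; rewrite subrK.
  have := s0 xpredT; lra.
rewrite (bigD1 (Ordinal kN)) //=.
have := s0 (fun i => i != Ordinal kN); have := seminorm_ge0 l; lra.
Qed.

Lemma fundamental_bounded u : fundamental u -> exists C, forall k, n (u k) <= C.
Proof.
move=> /(_ 1 ltr01)[N hN].
exists (n (u N) + 1 + \sum_(k < N) n (u k)) => k.
have s0 (P : pred 'I_N) : 0 <= \sum_(k < N | P k) n (u k).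
  by apply: sumr_ge0 => i _; apply: seminorm_ge0.
have [/hN /(_ (leqnn N)) h|kN] := leqP N k.
  have := seminormD hn (u k - u N) (u N); rewrite subrK.
  have := s0 xpredT; lra.
rewrite (bigD1 (Ordinal kN)) //=.
have := s0 (fun i => i != Ordinal kN); have := seminorm_ge0 (u N); lra.
Qed.

Lemma tends_unique u l m : (forall x, n x = 0 -> x = 0) ->
  tends u l -> tends u m -> l = m.
Proof.
move=> h0 hu hv; apply/eqP; rewrite -subr_eq0; apply/eqP/h0/eqP.
rewrite eq_le seminorm_ge0 andbT; apply/ler_addgt0Pl => e e0; rewrite addr0.
have e2 : 0 < e / 2 by lra.
have [N hN] := hu _ e2; have [M hM] := hv _ e2.
have := hN _ (leq_maxl N M); have := hM _ (leq_maxr N M).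
have := seminorm_triangle (u (maxn N M)) l m.
rewrite (seminorm_dist l (u _)); lra.
Qed.

Lemma tends_norm_le u l C : tends u l -> (forall k, n (u k) <= C) -> n l <= C.
Proof.
move=> hu hC; apply/ler_addgt0Pl => e /hu[N /(_ N (leqnn N))] h.
have := seminormD hn (l - u N) (u N); rewrite subrK seminorm_dist.
have := hC N; lra.
Qed.

Lemma tends_ext u v l : (forall k, u k = v k) -> tends u l -> tends v l.
Proof. by move=> h /[swap] e hu /hu[N hN]; exists N => k; rewrite -h; apply: hN. Qed.

Lemma tends_tail u l N : tends u l -> tends (fun k => u (k + N)%N) l.
Proof.
move=> hu e /hu[M hM]; exists M => k hk; apply: hM.
by rewrite (leq_trans hk) // leq_addr.
Qed.

End Sequences.

Lemma inv_lt_eventually (R : realType) (e : R) : 0 < e ->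
  exists N, forall k, (N <= k)%N -> k.+1%:R^-1 < e.
Proof.
move=> e0; have e1 : 0 <= e^-1 by rewrite invr_ge0 ltW.
exists (Num.truncn e^-1) => k hk.
have k0 : (0 : R) < k.+1%:R by rewrite ltr0n.
rewrite -(invrK e) ltf_pV2 ?posrE ?invr_gt0 //.
by rewrite (lt_le_trans (truncnS_gt _)) // ler_nat.
Qed.

Section NormedSeq.
Variables (R : realType) (V : normedModType R[i]).

Lemma nrm_seminorm : seminorm (@nrm R V).
Proof. by split; [exact: nrmN|exact: nrmD|exact: nrm0]. Qed.

Lemma nrm_lt (x : V) (e : R) : (`|x| < e%:C) = (nrm x < e).
Proof. by rewrite normE ltcR. Qed.

Lemma complex_gt0 (e : R[i]) : 0 < e -> e = (complex.Re e)%:C /\ 0 < complex.Re e.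
Proof. by case: e => a b; rewrite ltcE /= => /andP[/eqP -> ->]. Qed.

Lemma closureP_nrm (S : set V) (x : V) :
  closure S x <-> forall e : R, 0 < e -> exists2 y, S y & nrm (x - y) < e.
Proof.
split=> [h e e0|h B].
  have /h[y [Sy /=]] : nbhs x (ball x (e%:C)).
    by apply: nbhsx_ballx; rewrite ltcR.
  by rewrite -ball_normE /= nrm_lt => ?; exists y.
move=> /nbhs_ballP[e /complex_gt0[-> e0] hB].
have [y Sy hy] := h _ e0; exists y; split=> //; apply: hB.
by rewrite -ball_normE /= nrm_lt.
Qed.

Lemma tends_cvg (u : nat -> V) (l : V) : tends (@nrm R V) u l <-> u @ \oo --> l.
Proof.
split=> [h|/cvgrPdist_lt h e e0].
  apply/cvgrPdist_lt => e /complex_gt0[-> /h[N hN]].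
  exists N => // k /= /hN; rewrite nrm_lt -nrmN opprB //.
have /h[N _ hN] : (0 : R[i]) < e%:C by rewrite ltcR.
by exists N => k /hN /=; rewrite nrm_lt -nrmN opprB.
Qed.

Lemma closure_tends (S : set V) (x : V) : closure S x ->
  exists2 u : nat -> V, forall k, S (u k) & tends (@nrm R V) u x.
Proof.
move=> /closureP_nrm h.
have /choice[u hu] : forall k : nat, exists y, S y /\ nrm (x - y) < k.+1%:R^-1.
  by move=> k; have [|y ? ?] := h k.+1%:R^-1; [rewrite invr_gt0 ltr0n|exists y].
exists u => [k|e /inv_lt_eventually[N hN]]; first by case: (hu k).
exists N => k /hN; rewrite -nrmN opprB => h1; have [_ h2] := hu k; exact: lt_trans h1.
Qed.

End NormedSeq.

Lemma complete_tends (R : realType) (V : completeNormedModType R[i])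
    (u : nat -> V) :
  fundamental (@nrm R V) u -> exists l, tends (@nrm R V) u l.
Proof.
move=> hu.
have : cauchy (u @ \oo).
  apply/cauchyP => e /complex_gt0[-> /hu[N hN]]; exists (u N).
  by exists N => // k /= hk; rewrite -ball_normE /= nrm_lt; apply: hN.
by move=> /cauchy_cvg /cvg_ex[l] /tends_cvg; exists l.
Qed.

(** The axioms with a real norm and sequential completeness. Adjointable operators, [P (x) B] and
    corners are all presented in this form, and [calg] converts it to the hierarchy once. *)
Record cstar_data (R : realType) := CstarData {
  cd_car :> lmodType R[i];
  cd_mul : cd_car -> cd_car -> cd_car;
  cd_star : cd_car -> cd_car;
  cd_one : cd_car;
  cd_norm : cd_car -> R;
  cd_normD : forall x y, cd_norm (x + y) <= cd_norm x + cd_norm y;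
  cd_normZ : forall (k : R[i]) x, cd_norm (k *: x) = complex.Re `|k| * cd_norm x;
  cd_norm_eq0 : forall x, cd_norm x = 0 -> x = 0;
  cd_complete : forall u, fundamental cd_norm u -> exists l, tends cd_norm u l;
  cd_mulA : associative cd_mul;
  cd_linearl : forall y, linear (fun x => cd_mul x y);
  cd_linearr : forall x, linear (cd_mul x);
  cd_starK : involutive cd_star;
  cd_star_linear : forall (k : R[i]) x y,
    cd_star (k *: x + y) = Num.conj k *: cd_star x + cd_star y;
  cd_starM : forall x y, cd_star (cd_mul x y) = cd_mul (cd_star y) (cd_star x);
  cd_normM : forall x y, cd_norm (cd_mul x y) <= cd_norm x * cd_norm y;
  cd_norm_star : forall x, cd_norm (cd_mul (cd_star x) x) = cd_norm x ^+ 2;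
  cd_mul1x : left_id cd_one cd_mul;
  cd_mulx1 : right_id cd_one cd_mul }.

Definition calg (R : realType) (d : cstar_data R) : Type := cd_car d.

Section CalgInstances.
Variables (R : realType) (d : cstar_data R).

HB.instance Definition _ := GRing.Lmodule.on (calg d).

Let cnorm (x : calg d) : R[i] := (cd_norm (x : d))%:C.

Let cnormD x y : cnorm (x + y) <= cnorm x + cnorm y.
Proof. by rewrite -rmorphD lecR; exact: cd_normD. Qed.

Let cnormZ (k : R[i]) x : cnorm (k *: x) = `|k| * cnorm x.
Proof.
rewrite /cnorm cd_normZ rmorphM /=; congr (_ * _).
Qed.

Let cnorm_eq0 x : cnorm x = 0 -> x = 0.
Proof. by move=> /complexI /cd_norm_eq0. Qed.

HB.instance Definition _ :=
  Lmodule_isNormed.Build R[i] (calg d) cnormD cnormZ cnorm_eq0.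

(** The centres of balls of radius [1 / (k + 1)] belonging to [F] form a Cauchy sequence, and its
    limit is a limit of the filter. *)
Lemma calg_complete (F : set_system (calg d)) :
  ProperFilter F -> cauchy F -> cvg F.
Proof.
move=> FF /cauchyP hF.
have /choice[u hu] : forall k : nat, exists x : calg d,
    F (ball x ((k.+1%:R^-1 : R)%:C)).
  by move=> k; apply: hF; rewrite ltcR invr_gt0 ltr0n.
have hd j k : nrm (u j - u k) <= j.+1%:R^-1 + k.+1%:R^-1.
  have [x [/= h1 h2]] := filter_ex (filterI (hu j) (hu k)).
  move: h1 h2; rewrite -!ball_normE /= !nrm_lt => h1 h2.
  have := seminorm_triangle (nrm_seminorm _) x (u j) (u k).
  rewrite (seminorm_dist (nrm_seminorm _) x (u k)).
  by move=> /le_trans; apply; apply: ltW; apply: ltrD.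
have /cd_complete[l hl] : fundamental (@cd_norm R d) u.
  move=> e e0; have [|N hN] := @inv_lt_eventually R (e / 2); first lra.
  exists N => j k /hN h1 /hN h2; apply: (le_lt_trans (hd j k)); by rewrite (splitr e) ltrD.
apply/cvg_ex; exists l; apply/cvgrPdist_lt => e /complex_gt0[-> e0].
have e2 : 0 < complex.Re e / 2 by lra.
have [N hN] := inv_lt_eventually e2; have [M hM] := hl _ e2.
have := hM _ (leq_maxr N M); have := hN _ (leq_maxl N M).
set k := maxn N M => h1 h2.
apply: (filterS _ (hu k)) => x; rewrite -ball_normE /= !nrm_lt => h3.
apply: (le_lt_trans (seminorm_triangle (nrm_seminorm _) (u k) (l : calg d) x)).
rewrite (seminorm_dist (nrm_seminorm (calg d)) l (u k)) (splitr (complex.Re e)).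
by apply: ltrD => //; apply: lt_trans h1.
Qed.

HB.instance Definition _ := Uniform_isComplete.Build (calg d) calg_complete.

Let cnormM (x y : calg d) : `|(cd_mul x y : calg d)| <= `|x| * `|y|.
Proof. by rewrite !normE -rmorphM lecR; exact: cd_normM. Qed.

Let cnorm_star (x : calg d) : `|(cd_mul (cd_star x) x : calg d)| = `|x| ^+ 2.
Proof. by rewrite !normE -rmorphXn; congr (_%:C); exact: cd_norm_star. Qed.

HB.instance Definition _ := @isCstarAlgebra.Build R (calg d)
  (@cd_mul R d) (@cd_star R d) (@cd_mulA R d) (@cd_linearl R d)
  (@cd_linearr R d) (@cd_starK R d) (@cd_star_linear R d) (@cd_starM R d)
  cnormM cnorm_star.

HB.instance Definition _ := @isUnitalCstarAlgebra.Build R (calg d)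
  (@cd_one R d) (@cd_mul1x R d) (@cd_mulx1 R d).

Definition calgU : unitalCstarAlgType R := calg d.

End CalgInstances.

(** * Identities in C*-algebras *)

Section CstarAlgebraTheory.
Variables (R : realType) (A : cstarAlgType R).
Implicit Types (x y z : A) (k : R[i]).

Lemma cmulDl x y z : (x + y) ** z = x ** z + y ** z.
Proof. by have := cmul_linearl z 1 x y; rewrite !scale1r. Qed.

Lemma cmulDr x y z : x ** (y + z) = x ** y + x ** z.
Proof. by have := cmul_linearr x 1 y z; rewrite !scale1r. Qed.

Lemma cmul0x x : 0 ** x = 0.
Proof. by apply: (addrI (0 ** x)); rewrite -cmulDl !addr0. Qed.

Lemma cmulx0 x : x ** 0 = 0.
Proof. by apply: (addrI (x ** 0)); rewrite -cmulDr !addr0. Qed.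

Lemma cmulZl k x y : (k *: x) ** y = k *: (x ** y).
Proof. by have := cmul_linearl y k x 0; rewrite cmul0x !addr0. Qed.

Lemma cmulZr k x y : x ** (k *: y) = k *: (x ** y).
Proof. by have := cmul_linearr x k y 0; rewrite cmulx0 !addr0. Qed.

Lemma cmulNl x y : (- x) ** y = - (x ** y).
Proof. by rewrite -scaleN1r cmulZl scaleN1r. Qed.

Lemma cmulNr x y : x ** (- y) = - (x ** y).
Proof. by rewrite -scaleN1r cmulZr scaleN1r. Qed.

Lemma cmulBl x y z : (x - y) ** z = x ** z - y ** z.
Proof. by rewrite cmulDl cmulNl. Qed.

Lemma cmulBr x y z : x ** (y - z) = x ** y - x ** z.
Proof. by rewrite cmulDr cmulNr. Qed.

Lemma cmul_suml (I : Type) (r : seq I) (Q : pred I) (F : I -> A) y :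
  (\sum_(i <- r | Q i) F i) ** y = \sum_(i <- r | Q i) F i ** y.
Proof. by apply: (big_morph (fun x => x ** y)) => [a b|]; rewrite ?cmulDl ?cmul0x. Qed.

Lemma cmul_sumr (I : Type) (r : seq I) (Q : pred I) (F : I -> A) y :
  y ** (\sum_(i <- r | Q i) F i) = \sum_(i <- r | Q i) y ** F i.
Proof. by apply: (big_morph (fun x => y ** x)) => [a b|]; rewrite ?cmulDr ?cmulx0. Qed.

Lemma cstarD x y : cstar (x + y) = cstar x + cstar y.
Proof. by have := cstar_conj_linear 1 x y; rewrite conjC1 !scale1r. Qed.

Lemma cstar0 : cstar (0 : A) = 0.
Proof. by apply: (addrI (cstar (0 : A))); rewrite -cstarD !addr0. Qed.

Lemma cstarZ k x : cstar (k *: x) = Num.conj k *: cstar x.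
Proof. by have := cstar_conj_linear k x 0; rewrite cstar0 !addr0. Qed.

Lemma conj_realC (k : R) : Num.conj (k%:C) = k%:C.
Proof. by apply/eqP; rewrite eq_complex /= oppr0 !eqxx. Qed.

Lemma cstarZr (k : R) x : cstar (k%:C *: x) = k%:C *: cstar x.
Proof. by rewrite cstarZ conj_realC. Qed.

Lemma cstarN x : cstar (- x) = - cstar x.
Proof. by rewrite -scaleN1r cstarZ rmorphN1 scaleN1r. Qed.

Lemma cstarB x y : cstar (x - y) = cstar x - cstar y.
Proof. by rewrite cstarD cstarN. Qed.

Lemma cstar_sum (I : Type) (r : seq I) (Q : pred I) (F : I -> A) :
  cstar (\sum_(i <- r | Q i) F i) = \sum_(i <- r | Q i) cstar (F i).
Proof. by apply: (big_morph (@cstar R A)) => [a b|]; rewrite ?cstarD ?cstar0. Qed.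

Lemma nrm_cmul x y : nrm (x ** y) <= nrm x * nrm y.
Proof. by have := normr_cmul_le x y; rewrite !normE -rmorphM lecR. Qed.

Lemma nrm_cstar_cmul x : nrm (cstar x ** x) = nrm x ^+ 2.
Proof. by have := cstar_identity x; rewrite !normE -rmorphXn => /complexI. Qed.

Lemma nrm_cstar x : nrm (cstar x) = nrm x.
Proof.
have le y : nrm y <= nrm (cstar y).
  have [->|y0] := eqVneq (nrm y) 0; first exact: nrm_ge0.
  have y1 : 0 < nrm y by rewrite lt_def y0 nrm_ge0.
  have := nrm_cmul (cstar y) y; rewrite nrm_cstar_cmul expr2 => h.
  by rewrite -(ler_pM2r y1).
by apply/eqP; rewrite eq_le le andbT -{2}(cstarK x) le.
Qed.

Lemma cstar_cmul_eq0 x : cstar x ** x = 0 -> x = 0.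
Proof.
move=> h; apply: nrm0_eq0; have := nrm_cstar_cmul x.
by rewrite h nrm0 => /esym/eqP; rewrite sqrf_eq0 => /eqP.
Qed.

Lemma tends_cmul (u v : nat -> A) (x y : A) :
  tends (@nrm R A) u x -> tends (@nrm R A) v y ->
  tends (@nrm R A) (fun n => u n ** v n) (x ** y).
Proof.
move=> hu hv e e0.
have [C hC] := tends_bounded (nrm_seminorm A) hu.
have C0 : 0 <= C by apply: le_trans (hC 0%N); apply: nrm_ge0.
have d1 : 0 < e / 2 / (C + 1) by rewrite !divr_gt0 //; lra.
have d2 : 0 < e / 2 / (nrm y + 1).
  by rewrite !divr_gt0 //; have := nrm_ge0 y; lra.
have [N hN] := hv _ d1; have [M hM] := hu _ d2.
exists (maxn N M) => k; rewrite geq_max => /andP[/hN h1 /hM h2].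
have -> : u k ** v k - x ** y = u k ** (v k - y) + (u k - x) ** y.
  by rewrite cmulBr cmulBl addrA subrK.
apply: (le_lt_trans (nrmD _ _)); rewrite (splitr e); apply: ltr_leD.
  apply: (le_lt_trans (nrm_cmul _ _)).
  apply: (@le_lt_trans _ _ (C * nrm (v k - y))).
    by apply: ler_wpM2r; rewrite ?nrm_ge0.
  apply: (@le_lt_trans _ _ ((C + 1) * nrm (v k - y))).
    by apply: ler_wpM2r; [rewrite nrm_ge0|lra].
  by rewrite mulrC -ltr_pdivlMr //; lra.
apply: (le_trans (nrm_cmul _ _)).
apply: (@le_trans _ _ (nrm (u k - x) * (nrm y + 1))).
  by apply: ler_wpM2l; [rewrite nrm_ge0|lra].
by rewrite -ler_pdivlMr ?ltW //; have := nrm_ge0 y; lra.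
Qed.

Lemma tends_cstar (u : nat -> A) (x : A) : tends (@nrm R A) u x ->
  tends (@nrm R A) (fun n => cstar (u n)) (cstar x).
Proof. by move=> h e /h[N hN]; exists N => k /hN; rewrite -cstarB nrm_cstar. Qed.

End CstarAlgebraTheory.

Section NormedTends.
Variables (R : realType) (V : normedModType R[i]).

Lemma tendsZ (k : R[i]) (u : nat -> V) (x : V) : tends (@nrm R V) u x ->
  tends (@nrm R V) (fun n => k *: u n) (k *: x).
Proof.
move=> h e e0; have K0 : 0 <= complex.Re `|k|.
  by have := normr_ge0 k; case: `|k| => a b; rewrite lecE /= => /andP[_].
have : 0 < e / (complex.Re `|k| + 1) by rewrite divr_gt0 //; lra.
move=> /h[N hN]; exists N => n /hN; rewrite -scalerBr nrmZ.
rewrite ltr_pdivlMr; last lra.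
apply: le_lt_trans; rewrite mulrC; apply: ler_wpM2l; first exact: nrm_ge0.
lra.
Qed.

Lemma nrm_sum (I : Type) (r : seq I) (P : pred I) (F : I -> V) :
  nrm (\sum_(i <- r | P i) F i) <= \sum_(i <- r | P i) nrm (F i).
Proof.
elim/big_ind2: _ => [|a b c d h1 h2|//]; first by rewrite nrm0.
by apply: le_trans (nrmD _ _) _; apply: lerD.
Qed.

End NormedTends.

(* Reflexive normalization of noncommutative polynomial expressions; an
   identity is reduced to the vanishing of the scalar coefficient of each
   word. *)
Inductive nc_expr (K : Type) :=
| NcVar of nat | NcOne | NcZero | NcAdd of nc_expr K & nc_expr K
| NcOpp of nc_expr K | NcMul of nc_expr K & nc_expr K
| NcScale of K & nc_expr K.
Arguments NcVar {K}. Arguments NcOne {K}. Arguments NcZero {K}.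

Fixpoint word_eqb (u v : list nat) : bool :=
  match u, v with
  | nil, nil => true
  | cons a u', cons b v' => eqn a b && word_eqb u' v'
  | _, _ => false
  end.

Section NcReflection.
Variables (R : realType) (A : unitalCstarAlgType R).

Fixpoint nc_eval (env : list A) (e : nc_expr R[i]) : A :=
  match e with
  | NcVar n => List.nth n env 0
  | NcOne => cone
  | NcZero => 0
  | NcAdd a b => nc_eval env a + nc_eval env b
  | NcOpp a => - nc_eval env a
  | NcMul a b => nc_eval env a ** nc_eval env b
  | NcScale k a => k *: nc_eval env a
  end.

Definition nc_poly := list (R[i] * list nat).

Fixpoint nc_add1 (k : R[i]) (w : list nat) (p : nc_poly) : nc_poly :=
  match p with
  | nil => (k, w) :: nil
  | cons (l, v) p' =>
      if word_eqb w v then cons (k + l, v) p' else cons (l, v) (nc_add1 k w p')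
  end.

Fixpoint nc_add (p q : nc_poly) : nc_poly :=
  match p with nil => q | cons (k, w) p' => nc_add1 k w (nc_add p' q) end.

Fixpoint nc_scale (k : R[i]) (p : nc_poly) : nc_poly :=
  match p with nil => nil | cons (l, w) p' => cons (k * l, w) (nc_scale k p') end.

Fixpoint nc_shift (k : R[i]) (u : list nat) (p : nc_poly) : nc_poly :=
  match p with
  | nil => nil
  | cons (l, w) p' => cons (k * l, List.app u w) (nc_shift k u p')
  end.

Fixpoint nc_mul (p q : nc_poly) : nc_poly :=
  match p with
  | nil => nil
  | cons (k, u) p' => nc_add (nc_shift k u q) (nc_mul p' q)
  end.

Fixpoint nc_norm (e : nc_expr R[i]) : nc_poly :=
  match e with
  | NcVar n => cons (1, cons n nil) nil
  | NcOne => cons (1, nil) nil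
  | NcZero => nil
  | NcAdd a b => nc_add (nc_norm a) (nc_norm b)
  | NcOpp a => nc_scale (-1) (nc_norm a)
  | NcMul a b => nc_mul (nc_norm a) (nc_norm b)
  | NcScale k a => nc_scale k (nc_norm a)
  end.

Fixpoint nc_word (env : list A) (w : list nat) : A :=
  match w with nil => cone | cons n w' => List.nth n env 0 ** nc_word env w' end.

Fixpoint nc_sem (env : list A) (p : nc_poly) : A :=
  match p with nil => 0 | cons (k, w) p' => k *: nc_word env w + nc_sem env p' end.

Fixpoint nc_null (p : nc_poly) : Prop :=
  match p with nil => True | cons (k, _) p' => k = 0 /\ nc_null p' end.

Lemma word_eqbP u v : word_eqb u v -> u = v.
Proof.
by elim: u v => [|a u IH] [|b v] //= /andP[/eqnP -> /IH ->].
Qed.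

Lemma nc_sem_add1 env k w p :
  nc_sem env (nc_add1 k w p) = k *: nc_word env w + nc_sem env p.
Proof.
elim: p => [//|[l v] p IH] /=; case: ifP => [/word_eqbP ->|_] /=.
  by rewrite scalerDl addrA.
by rewrite IH addrCA.
Qed.

Lemma nc_sem_add env p q : nc_sem env (nc_add p q) = nc_sem env p + nc_sem env q.
Proof.
by elim: p => [|[k w] p IH] /=; rewrite ?add0r // nc_sem_add1 IH addrA.
Qed.

Lemma nc_sem_scale env k p : nc_sem env (nc_scale k p) = k *: nc_sem env p.
Proof.
by elim: p => [|[l w] p IH] /=; rewrite ?scaler0 // IH scalerDr scalerA.
Qed.

Lemma nc_word_cat env u v : nc_word env (List.app u v) = nc_word env u ** nc_word env v.
Proof. by elim: u => [|a u IH] /=; rewrite ?cmul1x // IH cmulA. Qed.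

Lemma nc_sem_shift env k u p :
  nc_sem env (nc_shift k u p) = k *: (nc_word env u ** nc_sem env p).
Proof.
elim: p => [|[l w] p IH] /=; first by rewrite cmulx0 scaler0.
by rewrite IH nc_word_cat cmulDr cmulZr scalerDr scalerA.
Qed.

Lemma nc_sem_mul env p q : nc_sem env (nc_mul p q) = nc_sem env p ** nc_sem env q.
Proof.
elim: p => [|[k u] p IH] /=; first by rewrite cmul0x.
by rewrite nc_sem_add nc_sem_shift IH cmulDl cmulZl.
Qed.

Lemma nc_sem_norm env e : nc_sem env (nc_norm e) = nc_eval env e.
Proof.
elim: e => [n|||a IHa b IHb|a IHa|a IHa b IHb|k a IHa] //=.
- by rewrite cmulx1 scale1r addr0.
- by rewrite scale1r addr0.
- by rewrite nc_sem_add IHa IHb.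
- by rewrite nc_sem_scale IHa scaleN1r.
- by rewrite nc_sem_mul IHa IHb.
- by rewrite nc_sem_scale IHa.
Qed.

Lemma nc_sem_null env p : nc_null p -> nc_sem env p = 0.
Proof. by elim: p => [//|[k w] p IH] /= [-> /IH ->]; rewrite scale0r addr0. Qed.

Lemma nc_correct env e1 e2 :
  nc_null (nc_norm (NcAdd e1 (NcOpp e2))) -> nc_eval env e1 = nc_eval env e2.
Proof.
move=> /(nc_sem_null env); rewrite nc_sem_norm /= => /eqP.
by rewrite subr_eq0 => /eqP.
Qed.

End NcReflection.

Ltac nc_index x env :=
  match env with
  | cons x _ => constr:(O)
  | cons _ ?t => let n := nc_index x t in constr:(S n)
  end.

Ltac nc_insert x env :=
  match env with
  | _ => let n := nc_index x env in env
  | _ => constr:(cons x env)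
  end.

Ltac nc_atoms env e :=
  lazymatch e with
  | @GRing.add _ ?a ?b => let env1 := nc_atoms env a in nc_atoms env1 b
  | @GRing.opp _ ?a => nc_atoms env a
  | @cmul _ _ ?a ?b => let env1 := nc_atoms env a in nc_atoms env1 b
  | @GRing.scale _ _ _ ?a => nc_atoms env a
  | @GRing.zero _ => env
  | @cone _ _ => env
  | _ => nc_insert e env
  end.

Ltac nc_reify K env e :=
  lazymatch e with
  | @GRing.add _ ?a ?b =>
      let a' := nc_reify K env a in let b' := nc_reify K env b in
      constr:(@NcAdd K a' b')
  | @GRing.opp _ ?a => let a' := nc_reify K env a in constr:(@NcOpp K a')
  | @cmul _ _ ?a ?b =>
      let a' := nc_reify K env a in let b' := nc_reify K env b in
      constr:(@NcMul K a' b')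
  | @GRing.scale _ _ ?k ?a =>
      let a' := nc_reify K env a in constr:(@NcScale K k a')
  | @GRing.zero _ => constr:(@NcZero K)
  | @cone _ _ => constr:(@NcOne K)
  | _ => let n := nc_index e env in constr:(@NcVar K n)
  end.

(** A coefficient equation that [ring] does not close stays as a goal, which is why some calls are
    followed by [field]. *)
Ltac nc_split :=
  match goal with
  | |- True => exact I
  | |- _ /\ _ => split; [try by ring | nc_split]
  end.

Ltac nc_ring_in R A :=
  lazymatch goal with
  | |- @eq _ ?a ?b =>
    let T := constr:(UnitalCstarAlgebra.sort A) in
    let env0 := constr:(@nil T) in
    let env1 := nc_atoms env0 a in
    let env := nc_atoms env1 b in
    let K := constr:(R[i] : Type) in
    let K := eval cbv beta in K in
    let e1 := nc_reify K env a in
    let e2 := nc_reify K env b in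
    apply: (@nc_correct R A env e1 e2);
    cbv [nc_null nc_norm nc_add nc_add1 nc_scale nc_shift nc_mul word_eqb
         eqn andb List.app];
    nc_split
  end.

(** * Square roots and positive elements *)

Section Monotone.
Variable R : realType.

Lemma nondecreasing_fundamental (s : nat -> R) (C : R) :
  (forall n, s n <= s n.+1) -> (forall n, s n <= C) ->
  forall e, 0 < e -> exists N, forall k, (N <= k)%N -> s k - s N < e.
Proof.
move=> hs hC e e0.
have hsup : has_sup (range s).
  by split; [exists (s 0%N), 0%N|exists C => _ [n _ <-]].
have [_ [N _ <-] hN] := sup_adherent e0 hsup.
exists N => k _; have : s k <= sup (range s).
  by apply: sup_upper_bound => //; exists k.
lra.
Qed.

(** Method of majorants; it serves both the square root iteration and the Neumann series. *)
Lemma dominated_tends (V : completeNormedModType R[i]) (u : nat -> V)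
    (s : nat -> R) (C : R) :
  (forall n, nrm (u n.+1 - u n) <= s n.+1 - s n) -> (forall n, s n <= C) ->
  exists l, tends (@nrm R V) u l.
Proof.
move=> hu hC; apply: complete_tends.
have hs n : s n <= s n.+1 by have := hu n; have := nrm_ge0 (u n.+1 - u n); lra.
have hd n m : nrm (u (n + m)%N - u n) <= s (n + m)%N - s n.
  elim: m => [|m IH]; first by rewrite addn0 !subrr nrm0.
  rewrite addnS; have := hu (n + m)%N => h.
  have := seminorm_triangle (nrm_seminorm V) (u (n + m)%N) (u (n + m).+1) (u n).
  lra.
move=> e e0; have e2 : 0 < e / 2 by lra.
have [N hN] := nondecreasing_fundamental hs hC e2.
have hd' k : (N <= k)%N -> nrm (u k - u N) < e / 2.
  by move=> hk; have := hd N (k - N)%N; rewrite subnKC //; have := hN _ hk; lra.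
exists N => j k /hd' h1 /hd' h2.
have := seminorm_triangle (nrm_seminorm V) (u N) (u j) (u k).
rewrite (seminorm_dist (nrm_seminorm V) (u N) (u k)); lra.
Qed.

End Monotone.

(** * Square roots near the unit, by iteration *)

Section SquareRoot.
Variables (R : realType) (A : unitalCstarAlgType R).
Implicit Types (x y z a b h k : A).

Definition sa x := cstar x = x.

Lemma cstar1 : cstar (cone : A) = cone.
Proof. by have := cmul1x (cstar (cone : A)); rewrite -{1}[cone]cstarK -cstarM cmul1x cstarK. Qed.

Lemma nrm1_le : nrm (cone : A) <= 1.
Proof.
have := nrm_cstar_cmul (cone : A); rewrite cstar1 cmul1x.
have := nrm_ge0 (cone : A); nra.
Qed.

(** A fixed point [y] of [y = (b + y^2) / 2] satisfies [(1 - y)^2 = 1 - b]. *)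
Fixpoint root_iter b n : A :=
  if n is m.+1 then 2^-1 *: (b + root_iter b m ** root_iter b m) else 0.

(** The same iteration at the scalar [b = 1]; it increases, stays below 1, and majorizes the one in
    [A] whenever [nrm b <= 1]. *)
Fixpoint root_bound n : R :=
  if n is m.+1 then 2^-1 * (1 + root_bound m ^+ 2) else 0.

Lemma root_bound_le1 n : 0 <= root_bound n <= 1.
Proof. by elim: n => [|n /andP[h1 h2]] /=; apply/andP; split; nra. Qed.

Lemma half_realC : (2^-1 : R[i]) = (2^-1 : R)%:C.
Proof. by rewrite fmorphV rmorphMn. Qed.

Lemma nrm_half x : nrm ((2^-1 : R[i]) *: x) = 2^-1 * nrm x.
Proof.
by rewrite half_realC nrmZr ger0_norm // invr_ge0.
Qed.

Lemma nrm_root_iter b n : nrm b <= 1 -> nrm (root_iter b n) <= root_bound n.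
Proof.
move=> hb; elim: n => [|n IH] /=; first by rewrite nrm0.
rewrite nrm_half ler_pM2l ?invr_gt0 //.
apply: le_trans (nrmD _ _) _; apply: lerD => //.
apply: le_trans (nrm_cmul _ _) _; rewrite expr2.
by apply: ler_pM => //; apply: nrm_ge0.
Qed.

Lemma nrm_root_iterS b n : nrm b <= 1 ->
  nrm (root_iter b n.+1 - root_iter b n) <= root_bound n.+1 - root_bound n.
Proof.
move=> hb; elim: n => [|n IH].
  by rewrite /= cmul0x addr0 !subr0 nrm_half expr0n addr0 mulr1 ler_piMr // invr_ge0.
(* A difference of squares written as [u (u - v) + (u - v) v], which is valid without commutation;
   the majorant obeys the same identity. *)
have e : root_iter b n.+2 - root_iter b n.+1 = (2^-1 : R[i]) *:
    (root_iter b n.+1 ** (root_iter b n.+1 - root_iter b n)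
     + (root_iter b n.+1 - root_iter b n) ** root_iter b n).
  have E m : root_iter b m.+1 = 2^-1 *: (b + root_iter b m ** root_iter b m) by [].
  transitivity (2^-1 *: (b + root_iter b n.+1 ** root_iter b n.+1)
                - 2^-1 *: (b + root_iter b n ** root_iter b n)); first by rewrite -!E.
  move: (root_iter b n.+1) (root_iter b n) => u v; nc_ring_in R A.
rewrite e nrm_half.
have h1 := nrm_cmul (root_iter b n.+1) (root_iter b n.+1 - root_iter b n).
have h2 := nrm_cmul (root_iter b n.+1 - root_iter b n) (root_iter b n).
have h3 := nrmD (root_iter b n.+1 ** (root_iter b n.+1 - root_iter b n))
  ((root_iter b n.+1 - root_iter b n) ** root_iter b n).
have h4 := nrm_root_iter n hb; have h5 := nrm_root_iter n.+1 hb.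
have h6 := nrm_ge0 (root_iter b n); have h7 := nrm_ge0 (root_iter b n.+1).
have h8 := nrm_ge0 (root_iter b n.+1 - root_iter b n).
have -> : root_bound n.+2 - root_bound n.+1 =
  2^-1 * (root_bound n.+1 * (root_bound n.+1 - root_bound n)
   + (root_bound n.+1 - root_bound n) * root_bound n).
  transitivity (2^-1 * (1 + root_bound n.+1 ^+ 2) - 2^-1 * (1 + root_bound n ^+ 2)) => //.
  by move: (root_bound n.+1) (root_bound n) => u v; ring.
rewrite ler_pM2l ?invr_gt0 //; apply: le_trans h3 _; apply: lerD.
  by apply: le_trans h1 _; apply: ler_pM.
by apply: le_trans h2 _; apply: ler_pM.
Qed.

Lemma root_iter_tends b : nrm b <= 1 -> exists y, tends (@nrm R A) (root_iter b) y.
Proof.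
move=> hb; apply: (@dominated_tends _ _ _ root_bound 1) => n.
  exact: nrm_root_iterS.
by case/andP: (root_bound_le1 n).
Qed.

(** This is the square root of [1 - b]; it is meaningful for [nrm b <= 1], and the default 0 of
    [xget] covers a divergent iteration. *)
Definition root1 b : A := cone - xget 0 [set y | tends (@nrm R A) (root_iter b) y].

Lemma root1_tends b : nrm b <= 1 -> tends (@nrm R A) (root_iter b) (cone - root1 b).
Proof.
move=> /root_iter_tends[y hy]; rewrite /root1 subKr.
by apply: (@xgetPex _ 0 [set z | tends (@nrm R A) (root_iter b) z]); exists y.
Qed.

Lemma tends_uniq (u : nat -> A) x y :
  tends (@nrm R A) u x -> tends (@nrm R A) u y -> x = y.
Proof. by apply: tends_unique; [exact: nrm_seminorm|exact: nrm0_eq0]. Qed.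

Lemma tends_shift1 (u : nat -> A) x : tends (@nrm R A) u x ->
  tends (@nrm R A) (fun n => u n.+1) x.
Proof.
by move=> /(tends_tail 1); apply: tends_ext => n; rewrite addn1.
Qed.

Lemma root1_sqr b : nrm b <= 1 -> root1 b ** root1 b = cone - b.
Proof.
move=> hb; have h := root1_tends hb; set y := cone - root1 b in h.
have e : y = 2^-1 *: (b + y ** y).
  apply: (tends_uniq (tends_shift1 h)); apply: tendsZ.
  apply: tendsD; [exact: nrm_seminorm| |exact: tends_cmul].
  by apply: tends_cst; exact: nrm_seminorm.
have -> : root1 b = cone - y by rewrite /y subKr.
have -> : (cone - y) ** (cone - y) = cone - (2:R[i]) *: y + y ** y.
  by nc_ring_in R A.
rewrite {1}e; nc_ring_in R A; by field.
Qed.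

Lemma root1_nrm b : nrm b <= 1 -> nrm (cone - root1 b) <= 1.
Proof.
move=> hb; apply: (tends_norm_le (nrm_seminorm A) (root1_tends hb)) => n.
apply: le_trans (nrm_root_iter n hb) _; by case/andP: (root_bound_le1 n).
Qed.

Lemma cstar_half x : cstar ((2^-1 : R[i]) *: x) = 2^-1 *: cstar x.
Proof. by rewrite half_realC cstarZr. Qed.

Lemma root1_sa b : nrm b <= 1 -> sa b -> sa (root1 b).
Proof.
move=> hb sb; have h := root1_tends hb.
have hn n : cstar (root_iter b n) = root_iter b n.
  elim: n => [|n IH] /=; first exact: cstar0.
  by rewrite cstar_half cstarD cstarM IH sb.
have := tends_uniq h (tends_ext hn (tends_cstar h)).
by rewrite cstarB cstar1 => /addrI /oppr_inj.
Qed.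

(** Commutation with all that commutes with [b] passes to the limit. Together with the square root
    itself, it replaces the continuous functional calculus. *)
Lemma root1_comm b z : nrm b <= 1 -> z ** b = b ** z ->
  z ** root1 b = root1 b ** z.
Proof.
move=> hb zb; have h := root1_tends hb.
have hn n : z ** root_iter b n = root_iter b n ** z.
  elim: n => [|n IH] /=; first by rewrite cmul0x cmulx0.
  rewrite cmulZr cmulZl cmulDl cmulDr zb; congr (_ *: (_ + _)).
  by rewrite cmulA IH -cmulA IH cmulA.
have hz : tends (@nrm R A) (fun=> z) z by apply: tends_cst; exact: nrm_seminorm.
have := tends_uniq (tends_ext hn (tends_cmul hz h)) (tends_cmul h hz).
by rewrite cmulBl cmulBr cmulx1 cmul1x => /addrI /oppr_inj.
Qed.

End SquareRoot.

(** * The positive cone *)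

Section Positive.
Variables (R : realType) (A : unitalCstarAlgType R).
Implicit Types (x y z a b d h k : A).

Definition rone (t : R) : A := t%:C *: cone.

Lemma sa_rone t : sa (rone t).
Proof. by rewrite /sa cstarZr cstar1. Qed.

Lemma saD x y : sa x -> sa y -> sa (x + y).
Proof. by rewrite /sa cstarD => -> ->. Qed.

Lemma saN x : sa x -> sa (- x).
Proof. by rewrite /sa cstarN => ->. Qed.

Lemma saZ (t : R) x : sa x -> sa (t%:C *: x).
Proof. by rewrite /sa cstarZr => ->. Qed.

Lemma sa1 : sa (cone : A). Proof. exact: cstar1. Qed.

Lemma comm_mul x a b : x ** a = a ** x -> x ** b = b ** x ->
  x ** (a ** b) = (a ** b) ** x.
Proof. by move=> xa xb; rewrite cmulA xa -cmulA xb cmulA. Qed.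

Lemma saM x y : sa x -> sa y -> x ** y = y ** x -> sa (x ** y).
Proof. by rewrite /sa cstarM => -> -> ->. Qed.

Lemma sa_sq x : sa x -> sa (x ** x).
Proof. by move=> h; apply: saM. Qed.

Lemma sa_xx x : sa (cstar x ** x).
Proof. by rewrite /sa cstarM cstarK. Qed.

Lemma nrm_sa_sq x : sa x -> nrm (x ** x) = nrm x ^+ 2.
Proof. by move=> h; rewrite -nrm_cstar_cmul h. Qed.

Lemma sa_sq_eq0 x : sa x -> x ** x = 0 -> x = 0.
Proof. by move=> h e; apply: cstar_cmul_eq0; rewrite h. Qed.

(** Since [a = t (1 - (1 - a / t))], this is a square root of [a] as soon as [nrm (t - a) <= t]. *)
Definition sqrtp (t : R) a : A := (Num.sqrt t)%:C *: root1 (cone - (t^-1)%:C *: a).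

(** Squares of self-adjoint elements come with a root at once; that every [x^* x] is one of them is
    the harder [pos_xx]. *)
Definition pos a := exists2 h, sa h & a = h ** h.

Lemma pos_sa a : pos a -> sa a.
Proof. by move=> [h sh ->]; apply: sa_sq. Qed.

Section SqrtPositive.
Variables (t : R) (a : A).
Hypotheses (t0 : 0 < t) (ha : nrm (rone t - a) <= t).

Lemma sqrtp_dom : nrm (cone - (t^-1)%:C *: a) <= 1.
Proof.
have -> : cone - (t^-1)%:C *: a = (t^-1)%:C *: (rone t - a).
  by rewrite /rone scalerBr scalerA -rmorphM mulVf ?gt_eqF // scale1r.
by rewrite nrmZr gtr0_norm ?invr_gt0 // ler_pdivrMl // mulr1.
Qed.

Lemma sqrtp_sqr : sqrtp t a ** sqrtp t a = a.
Proof.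
rewrite /sqrtp cmulZl cmulZr scalerA root1_sqr ?sqrtp_dom // subKr scalerA.
by rewrite -!rmorphM -expr2 sqr_sqrtr ?(ltW t0) // mulfV ?gt_eqF // scale1r.
Qed.

Lemma sqrtp_sa : sa a -> sa (sqrtp t a).
Proof.
move=> sA; apply: saZ; apply: root1_sa; rewrite ?sqrtp_dom //.
by apply: saD; [exact: sa1|apply: saN; apply: saZ].
Qed.

Lemma sqrtp_comm z : z ** a = a ** z -> z ** sqrtp t a = sqrtp t a ** z.
Proof.
move=> za; rewrite /sqrtp cmulZl cmulZr root1_comm ?sqrtp_dom //.
by rewrite cmulBl cmulBr cmulx1 cmul1x cmulZl cmulZr za.
Qed.

Lemma sqrtp_nrm : nrm (rone (Num.sqrt t) - sqrtp t a) <= Num.sqrt t.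
Proof.
rewrite /rone /sqrtp -scalerBr nrmZr ger0_norm ?sqrtr_ge0 //.
by rewrite ler_piMr ?sqrtr_ge0 // root1_nrm // sqrtp_dom.
Qed.

End SqrtPositive.

(* [h + i k] is a unitary. *)
Lemma nrm_cos_sin h k : sa h -> sa k -> h ** k = k ** h ->
  h ** h + k ** k = cone -> nrm h <= 1.
Proof.
move=> sh sk hk e; have i2 : ('i : R[i]) * 'i = -1 by rewrite -expr2 sqrCi.
pose u := h + 'i *: k.
have su : cstar u = h - 'i *: k.
  by rewrite /u cstarD cstarZ sh sk conjCi scaleNr.
have n1 (v w : A) : cstar v = w -> w ** v = cone -> nrm v <= 1.
  move=> <- ev; have : nrm (cone : A) = nrm v ^+ 2 by rewrite -ev nrm_cstar_cmul.
  have : nrm (cone : A) <= 1 by exact: nrm1_le.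
  have v0 : 0 <= nrm v by exact: nrm_ge0.
  nra.
have key (c : R[i]) : c * c = -1 -> (h - c *: k) ** (h + c *: k) = cone.
  move=> c2; rewrite -e.
  have -> : (h - c *: k) ** (h + c *: k) =
    h ** h - (c * c) *: (k ** k) + c *: (h ** k - k ** h) by nc_ring_in R A.
  by rewrite hk subrr scaler0 addr0 c2 scaleN1r opprK.
have nu : nrm u <= 1 by apply: (n1 _ _ su); apply: key.
have nus : nrm (cstar u) <= 1 by rewrite nrm_cstar.
have -> : h = 2^-1 *: (u + cstar u).
  by rewrite su /u; nc_ring_in R A; field.
rewrite nrm_half.
have : nrm (u + cstar u) <= nrm u + nrm (cstar u) by exact: nrmD.
lra.
Qed.

(** With [g = h / sqrt t] and [k] the square root of [1 - g^2], the element [k + i g] is unitary, so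
    [nrm k <= 1], and [t - h^2 = t k^2]. Together with the converse [nrm_pos], this turns positivity
    into a norm estimate, stable under sums and limits. *)
Lemma pos_nrm a t : pos a -> nrm a <= t -> nrm (rone t - a) <= t.
Proof.
move=> [h sh ->]; rewrite nrm_sa_sq // => ht.
have := le_trans (sqr_ge0 _) ht; rewrite le_eqVlt => /orP[/eqP t0|t0].
  have h0 : h = 0.
    apply: nrm0_eq0; apply/eqP; rewrite -sqrf_eq0; apply/eqP.
    by apply/eqP; rewrite eq_le sqr_ge0 t0 ht.
  by rewrite h0 cmul0x -t0 /rone scale0r subrr nrm0.
pose g := ((Num.sqrt t)^-1)%:C *: h.
have s0 : 0 < Num.sqrt t by rewrite sqrtr_gt0.
have sg : sa g by apply: saZ.
have gh : nrm g <= 1.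
  rewrite nrmZr gtr0_norm ?invr_gt0 // ler_pdivrMl // mulr1.
  by rewrite -(ger0_norm (nrm_ge0 h)) -sqrtr_sqr; apply: ler_wsqrtr.
have ngg : nrm (g ** g) <= 1 by rewrite nrm_sa_sq // expr_le1 // nrm_ge0.
pose k := root1 (g ** g).
have sk : sa k by apply: root1_sa => //; apply: sa_sq.
have kk : k ** k = cone - g ** g by rewrite root1_sqr.
have gk : g ** k = k ** g by apply: root1_comm => //; rewrite cmulA.
have hk : nrm k <= 1.
  by apply: (nrm_cos_sin sk sg); rewrite ?gk ?kk ?subrK.
have -> : rone t - h ** h = t%:C *: (k ** k).
  rewrite kk /g cmulZl cmulZr scalerA scalerBr scalerA -!rmorphM -invfM.
  by rewrite -expr2 sqr_sqrtr ?(ltW t0) // mulfV ?gt_eqF // scale1r.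
rewrite nrmZr gtr0_norm // nrm_sa_sq // ler_piMr ?(ltW t0) //.
by rewrite expr_le1 // nrm_ge0.
Qed.

Lemma nrm_pos_sqrt a t : sa a -> 0 < t -> nrm (rone t - a) <= t ->
  exists h, [/\ sa h, h ** h = a, nrm (rone (Num.sqrt t) - h) <= Num.sqrt t &
    forall z, z ** a = a ** z -> z ** h = h ** z].
Proof.
move=> sA t0 ht; exists (sqrtp t a); split.
- exact: sqrtp_sa.
- exact: sqrtp_sqr.
- exact: sqrtp_nrm.
- by move=> z; apply: sqrtp_comm.
Qed.

Lemma nrm_pos a t : sa a -> nrm (rone t - a) <= t -> pos a.
Proof.
move=> sA ht; have := le_trans (nrm_ge0 _) ht.
rewrite le_eqVlt => /orP[/eqP t0|t0].
  suff -> : a = 0 by exists 0; rewrite /sa ?cstar0 ?cmul0x.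
  apply: nrm0_eq0; apply/eqP; rewrite eq_le nrm_ge0 andbT.
  by move: ht; rewrite -t0 /rone scale0r sub0r nrmN.
by have [h [sh <- _ _]] := nrm_pos_sqrt sA t0 ht; exists h.
Qed.

Lemma pos_sqrt a : pos a -> exists h, [/\ sa h, h ** h = a, pos h &
    forall z, z ** a = a ** z -> z ** h = h ** z].
Proof.
move=> pa; have n0 := nrm_ge0 a.
have [|||h [h1 h2 h3 h4]] := @nrm_pos_sqrt a (nrm a + 1).
- exact: pos_sa.
- lra.
- by apply: pos_nrm => //; lra.
by exists h; split=> //; apply: nrm_pos h3.
Qed.

Lemma pos0 : pos 0.
Proof. by exists 0; rewrite /sa ?cstar0 ?cmul0x. Qed.

Lemma posD a b : pos a -> pos b -> pos (a + b).
Proof.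
move=> pa pb; apply: (@nrm_pos _ (nrm a + nrm b)).
  by apply: saD; apply: pos_sa.
have -> : rone (nrm a + nrm b) - (a + b) = (rone (nrm a) - a) + (rone (nrm b) - b).
  by rewrite /rone rmorphD scalerDl opprD addrACA.
by apply: le_trans (nrmD _ _) _; apply: lerD; apply: pos_nrm.
Qed.

Lemma pos_sum (I : Type) (r : seq I) (P : pred I) (F : I -> A) :
  (forall i, P i -> pos (F i)) -> pos (\sum_(i <- r | P i) F i).
Proof. by move=> h; elim/big_rec: _ => [|i x Pi]; [exact: pos0|apply: posD; apply: h]. Qed.

Lemma posZ (t : R) a : 0 <= t -> pos a -> pos (t%:C *: a).
Proof.
move=> t0 [h sh ->]; exists ((Num.sqrt t)%:C *: h); first exact: saZ.
by rewrite cmulZl cmulZr scalerA -rmorphM -expr2 sqr_sqrtr.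
Qed.

Lemma pos1 : pos cone.
Proof. by exists cone; rewrite ?cmul1x //; apply: sa1. Qed.

Lemma pos_rone t : 0 <= t -> pos (rone t).
Proof. by move=> t0; apply: posZ => //; apply: pos1. Qed.

Lemma pos_tends (u : nat -> A) a : (forall n, pos (u n)) ->
  tends (@nrm R A) u a -> pos a.
Proof.
move=> pu ua; have [C hC] := tends_bounded (nrm_seminorm A) ua.
have sA : sa a.
  apply: (tends_uniq _ ua); apply: (tends_ext _ (tends_cstar ua)) => n.
  exact: pos_sa.
apply: (@nrm_pos _ C sA).
have h : tends (@nrm R A) (fun n => rone C - u n) (rone C - a).
  by apply: tendsB ua; [exact: nrm_seminorm|apply: tends_cst; exact: nrm_seminorm].
by apply: (tends_norm_le (nrm_seminorm A) h) => n; apply: pos_nrm.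
Qed.

(** Let [a = h^2] and [- a = k^2] with [h] and [k] commuting. Then [z = h + i k] has
    [z^* z = h^2 + k^2 = 0], so [z] and its adjoint [h - i k] both vanish. *)
Lemma pos_anti a : pos a -> pos (- a) -> a = 0.
Proof.
move=> [h sh e] /pos_sqrt[k [sk ek _ ck]].
have hk : h ** k = k ** h by apply: ck; rewrite cmulNr cmulNl e cmulA.
have i2 : ('i : R[i]) * 'i = -1 by rewrite -expr2 sqrCi.
have : h + 'i *: k = 0.
  apply: cstar_cmul_eq0; rewrite cstarD cstarZ sh sk conjCi.
  have -> : (h + - 'i *: k) ** (h + 'i *: k) =
     h ** h - ('i * 'i) *: (k ** k) + 'i *: (h ** k - k ** h) by nc_ring_in R A.
  by rewrite hk subrr scaler0 addr0 i2 scaleN1r opprK ek e subrr.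
move=> /[dup] z0 /(congr1 (@cstar R A)).
rewrite cstarD cstarZ sh sk conjCi cstar0 => z1.
have h0 : h = 0.
  have -> : h = 2^-1 *: ((h + 'i *: k) + (h + - 'i *: k)).
    by nc_ring_in R A; field.
  by rewrite z0 z1 addr0 scaler0.
by rewrite e h0 cmul0x.
Qed.

Lemma pos_cmul a b : pos a -> pos b -> a ** b = b ** a -> pos (a ** b).
Proof.
move=> pa pb ab; have [h [sh eh _ ch]] := pos_sqrt pa.
have [k [sk ek _ ck]] := pos_sqrt pb.
have hb : h ** b = b ** h by rewrite ch // ab.
have hk : h ** k = k ** h by apply: ck.
exists (h ** k); first exact: saM.
rewrite -eh -ek -!cmulA; congr (_ ** _).
by rewrite !cmulA hk.
Qed.

Lemma pos_rone_nrm a t : sa a -> nrm a <= t -> pos (rone t - a).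
Proof.
move=> sA ht; apply: (@nrm_pos _ t).
  by apply: saD; [exact: sa_rone|exact: saN].
by rewrite subKr.
Qed.

(** The square roots of [a / t] and [1 - a / t] are the real and imaginary parts of a unitary, so
    both have norm at most 1. *)
Lemma pos_le_nrm a t : 0 <= t -> pos a -> pos (rone t - a) -> nrm a <= t.
Proof.
rewrite le_eqVlt => /orP[/eqP <- pa|t0 [h sh eh] pt].
  by rewrite /rone scale0r sub0r => /(pos_anti pa) ->; rewrite nrm0.
have [k [sk ek _ ck]] := pos_sqrt pt.
have hk : h ** k = k ** h.
  by apply: ck; rewrite cmulBr cmulBl eh cmulA cmulZl cmulZr cmulx1 cmul1x.
pose s := ((Num.sqrt t)^-1)%:C : R[i].
have s0 : 0 < Num.sqrt t by rewrite sqrtr_gt0.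
have ss : s * s = (t^-1)%:C.
  by rewrite -rmorphM -invfM -expr2 sqr_sqrtr ?ltW.
have : nrm (s *: h) <= 1.
  apply: (@nrm_cos_sin _ (s *: k)); rewrite ?cmulZl ?cmulZr ?scalerA.
  - exact: saZ.
  - exact: saZ.
  - by rewrite hk.
  rewrite ss ek -eh -scalerDr addrC subrK /rone scalerA -rmorphM mulVf ?gt_eqF //.
  by rewrite scale1r.
rewrite nrmZr gtr0_norm ?invr_gt0 // ler_pdivrMl // mulr1 => h1.
rewrite eh nrm_sa_sq // -[leRHS]sqr_sqrtr ?(ltW t0) //.
by rewrite ler_sqr ?nnegrE ?nrm_ge0 // ltW.
Qed.

Lemma comm_rone x t : x ** rone t = rone t ** x.
Proof. by rewrite cmulZl cmulZr cmulx1 cmul1x. Qed.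

(* If [y^* y = -d] with [d >= 0] then [b = y y^*] is positive, so that
   [y (1 + c d)^n = (1 - c b)^n y] stays bounded, whereas
   [(1 + c d)^n >= 1 + n c d]. *)
Lemma cstar_cmul_neg k y : sa k -> cstar y ** y = - (k ** k) -> y = 0.
Proof.
move=> sk ey; set d := k ** k in ey.
have pd : pos d by exists k.
have sd := pos_sa pd.
have pb : pos (y ** cstar y).
  (* With [u] and [v] the self-adjoint parts of [y] up to sign, [y y^* + y^* y = 2 u^2 + 2 v^2], and
     here [y^* y = - d]. *)
  pose u := 2^-1 *: (y + cstar y); pose v := 2^-1 *: ('i *: (cstar y - y)).
  have su : sa u by rewrite /sa cstar_half cstarD cstarK addrC.
  have sv : sa v.
    by rewrite /sa cstar_half cstarZ conjCi cstarB cstarK scaleNr -scalerN opprB.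
  have i2 : ('i : R[i]) * 'i = -1 by rewrite -expr2 sqrCi.
  have -> : y ** cstar y = u ** u + u ** u + (v ** v + v ** v) + d.
    rewrite -[d]opprK -ey.
    have -> : v ** v = (2^-1 * 2^-1) *: (('i * 'i) *: ((cstar y - y) ** (cstar y - y))).
      by rewrite /v; nc_ring_in R A.
    rewrite i2 /u; nc_ring_in R A; by field.
  apply: posD pd; apply: posD; apply: posD; by [exists u|exists v].
set b := y ** cstar y in pb.
pose T := nrm b + 1; have T0 : 0 < T by rewrite /T; have := nrm_ge0 b; lra.
pose c : R := T^-1; have c0 : 0 < c by rewrite invr_gt0.
have cT : c * T = 1 by rewrite /c mulVf // gt_eqF.
pose F := cone - c%:C *: b; pose G := cone + c%:C *: d.
have hF : nrm F <= 1.
  have h : nrm (rone T - b) <= T by apply: pos_nrm => //; rewrite /T; lra.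
  have -> : F = c%:C *: (rone T - b).
    by rewrite /F /rone scalerBr scalerA -rmorphM cT scale1r.
  by rewrite nrmZr gtr0_norm // ler_pdivrMl // mulr1.
have Fy : F ** y = y ** G.
  have -> : y ** G = y ** (cone - c%:C *: (cstar y ** y)) by rewrite ey /G scalerN opprK.
  by rewrite /F /G /b; nc_ring_in R A.
pose E n := iter n (fun z => z ** G) cone.
have ES n : E n.+1 = E n ** G by [].
have dG : d ** G = G ** d by rewrite /G; nc_ring_in R A.
have dE n : d ** E n = E n ** d.
  elim: n => [|n IH]; first by rewrite cmul1x cmulx1.
  by rewrite ES cmulA IH -cmulA dG cmulA.
have pG : pos G by apply: posD; [exact: pos1|apply: posZ => //; exact: ltW].
have pE n : pos (E n - cone - (n%:R * c)%:C *: d).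
  elim: n => [|n IH]; first by rewrite subrr mul0r scale0r subr0; exact: pos0.
  have -> : E n.+1 - cone - (n.+1%:R * c)%:C *: d =
    (E n - cone - (n%:R * c)%:C *: d) ** G + (n%:R * c * c)%:C *: (d ** d).
    by rewrite ES /G -natr1; nc_ring_in R A; ring.
  apply: posD; last by apply: posZ; [rewrite !mulr_ge0 // ltW|exists d].
  apply: pos_cmul => //; rewrite /G; move: (dE n); set X := E n => dX.
  have -> : (X - cone - (n%:R * c)%:C *: d) ** (cone + c%:C *: d) =
    (cone + c%:C *: d) ** (X - cone - (n%:R * c)%:C *: d) - c%:C *: (d ** X - X ** d).
    by nc_ring_in R A; ring.
  by rewrite dX subrr scaler0 subr0.
have sE n : sa (E n).
  have -> : E n = (E n - cone - (n%:R * c)%:C *: d) + (cone + (n%:R * c)%:C *: d).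
    by nc_ring_in R A; ring.
  apply: saD; first exact: pos_sa.
  by apply: saD; [exact: sa1|exact: saZ].
have hE n : nrm (y ** E n) <= nrm y.
  elim: n => [|n IH]; first by rewrite cmulx1.
  have -> : y ** E n.+1 = F ** (y ** E n).
    have EG m : G ** E m = E m ** G.
      by elim: m => [|m IHm]; rewrite ?cmul1x ?cmulx1 // ES cmulA IHm.
    by rewrite cmulA Fy -cmulA EG.
  apply: le_trans (nrm_cmul _ _) _.
  by have := nrm_ge0 (y ** E n); have := nrm_ge0 F; nra.
pose C := nrm y ^+ 2.
have hdE n : pos (rone C - d ** E n).
  apply: pos_rone_nrm; first by apply: saM.
  have -> : d ** E n = - (cstar y ** (y ** E n)) by rewrite cmulA ey cmulNl opprK.
  rewrite nrmN; apply: le_trans (nrm_cmul _ _) _; rewrite nrm_cstar /C expr2.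
  by apply: ler_wpM2l (hE n); apply: nrm_ge0.
(* Compare [d E_n <= C] with [d E_n >= d + n c d^2]; dividing by [n c] and letting [n] grow then
   gives [d^2 <= 0]. *)
have hn n : pos (rone C - (n%:R * c)%:C *: (d ** d)).
  have := posD (posD (hdE n) (pos_cmul pd (pE n) _)) pd.
  have -> : rone C - d ** E n + d ** (E n - cone - (n%:R * c)%:C *: d) + d =
    rone C - (n%:R * c)%:C *: (d ** d) by nc_ring_in R A; ring.
  apply; move: (dE n); set X := E n => dX.
  have -> : d ** (X - cone - (n%:R * c)%:C *: d) =
     (X - cone - (n%:R * c)%:C *: d) ** d + (d ** X - X ** d).
    by nc_ring_in R A; ring.
  by rewrite dX subrr addr0.
have : d ** d = 0.
  apply: pos_anti; first by exists d.
  apply: (@pos_tends (fun n => ((n.+1%:R * c)^-1)%:C *: (rone C - (n.+1%:R * c)%:C *: (d ** d)))).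
    by move=> n; apply: posZ => //; rewrite invr_ge0 mulr_ge0 // ltW.
  have e n : ((n.+1%:R * c)^-1)%:C *: (rone C - (n.+1%:R * c)%:C *: (d ** d))
      = (n.+1%:R^-1)%:C *: rone (c^-1 * C) - d ** d.
    have nc0 : n.+1%:R * c != 0 by rewrite mulf_neq0 ?pnatr_eq0 // gt_eqF.
    by rewrite scalerBr /rone !scalerA -!rmorphM mulVf // scale1r invfM -mulrA.
  apply: (tends_ext (fun n => esym (e n))).
  move=> eps eps0; pose K := nrm (rone (c^-1 * C)) + 1.
  have K0 : 0 < K by rewrite /K; have := nrm_ge0 (rone (c^-1 * C)); lra.
  have /inv_lt_eventually[N hN] : 0 < eps / K by rewrite divr_gt0.
  exists N => n /hN h; rewrite opprK subrK nrmZr ger0_norm ?invr_ge0 //.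
  move: h; rewrite ltr_pdivlMr //; apply: le_lt_trans; apply: ler_wpM2l.
    by rewrite invr_ge0.
  by rewrite /K; lra.
move=> /(sa_sq_eq0 sd) d0; apply: cstar_cmul_eq0; by rewrite ey d0 oppr0.
Qed.

Lemma sa_abs a : sa a -> exists s, [/\ pos s, s ** s = a ** a &
  forall z, z ** a = a ** z -> z ** s = s ** z].
Proof.
move=> sA; have [|s [_ es ps cs]] := @pos_sqrt (a ** a); first by exists a.
by exists s; split=> // z za; apply: cs; rewrite cmulA za -cmulA za cmulA.
Qed.

(** Let [q] be the absolute value of [n] and [m = (q - n) / 2] its negative part, so that
    [q m = m^2] and [m n = - m^2]. Then [m^5 = q m^4] is positive, and so is [- m^5 = m^2 n^3];
    hence [m^5 = 0] and [m = 0]. *)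
Lemma sa_cube_pos n : sa n -> pos (n ** n ** n) -> pos n.
Proof.
move=> sn /pos_sqrt[g [sg eg _ cg]].
have [q [pq eq cq]] := sa_abs sn.
have [r [sr er _ cr]] := pos_sqrt pq.
have sq := pos_sa pq.
have nq : n ** q = q ** n by apply: cq.
have nr : n ** r = r ** n by apply: cr.
have qr : q ** r = r ** q by apply: cr.
pose m := 2^-1 *: (q - n).
have sm : sa m by rewrite /sa cstar_half cstarB sq sn.
have rm : r ** m = m ** r by rewrite cmulZl cmulZr cmulBl cmulBr nr qr.
have mn : m ** n = - (m ** m).
  have -> : m ** n = - (m ** m) + (2^-1 * 2^-1) *: ((q ** q - n ** n) + (q ** n - n ** q)).
    by rewrite /m; nc_ring_in R A; field.
  by rewrite eq nq !subrr addr0 scaler0 addr0.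
have qm : q ** m = m ** m.
  have -> : q ** m = m ** m + (2^-1 * 2^-1) *: ((q ** q - n ** n) - (q ** n - n ** q)).
    by rewrite /m; nc_ring_in R A; field.
  by rewrite eq nq !subrr ?subr0 scaler0 addr0.
have nm : n ** m = m ** n.
  by rewrite cmulZl cmulZr cmulBl cmulBr nq.
have gm : m ** g = g ** m by apply: cg; do 2?apply: comm_mul.
have mn' z : z ** m ** n = - (z ** m ** m) by rewrite -cmulA mn cmulNr cmulA.
have m5 : m ** m ** m ** m ** m = 0.
  have rmm := comm_mul rm rm.
  apply: pos_anti.
    exists (r ** (m ** m)); first by apply: saM => //; exact: sa_sq.
    by rewrite -(cmulA r) (cmulA (m ** m)) -rmm !cmulA er qm.
  exists (m ** g); first exact: saM.
  have -> : m ** g ** (m ** g) = m ** m ** (g ** g).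
    by rewrite -(cmulA m) (cmulA g) -gm !cmulA.
  by rewrite eg !cmulA mn' !cmulNl mn' !(cmulNl, opprK) mn'.
have m2 : m ** m = 0.
  apply: (sa_sq_eq0 (sa_sq sm)); apply: (sa_sq_eq0 (sa_sq (sa_sq sm))).
  have -> : m ** m ** (m ** m) ** (m ** m ** (m ** m)) = (m ** m ** m ** m ** m) ** (m ** m ** m).
    by nc_ring_in R A.
  by rewrite m5 cmul0x.
have m0 : m = 0 by apply: sa_sq_eq0.
have -> : n = q - (2:R[i]) *: m by rewrite /m; nc_ring_in R A; field.
by rewrite m0 scaler0 subr0.
Qed.

(** With [s] the absolute value of [a] and [r] its root, the parts [z = (s + a) / 2] and
    [z = (s - a) / 2] satisfy [s z = z^2]. Hence [z^3 = (r z)^2] is positive, and positivity of [z]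
    follows from that of its cube. *)
Lemma sa_jordan a : sa a -> exists p n : A,
  [/\ pos p, pos n, a = p - n, p ** n = 0 & n ** p = 0].
Proof.
move=> sA; have [s [ps es cs]] := sa_abs sA.
have [r [sr er _ cr]] := pos_sqrt ps.
have ss := pos_sa ps.
have as_ : a ** s = s ** a by apply: cs.
have ar : a ** r = r ** a by apply: cr.
have sr' : s ** r = r ** s by apply: cr.
pose n := 2^-1 *: (s - a); pose p := 2^-1 *: (s + a).
have sn : sa n by rewrite /sa cstar_half cstarB ss sA.
have sp : sa p by rewrite /sa cstar_half cstarD ss sA.
have pn : p ** n = 0.
  have -> : p ** n = (2^-1 * 2^-1) *: ((s ** s - a ** a) + (a ** s - s ** a)).
    by rewrite /p /n; nc_ring_in R A.
  by rewrite es as_ !subrr addr0 scaler0.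
have np : n ** p = 0 by rewrite -[n]cstarK -[p]cstarK -cstarM sp sn pn cstar0.
have aE : a = p - n by rewrite /p /n; nc_ring_in R A; field.
have sE : s = p + n by rewrite /p /n; nc_ring_in R A; field.
have cube z : sa z -> r ** z = z ** r -> s ** z = z ** z -> pos z.
  move=> sz rz hz; apply: sa_cube_pos => //; exists (r ** z); first exact: saM.
  by rewrite [r ** z ** _]cmulA -(cmulA r z) -rz cmulA er hz.
exists p, n; split=> //.
- apply: cube => //; first by rewrite cmulZl cmulZr cmulDl cmulDr ar sr'.
  by rewrite sE cmulDl np addr0.
- apply: cube => //; first by rewrite cmulZl cmulZr cmulBl cmulBr ar sr'.
  by rewrite sE cmulDl pn add0r.
Qed.

(** Let [x^* x = p - n] be the Jordan decomposition. Then [(x n)^* (x n) = - n^3] is the negative of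
    a square, so [x n = 0] by [cstar_cmul_neg]; therefore [n^3 = 0] and [n = 0]. *)
Lemma pos_xx x : pos (cstar x ** x).
Proof.
have sx := sa_xx x; have [p [n [pp pn e pn0 np0]]] := sa_jordan sx.
have sn := pos_sa pn.
have [k [sk ek _ ck]] := pos_sqrt pn.
have kn : n ** k = k ** n by apply: ck.
have /cstar_cmul_neg h : cstar (x ** n) ** (x ** n) = - ((k ** n) ** (k ** n)).
  rewrite cstarM sn cmulA -(cmulA n) e cmulBr np0 sub0r cmulNl.
  by rewrite [k ** n ** _]cmulA -(cmulA k n) kn cmulA ek.
have xn : x ** n = 0 by apply: h; apply: saM.
have : n ** n ** n = 0.
  have := congr1 (fun z => cstar z ** (x ** n)) xn; rewrite cstar0 cmul0x cstarM sn.
  rewrite cmulA -(cmulA n) e cmulBr np0 sub0r cmulNl => /eqP; rewrite oppr_eq0.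
  by move/eqP.
move=> n3; have n0 : n = 0.
  apply: sa_sq_eq0 => //; apply: (sa_sq_eq0 (sa_sq sn)).
  by rewrite cmulA n3 cmul0x.
by rewrite e n0 subr0.
Qed.

Lemma posP a : pos a <-> exists x, a = cstar x ** x.
Proof.
split=> [[h sh ->]|[x ->]]; last exact: pos_xx.
by exists h; rewrite sh.
Qed.

Lemma pos_conj a x : pos a -> pos (cstar x ** a ** x).
Proof.
move=> [h sh ->]; have -> : cstar x ** (h ** h) ** x = cstar (h ** x) ** (h ** x).
  by rewrite cstarM sh !cmulA.
exact: pos_xx.
Qed.

End Positive.

(** * Homomorphisms *)

Section Neumann.
Variables (R : realType) (A : unitalCstarAlgType R).
Implicit Types (x y z a b c w : A).

(** The inverse of [1 - w] as the limit of [v |-> 1 + w v], majorized by the geometric series of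
    [r]. *)
Lemma neumann w (r : R) : nrm w <= r -> r < 1 -> sa w ->
  exists v, [/\ sa v, v = cone + w ** v & forall z, z ** w = w ** z -> z ** v = v ** z].
Proof.
move=> wr r1 sw; have r0 : 0 <= r := le_trans (nrm_ge0 w) wr.
pose u n := iter n (fun v => cone + w ** v) 0.
pose s n : R := \sum_(k < n) r ^+ k.
have r1' : 0 < 1 - r by lra.
have uS n : u n.+1 = cone + w ** u n by [].
have uD n : nrm (u n.+1 - u n) <= s n.+1 - s n.
  have -> : s n.+1 - s n = r ^+ n by rewrite /s big_ord_recr /= addrAC subrr add0r.
  elim: n => [|n IH].
    by rewrite uS /= cmulx0 addr0 subr0 expr0; exact: nrm1_le.
  have -> : u n.+2 - u n.+1 = w ** (u n.+1 - u n).
    transitivity ((cone + w ** u n.+1) - (cone + w ** u n)) => //.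
    by rewrite opprD addrACA subrr add0r cmulBr.
  apply: le_trans (nrm_cmul _ _) _; rewrite exprS.
  by apply: ler_pM => //; exact: nrm_ge0.
have sC n : s n <= (1 - r)^-1.
  rewrite -[leRHS]mul1r ler_pdivlMr //.
  have -> : s n * (1 - r) = 1 - r ^+ n.
    elim: n => [|n IH]; first by rewrite /s big_ord0 mul0r expr0 subrr.
    by rewrite /s big_ord_recr /= mulrDl IH exprS; ring.
  by rewrite lerBlDr lerDl exprn_ge0.
have [v hv] := dominated_tends uD sC.
have cst x : tends (@nrm R A) (fun=> x) x by apply: tends_cst; exact: nrm_seminorm.
have cu z n : z ** w = w ** z -> z ** u n = u n ** z.
  move=> zw; elim: n => [|n IH]; first by rewrite cmulx0 cmul0x.
  by rewrite uS cmulDr cmulDl cmulx1 cmul1x comm_mul.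
have su n : sa (u n).
  elim: n => [|n IH]; first exact: cstar0.
  by rewrite uS; apply: saD; [exact: sa1|apply: saM => //; apply: cu].
exists v; split.
- by apply: (tends_uniq _ hv); apply: (tends_ext su (tends_cstar hv)).
- apply: (tends_uniq (tends_shift1 hv)).
  by apply: tendsD; [exact: nrm_seminorm|exact: cst|exact: (tends_cmul (cst w) hv)].
move=> z zw; apply: (tends_uniq (tends_cmul (cst z) hv)).
by apply: (tends_ext _ (tends_cmul hv (cst z))) => n; rewrite cu.
Qed.

(* [s = t (t + c)^-1]. *)
Lemma pos_resolvent c (t : R) : pos c -> 0 < t ->
  exists s, [/\ pos s, pos (cone - s), s ** (rone A t + c) = rone A t &
    (rone A t + c) ** s = rone A t].
Proof.
move=> pc t0; have n0 := nrm_ge0 c; pose K := t + nrm c.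
have K0 : 0 < K by rewrite /K; lra.
have KV : K^-1 * K = 1 by rewrite mulVf // gt_eqF.
(* [t + c = K (1 - w)] with [nrm w <= nrm c / K < 1], so the Neumann series inverts [t + c]. *)
pose w := (K^-1)%:C *: (rone A (nrm c) - c).
have wr : nrm w <= K^-1 * nrm c.
  by rewrite nrmZr gtr0_norm ?invr_gt0 // ler_pM2l ?invr_gt0 //; apply: pos_nrm.
have r1 : K^-1 * nrm c < 1 by rewrite ltr_pdivrMl // mulr1 /K; lra.
have sc := pos_sa pc.
have sw : sa w by apply: saZ; apply: saD; [exact: sa_rone|exact: saN].
have [v [sv ev cv]] := neumann wr r1 sw.
have cw z : z ** c = c ** z -> z ** v = v ** z.
  by move=> zc; apply: cv; rewrite cmulZl cmulZr cmulBl cmulBr comm_rone zc.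
have e1 : rone A t + c = K%:C *: (cone - w).
  rewrite /w scalerBr scalerA -rmorphM mulrC KV scale1r /rone /K.
  by nc_ring_in R A; ring.
pose s := (t * K^-1)%:C *: v.
have sv1 : (rone A t + c) ** s = rone A t.
  rewrite e1 /s cmulZl cmulZr scalerA -rmorphM cmulBl cmul1x {1}ev addrK /rone.
  by rewrite mulrCA [K * _]mulrC KV mulr1.
have cs : c ** s = s ** c by rewrite /s cmulZl cmulZr cw.
have sv2 : s ** (rone A t + c) = rone A t.
  by rewrite -[RHS]sv1 cmulDl cmulDr cs comm_rone.
have ss : sa s by apply: saZ.
have tV : t^-1 * t = 1 by rewrite mulVf // gt_eqF.
have ps : pos s.
  have -> : s = (t^-1)%:C *: (cstar s ** (rone A t + c) ** s).
    by rewrite ss sv2 /rone cmulZl cmul1x scalerA -rmorphM tV scale1r.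
  apply: posZ; first by rewrite invr_ge0 ltW.
  by apply: pos_conj; apply: posD => //; apply: pos_rone; apply: ltW.
exists s; split=> //.
have -> : cone - s = (t^-1)%:C *: (c ** s).
  have -> : c ** s = rone A t - t%:C *: s.
    by have := sv1; rewrite cmulDl {1}/rone cmulZl cmul1x => <-; rewrite addrAC subrr add0r.
  rewrite scalerBr /rone [_ *: (_ *: cone)]scalerA [_ *: (_ *: s)]scalerA.
  by rewrite -rmorphM tV !scale1r.
by apply: posZ; [rewrite invr_ge0 ltW|apply: pos_cmul].
Qed.

End Neumann.

Section StarHom.
Variables (R : realType) (A C : unitalCstarAlgType R) (f : A -> C).
Hypotheses (hf : star_hom f) (f1 : f cone = cone).
Implicit Types (x y : A).

Lemma homD x y : f (x + y) = f x + f y.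
Proof. by case: hf => fl _ _; have := fl 1 x y; rewrite !scale1r. Qed.

Lemma hom0 : f 0 = 0.
Proof. by apply: (addrI (f 0)); rewrite -homD !addr0. Qed.

Lemma homZ k x : f (k *: x) = k *: f x.
Proof. by case: hf => fl _ _; have := fl k x 0; rewrite hom0 !addr0. Qed.

Lemma homN x : f (- x) = - f x.
Proof. by rewrite -scaleN1r homZ scaleN1r. Qed.

Lemma homB x y : f (x - y) = f x - f y.
Proof. by rewrite homD homN. Qed.

Lemma homM x y : f (x ** y) = f x ** f y.
Proof. by case: hf. Qed.

Lemma hom_star x : f (cstar x) = cstar (f x).
Proof. by case: hf. Qed.

Lemma hom_rone t : f (rone A t) = rone C t.
Proof. by rewrite homZ f1. Qed.

Lemma hom_pos x : pos x -> pos (f x).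
Proof. by move=> /posP[y ->]; rewrite homM hom_star; exact: pos_xx. Qed.

Lemma hom_contractive x : nrm (f x) <= nrm x.
Proof.
have : nrm (f x) ^+ 2 <= nrm x ^+ 2.
  rewrite -nrm_cstar_cmul; apply: pos_le_nrm; rewrite ?sqr_ge0 //.
    exact: pos_xx.
  rewrite -hom_star -homM -hom_rone -homB; apply: hom_pos.
  by apply: pos_rone_nrm; [exact: sa_xx|rewrite nrm_cstar_cmul].
by rewrite ler_sqr ?nnegrE ?nrm_ge0.
Qed.

(* [j = a s - a] where [s = r^2 (r^2 + c)^-1] and [c] is the positive part of
   [a^* a - r^2]. *)
Lemma hom_lift a (r : R) : 0 < r -> nrm (f a) <= r ->
  exists2 j, f j = 0 & nrm (a + j) <= r.
Proof.
move=> r0 far; set h := cstar a ** a; have ph : pos h by exact: pos_xx.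
have r2 : 0 < r ^+ 2 by rewrite exprn_gt0.
have sh := pos_sa ph.
have sr : sa (h - rone A (r ^+ 2)) by apply: saD => //; apply: saN; exact: sa_rone.
have [c [n [pc pn e cn nc]]] := sa_jordan sr.
pose w := rone C (r ^+ 2) - f h.
have pw : pos w.
  apply: pos_rone_nrm; first by apply: pos_sa; exact: hom_pos.
  rewrite /h homM hom_star nrm_cstar_cmul.
  by rewrite ler_sqr ?nnegrE ?nrm_ge0 // ltW.
have fcn : f c ** f n = 0 by rewrite -homM cn hom0.
(* As [f h <= r^2], the positive part of [h - r^2] should die: from [f c = f n - w] and
   [f c f n = 0] comes [(f c)^3 = - f c w f c <= 0]. *)
have fc0 : f c = 0.
  have e1 : f c = f n - w.
    have := congr1 f e; rewrite !homB hom_rone /w => e1.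
    by rewrite -[f c](subrK (f n)) -e1 opprB addrC.
  have e3 : f c ** f c ** f c = 0.
    apply: pos_anti.
      rewrite -!homM; apply: hom_pos; rewrite -{1}(pos_sa pc).
      exact: pos_conj.
    have -> : - (f c ** f c ** f c) = cstar (f c) ** w ** f c.
      have -> : w = f n - f c by rewrite e1 opprB addrCA subrr addr0.
      by rewrite -hom_star (pos_sa pc) cmulBr fcn sub0r !cmulNl.
    exact: pos_conj.
  have sfc : sa (f c) by apply: pos_sa; exact: hom_pos.
  apply: sa_sq_eq0 => //; apply: (sa_sq_eq0 (sa_sq sfc)).
  by rewrite cmulA e3 cmul0x.
have [s [ps p1s s1 s2]] := pos_resolvent pc r2.
have fs : f s = cone.
  have := congr1 f s1; rewrite homM homD fc0 addr0 hom_rone /rone cmulZr cmulx1.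
  move/(congr1 (fun z => ((r ^+ 2)^-1)%:C *: z)).
  by rewrite !scalerA -rmorphM mulVf ?gt_eqF // !scale1r.
exists (a ** s - a); first by rewrite homB homM fs cmulx1 subrr.
rewrite addrCA subrr addr0.
suff : nrm (a ** s) ^+ 2 <= r ^+ 2 by rewrite ler_sqr ?nnegrE ?nrm_ge0 // ltW.
rewrite -nrm_cstar_cmul; apply: pos_le_nrm; first exact: ltW.
  exact: pos_xx.
have ss := pos_sa ps.
(* Here [h = r^2 + c - n] and [s (r^2 + c) = r^2], so that [s h s = r^2 s - s n s]. *)
have -> : rone A (r ^+ 2) - cstar (a ** s) ** (a ** s) =
    (r ^+ 2)%:C *: (cone - s) + cstar s ** n ** s.
  have -> : n = rone A (r ^+ 2) + c - h by rewrite -[n]opprK -[- n](addrK c) (addrC (- n)) -e; nc_ring_in R A; ring.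
  have -> : cstar (a ** s) ** (a ** s) = s ** h ** s by rewrite cstarM ss /h !cmulA.
  rewrite ss cmulBr cmulBl s1 /rone; nc_ring_in R A; ring.
apply: posD; first by apply: posZ => //; exact: ltW.
exact: pos_conj.
Qed.

(** The correction [j] supplied by [hom_lift] lies in the kernel, so it vanishes when [f] is
    injective. *)
Lemma hom_isometric x : (forall y, f y = 0 -> y = 0) -> nrm (f x) = nrm x.
Proof.
move=> inj; apply/eqP; rewrite eq_le hom_contractive /=.
apply/ler_addgt0Pl => e e0.
have := nrm_ge0 (f x) => n0.
have [||j /inj -> ] := @hom_lift x (e + nrm (f x)); [lra|lra|].
by rewrite addr0.
Qed.

End StarHom.

(** * Hilbert modules and adjointable operators *)

Section SubLmodule.
Variables (K : nzRingType) (V : lmodType K).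

(** Subspaces cut out by a predicate in [Prop]: adjointable operators, corners, completions and
    kernel modules get their linear structure from it. *)
Record submod := Submod {
  sm_set :> V -> Prop;
  sm_0 : sm_set 0;
  sm_lin : forall (k : K) x y, sm_set x -> sm_set y -> sm_set (k *: x + y) }.

Definition sm_pred (s : submod) : {pred V} := fun x => `[< s x >].

Lemma sm_pred_closed (s : submod) : submod_closed (sm_pred s).
Proof.
split; first by apply/asboolP; exact: sm_0.
by move=> k x y /asboolP sx /asboolP sy; apply/asboolP; exact: sm_lin.
Qed.

HB.instance Definition _ (s : submod) :=
  GRing.isSubmodClosed.Build K V (sm_pred s) (sm_pred_closed s).

Record subl (s : submod) := Subl { sl_val :> V; sl_mem : sl_val \in sm_pred s }.

HB.instance Definition _ s := [isSub for @sl_val s].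
HB.instance Definition _ s := [Choice of subl s by <:].
HB.instance Definition _ s := [SubChoice_isSubLmodule of subl s by <:].

Definition mksubl (s : submod) (x : V) (h : s x) : subl s := Subl (introT (asboolP _) h).

Lemma subl_prop (s : submod) (x : subl s) : s (sl_val x).
Proof. by apply/asboolP; exact: sl_mem. Qed.

Lemma subl_inj (s : submod) (x y : subl s) : sl_val x = sl_val y -> x = y.
Proof. exact: val_inj. Qed.

End SubLmodule.

Section PreHilbertModule.
Variables (R : realType) (B : unitalCstarAlgType R).

Lemma pos_nrm_mono (a b : B) : pos a -> pos (b - a) -> nrm a <= nrm b.
Proof.
move=> pa pba; have sb : sa b.
  by rewrite -[b](subrK a); apply: saD; apply: pos_sa.
apply: pos_le_nrm => //; first exact: nrm_ge0.
have -> : rone B (nrm b) - a = (rone B (nrm b) - b) + (b - a) by rewrite addrA subrK.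
by apply: posD => //; apply: pos_rone_nrm.
Qed.

(** The hypothesis is the expansion of [<T y - x b, T y - x b> >= 0] with [b = <x, y>]. For
    [T >= nrm p] one has [b^* p b <= T b^* b], whence [nrm b ^ 2 <= T nrm q]; then [T] tends to
    [nrm p]. Stated inside [B] so that it also applies to forms not yet known to be definite, as in
    [kip_def]. *)
Lemma pos_cauchy_schwarz (p q b : B) : pos p -> pos q ->
  (forall T : R, 0 < T -> pos ((T * T)%:C *: q - T%:C *: (cstar b ** b)
     - T%:C *: (cstar b ** b) + cstar b ** p ** b)) ->
  nrm b ^+ 2 <= nrm p * nrm q.
Proof.
move=> pp pq h.
have key T : 0 < T -> nrm p <= T -> nrm b ^+ 2 <= T * nrm q.
  move=> T0 pT; have := pos_conj b (pos_rone_nrm (pos_sa pp) pT) => h1.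
  have := posD (h _ T0) h1.
  have -> : (T * T)%:C *: q - T%:C *: (cstar b ** b) - T%:C *: (cstar b ** b)
     + cstar b ** p ** b + cstar b ** (rone B T - p) ** b =
     T%:C *: (T%:C *: q - cstar b ** b) by rewrite /rone; nc_ring_in R B; ring.
  move=> /(posZ (_ : 0 <= T^-1)); rewrite scalerA -rmorphM mulVf ?gt_eqF //.
  rewrite scale1r invr_ge0 ltW // => /(_ isT) h2.
  have h3 := pos_nrm_mono (pos_xx b) h2; rewrite nrm_cstar_cmul in h3.
  by apply: le_trans h3 _; rewrite nrmZr gtr0_norm.
apply/ler_addgt0Pl => e e0.
have q0 : 0 <= nrm q by exact: nrm_ge0.
have p0 : 0 <= nrm p by exact: nrm_ge0.
have d0 : 0 < e / (nrm q + 1) by rewrite divr_gt0 //; lra.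
have := key (nrm p + e / (nrm q + 1)).
have -> : (0 < nrm p + e / (nrm q + 1)) by lra.
move=> /(_ isT); rewrite lerDl ltW // => /(_ isT) h1.
apply: le_trans h1 _; rewrite mulrDl addrC lerD2r.
rewrite mulrAC ler_pdivrMr; last lra.
by apply: ler_wpM2l; lra.
Qed.

(** The right action is specified through the inner product only; its linearity and unit law follow
    from definiteness, by [ip_ext]. *)
Record premod := PreMod {
  pm_car :> lmodType R[i];
  pm_ip : pm_car -> pm_car -> B;
  pm_act : pm_car -> B -> pm_car;
  pm_linear : forall x, linear (pm_ip x);
  pm_star : forall x y, cstar (pm_ip x y) = pm_ip y x;
  pm_ipM : forall x y b, pm_ip x (pm_act y b) = pm_ip x y ** b;
  pm_pos : forall x, pos (pm_ip x x);
  pm_def : forall x, pm_ip x x = 0 -> x = 0 }.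

Variable N : premod.
Implicit Types (x y z : N) (b : B).

Local Notation ip := (@pm_ip N).
Local Notation act := (@pm_act N).

Lemma ipDr x y z : ip x (y + z) = ip x y + ip x z.
Proof. by have := pm_linear x 1 y z; rewrite !scale1r. Qed.

Lemma ip0r x : ip x 0 = 0.
Proof. by apply: (addrI (ip x 0)); rewrite -ipDr !addr0. Qed.

Lemma ipZr k x y : ip x (k *: y) = k *: ip x y.
Proof. by have := pm_linear x k y 0; rewrite ip0r !addr0. Qed.

Lemma ipNr x y : ip x (- y) = - ip x y.
Proof. by rewrite -scaleN1r ipZr scaleN1r. Qed.

Lemma ipBr x y z : ip x (y - z) = ip x y - ip x z.
Proof. by rewrite ipDr ipNr. Qed.

Lemma ipDl x y z : ip (x + y) z = ip x z + ip y z.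
Proof. by rewrite -pm_star ipDr cstarD !pm_star. Qed.

Lemma ip0l x : ip 0 x = 0.
Proof. by rewrite -pm_star ip0r cstar0. Qed.

Lemma ipZl k x y : ip (k *: x) y = Num.conj k *: ip x y.
Proof. by rewrite -pm_star ipZr cstarZ pm_star. Qed.

Lemma ipNl x y : ip (- x) y = - ip x y.
Proof. by rewrite -pm_star ipNr cstarN pm_star. Qed.

Lemma ipBl x y z : ip (x - y) z = ip x z - ip y z.
Proof. by rewrite ipDl ipNl. Qed.

Lemma ipMl x y b : ip (act x b) y = cstar b ** ip x y.
Proof. by rewrite -pm_star pm_ipM cstarM pm_star. Qed.

Lemma ip_sumr (I : Type) (r : seq I) (Q : pred I) (F : I -> N) x :
  ip x (\sum_(i <- r | Q i) F i) = \sum_(i <- r | Q i) ip x (F i).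
Proof. by apply: (big_morph (ip x)) => [u v|]; rewrite ?ipDr ?ip0r. Qed.

Lemma ip_suml (I : Type) (r : seq I) (Q : pred I) (F : I -> N) x :
  ip (\sum_(i <- r | Q i) F i) x = \sum_(i <- r | Q i) ip (F i) x.
Proof. by apply: (big_morph (fun u => ip u x)) => [u v|]; rewrite ?ipDl ?ip0l. Qed.

Lemma ip_ext x y : (forall z, ip z x = ip z y) -> x = y.
Proof.
move=> h; apply/eqP; rewrite -subr_eq0; apply/eqP; apply: pm_def.
by rewrite ipBr h subrr.
Qed.

Lemma ip_extl x y : (forall z, ip x z = ip y z) -> x = y.
Proof. by move=> h; apply: ip_ext => z; rewrite -[LHS]pm_star h pm_star. Qed.

Definition hn x : R := Num.sqrt (nrm (ip x x)).

Lemma hn_ge0 x : 0 <= hn x. Proof. exact: sqrtr_ge0. Qed.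

Lemma hn_sqr x : hn x ^+ 2 = nrm (ip x x).
Proof. by rewrite sqr_sqrtr // nrm_ge0. Qed.

Lemma hn_eq0 x : hn x = 0 -> x = 0.
Proof. by move=> h; apply: pm_def; apply: nrm0_eq0; rewrite -hn_sqr h expr0n. Qed.

Lemma cauchy_schwarz x y : nrm (ip x y) <= hn x * hn y.
Proof.
suff : nrm (ip x y) ^+ 2 <= (hn x * hn y) ^+ 2.
  by rewrite ler_sqr ?nnegrE ?mulr_ge0 ?nrm_ge0 ?hn_ge0.
rewrite exprMn !hn_sqr; apply: pos_cauchy_schwarz; [exact: pm_pos|exact: pm_pos|].
move=> T T0; have := pm_pos (T%:C *: y - act x (ip x y)).
rewrite ipBl !ipBr ipZl !ipZr conj_realC ipZl conj_realC !pm_ipM !ipMl pm_star.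
set u := ip y y; set v := ip x x; set w := ip x y.
have -> : ip y x = cstar w by rewrite pm_star.
congr pos; nc_ring_in R B; ring.
Qed.

Lemma hn_le x (C : R) : 0 <= C -> nrm (ip x x) <= C ^+ 2 -> hn x <= C.
Proof. by move=> C0 h; rewrite -(ger0_norm C0) -sqrtr_sqr; apply: ler_wsqrtr. Qed.

Lemma hn_seminorm : seminorm hn.
Proof.
split=> [x|x y|].
- by rewrite /hn ipNl ipNr opprK.
- apply: hn_le; first by rewrite addr_ge0 ?hn_ge0.
  rewrite ipDl !ipDr sqrrD !hn_sqr.
  have h1 : nrm (ip x x + ip x y + (ip y x + ip y y)) <=
     nrm (ip x x) + nrm (ip x y) + (nrm (ip y x) + nrm (ip y y)).
    apply: le_trans (nrmD _ _) _; apply: lerD; exact: nrmD.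
  apply: le_trans h1 _; have := cauchy_schwarz x y; have := cauchy_schwarz y x.
  set a := nrm (ip x y); set b := nrm (ip y x); set c := nrm (ip x x).
  set d := nrm (ip y y); rewrite [hn y * hn x]mulrC; set e := hn x * hn y.
  lra.
by rewrite /hn ip0r nrm0 sqrtr0.
Qed.

Lemma hnZ k x : hn (k *: x) = complex.Re `|k| * hn x.
Proof.
have k0 : 0 <= complex.Re `|k|.
  by have := normr_ge0 k; case: `|k| => a b; rewrite lecE /= => /andP[_].
rewrite /hn ipZl ipZr !nrmZ norm_conjC mulrA sqrtrM ?mulr_ge0 //.
by rewrite -expr2 sqrtr_sqr ger0_norm.
Qed.

Lemma hn_act x b : hn (act x b) <= nrm b * hn x.
Proof.
apply: hn_le; first by rewrite mulr_ge0 ?nrm_ge0 ?hn_ge0.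
rewrite ipMl pm_ipM exprMn hn_sqr.
apply: le_trans (nrm_cmul _ _) _; rewrite nrm_cstar expr2 -mulrA.
apply: ler_wpM2l; first exact: nrm_ge0.
by rewrite mulrC; apply: nrm_cmul.
Qed.

Lemma tends_ip (u v : nat -> N) x y : tends hn u x -> tends hn v y ->
  tends (@nrm R B) (fun n => ip (u n) (v n)) (ip x y).
Proof.
move=> hu hv e e0.
have [C hC] := tends_bounded hn_seminorm hu.
have C0 : 0 <= C by apply: le_trans (hC 0%N); apply: hn_ge0.
have y0 := hn_ge0 y.
have d1 : 0 < e / 2 / (C + 1) by rewrite !divr_gt0 //; lra.
have d2 : 0 < e / 2 / (hn y + 1) by rewrite !divr_gt0 //; lra.
have [M hM] := hv _ d1; have [K hK] := hu _ d2.
exists (maxn M K) => k; rewrite geq_max => /andP[/hM h1 /hK h2].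
have -> : ip (u k) (v k) - ip x y = ip (u k) (v k - y) + ip (u k - x) y.
  by rewrite ipBr ipBl addrA subrK.
apply: (le_lt_trans (nrmD _ _)); rewrite (splitr e); apply: ltr_leD.
  apply: (le_lt_trans (cauchy_schwarz _ _)).
  apply: (@le_lt_trans _ _ (C * hn (v k - y))).
    by apply: ler_wpM2r; rewrite ?hn_ge0.
  apply: (@le_lt_trans _ _ ((C + 1) * hn (v k - y))).
    by apply: ler_wpM2r; [rewrite hn_ge0|lra].
  by rewrite mulrC -ltr_pdivlMr //; lra.
apply: (le_trans (cauchy_schwarz _ _)).
apply: (@le_trans _ _ (hn (u k - x) * (hn y + 1))).
  by apply: ler_wpM2l; [rewrite hn_ge0|lra].
by rewrite -ler_pdivlMr ?ltW //; lra.
Qed.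

End PreHilbertModule.

(** * The C*-algebra of adjointable operators *)

Section AdjointableOperators.
Variables (R : realType) (B : unitalCstarAlgType R).

Record hmod := HMod {
  hm_pre :> premod B;
  hm_complete : forall u : nat -> hm_pre, fundamental (@hn R B hm_pre) u ->
    exists l, tends (@hn R B hm_pre) u l }.

Variable N : hmod.
Local Notation ip := (@pm_ip R B N).
Local Notation hn := (@hn R B N).
Implicit Types (x y z : N).

Let fnN : lmodType R[i] := (N -> N : Type).

Definition is_adj (T T' : N -> N) := forall x y, ip (T x) y = ip x (T' y).

Definition op_bound (T : N -> N) (C : R) := 0 <= C /\ forall x, hn (T x) <= C * hn x.

Definition adjointable (T : fnN) : Prop :=
  (exists T', is_adj T T') /\ exists C, op_bound T C.

Lemma adjointable0 : adjointable 0.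
Proof.
split; first by exists (fun=> 0) => x y; rewrite ip0l ip0r.
by exists 0; split=> // x; rewrite mul0r /hn ip0r nrm0 sqrtr0.
Qed.

Lemma is_adj_lin k (S S' T T' : N -> N) : is_adj S S' -> is_adj T T' ->
  is_adj (fun x => k *: S x + T x) (fun x => Num.conj k *: S' x + T' x).
Proof. by move=> hS hT x y; rewrite ipDl ipDr ipZl ipZr hS hT. Qed.

Lemma Re_norm_ge0 (k : R[i]) : 0 <= complex.Re `|k|.
Proof. by have := normr_ge0 k; case: `|k| => a b; rewrite lecE /= => /andP[_]. Qed.

Lemma adjointable_lin (k : R[i]) (S T : fnN) :
  adjointable S -> adjointable T -> adjointable (k *: S + T).
Proof.
move=> [[S' hS] [C [C0 hC]]] [[T' hT] [D [D0 hD]]]; split.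
  by exists (fun x => Num.conj k *: S' x + T' x); apply: is_adj_lin.
exists (complex.Re `|k| * C + D); split.
  by rewrite addr_ge0 // mulr_ge0 // Re_norm_ge0.
move=> x; apply: le_trans (seminormD (hn_seminorm N) _ _) _.
rewrite hnZ mulrDl -mulrA; apply: lerD => //.
by apply: ler_wpM2l => //; exact: Re_norm_ge0.
Qed.

Definition op_submod : submod fnN := Submod adjointable0 adjointable_lin.

Definition op := subl op_submod.

Definition opf (T : op) : N -> N := sl_val T.

Definition adj (T : op) : N -> N :=
  projT1 (cid (proj1 (subl_prop T))).

Lemma adjP (T : op) x y : ip (opf T x) y = ip x (adj T y).
Proof. by rewrite /adj; case: cid. Qed.

Lemma adjP' (T : op) x y : ip (adj T x) y = ip x (opf T y).
Proof. by rewrite -[LHS]pm_star -adjP pm_star. Qed.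

Lemma opE (T S : op) : (forall x, opf T x = opf S x) -> T = S.
Proof. by move=> h; apply: subl_inj; apply/funext. Qed.

Lemma adj_linear (T T' : N -> N) : is_adj T T' -> linear T.
Proof.
move=> h k x y; apply: ip_extl => z.
by rewrite h ipDl ipZl ipDl ipZl !h.
Qed.

Lemma opf_linear (T : op) : linear (opf T).
Proof. by apply: (@adj_linear _ (adj T)) => x y; rewrite adjP. Qed.

Lemma opfD T x y : opf T (x + y) = opf T x + opf T y.
Proof. by have := opf_linear T 1 x y; rewrite !scale1r. Qed.

Lemma opf0 T : opf T 0 = 0.
Proof. by apply: (addrI (opf T 0)); rewrite -opfD !addr0. Qed.

Lemma opfZ k T x : opf T (k *: x) = k *: opf T x.
Proof. by have := opf_linear T k x 0; rewrite opf0 !addr0. Qed.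

Definition opn (T : op) : R := inf [set C | op_bound (opf T) C].

Lemma opn_has_inf (T : op) : has_inf [set C | op_bound (opf T) C].
Proof.
have [_ [C hC]] := subl_prop T.
by split; [exists C|exists 0 => D [D0 _]].
Qed.

Lemma opn_ge0 T : 0 <= opn T.
Proof. by apply: lb_le_inf; [case: (opn_has_inf T)|move=> D []]. Qed.

Lemma opnP T x : hn (opf T x) <= opn T * hn x.
Proof.
have [|x0] := ltrP 0 (hn x); last first.
  have /hn_eq0 -> : hn x = 0 by apply/eqP; rewrite eq_le x0 hn_ge0.
  by rewrite opf0 /hn ip0r nrm0 sqrtr0 mulr0.
move=> x0; rewrite -ler_pdivrMr //.
apply: lb_le_inf; first by case: (opn_has_inf T).
by move=> D [_ hD]; rewrite ler_pdivrMr.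
Qed.

Lemma opn_le T C : 0 <= C -> (forall x, hn (opf T x) <= C * hn x) -> opn T <= C.
Proof.
by move=> C0 h; apply: ge_inf; [exists 0 => D []|split].
Qed.

Lemma hn_adj_le (T T' : N -> N) C : is_adj T T' -> op_bound T C -> op_bound T' C.
Proof.
move=> h [C0 hC]; split=> // y.
have [|y0] := ltrP 0 (hn (T' y)); last by rewrite (le_trans y0) // mulr_ge0 ?hn_ge0.
move=> y0; rewrite -(ler_pM2r y0) -expr2 hn_sqr -h.
apply: le_trans (cauchy_schwarz _ _) _.
rewrite mulrAC; apply: ler_wpM2r; first exact: hn_ge0.
exact: hC.
Qed.

Lemma opb T : op_bound (opf T) (opn T).
Proof. by split; [exact: opn_ge0|exact: opnP]. Qed.

Lemma adj_adjointable (T : op) : adjointable (adj T : fnN).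
Proof.
split; first by exists (opf T) => x y; rewrite adjP'.
exists (opn T); apply: (@hn_adj_le (opf T)); last exact: opb.
by move=> x y; rewrite adjP.
Qed.

Definition ostar (T : op) : op := mksubl (adj_adjointable T : op_submod _).

Lemma ostarP T x y : ip (opf (ostar T) x) y = ip x (opf T y).
Proof. exact: adjP'. Qed.

Lemma ostarP' T x y : ip (opf T x) y = ip x (opf (ostar T) y).
Proof. exact: adjP. Qed.

Lemma comp_adjointable (S T : op) : adjointable ((fun x => opf S (opf T x)) : fnN).
Proof.
split; first by exists (fun x => adj T (adj S x)) => x y; rewrite !adjP.
exists (opn S * opn T); split; first by rewrite mulr_ge0 ?opn_ge0.
move=> x; apply: le_trans (opnP _ _) _; rewrite -mulrA.
by apply: ler_wpM2l; [exact: opn_ge0|exact: opnP].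
Qed.

Definition omul (S T : op) : op := mksubl (comp_adjointable S T : op_submod _).

Lemma omulE S T x : opf (omul S T) x = opf S (opf T x). Proof. by []. Qed.

Lemma id_adjointable : adjointable ((fun x => x) : fnN).
Proof.
split; first by exists (fun x => x).
by exists 1; split=> // x; rewrite mul1r.
Qed.

Definition oone : op := mksubl (id_adjointable : op_submod _).

Lemma op_linE k (S T : op) x : opf (k *: S + T) x = k *: opf S x + opf T x.
Proof. by []. Qed.

Lemma opDE (S T : op) x : opf (S + T) x = opf S x + opf T x. Proof. by []. Qed.
Lemma opNE (T : op) x : opf (- T) x = - opf T x. Proof. by []. Qed.
Lemma opBE (S T : op) x : opf (S - T) x = opf S x - opf T x. Proof. by []. Qed.
Lemma opZE k (T : op) x : opf (k *: T) x = k *: opf T x. Proof. by []. Qed.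
Lemma op0E x : opf 0 x = 0. Proof. by []. Qed.

Lemma opnD (S T : op) : opn (S + T) <= opn S + opn T.
Proof.
apply: opn_le => [|x]; first by rewrite addr_ge0 ?opn_ge0.
rewrite mulrDl; apply: le_trans (seminormD (hn_seminorm N) _ _) _.
by apply: lerD; exact: opnP.
Qed.

Lemma opnZ k (T : op) : opn (k *: T) = complex.Re `|k| * opn T.
Proof.
have le c (S : op) : opn (c *: S) <= complex.Re `|c| * opn S.
  apply: opn_le => [|x]; first by rewrite mulr_ge0 ?opn_ge0 ?Re_norm_ge0.
  by rewrite opZE hnZ -mulrA; apply: ler_wpM2l; [exact: Re_norm_ge0|exact: opnP].
apply/eqP; rewrite eq_le le andTb.
have [->|k0] := eqVneq k 0.
  by rewrite normr0 mul0r opn_ge0.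
have h := le k^-1 (k *: T); rewrite scalerA mulVf // scale1r normfV in h.
have kE : `|k| = (complex.Re `|k|)%:C.
  by have := normr_ge0 k; case: `|k| => a b; rewrite lecE /= => /andP[/eqP -> _].
have k1 : 0 < complex.Re `|k|.
  by rewrite -(@ltcR R) -kE normr_gt0.
move: h; rewrite kE -fmorphV /= -ler_pdivrMl ?invr_gt0 // invrK.
by [].
Qed.

Lemma opn_eq0 T : opn T = 0 -> T = 0.
Proof.
move=> h; apply: opE => x; apply: hn_eq0; apply/eqP.
by rewrite eq_le hn_ge0 andbT; have := opnP T x; rewrite h mul0r.
Qed.

Lemma opnM S T : opn (omul S T) <= opn S * opn T.
Proof.
apply: opn_le => [|x]; first by rewrite mulr_ge0 ?opn_ge0.
rewrite omulE; apply: le_trans (opnP _ _) _; rewrite -mulrA.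
by apply: ler_wpM2l; [exact: opn_ge0|exact: opnP].
Qed.

Lemma opn_star_le T : opn (ostar T) <= opn T.
Proof.
apply: opn_le; first exact: opn_ge0.
by case: (@hn_adj_le (opf T) (opf (ostar T)) (opn T)); [exact: ostarP'|exact: opb|].
Qed.

Lemma ostarK : involutive ostar.
Proof.
by move=> T; apply: opE => x; apply: ip_ext => z; rewrite -!ostarP' ostarP -?ostarP'.
Qed.

Lemma opn_star T : opn (omul (ostar T) T) = opn T ^+ 2.
Proof.
apply/eqP; rewrite eq_le; apply/andP; split.
  apply: le_trans (opnM _ _) _; rewrite expr2.
  by apply: ler_wpM2r; [exact: opn_ge0|exact: opn_star_le].
set D := opn (omul _ _); have D0 : 0 <= D by exact: opn_ge0.
have : opn T <= Num.sqrt D.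
  apply: opn_le; first exact: sqrtr_ge0.
  move=> x; apply: hn_le; first by rewrite mulr_ge0 ?sqrtr_ge0 ?hn_ge0.
  rewrite ostarP' -omulE exprMn sqr_sqrtr //.
  apply: le_trans (cauchy_schwarz _ _) _; rewrite mulrC expr2 mulrA.
  by apply: ler_wpM2r; [exact: hn_ge0|exact: opnP].
move=> h; rewrite -(sqr_sqrtr D0).
by rewrite ler_sqr ?nnegrE ?opn_ge0 ?sqrtr_ge0.
Qed.

Lemma ostar_lin k (S T : op) : ostar (k *: S + T) = Num.conj k *: ostar S + ostar T.
Proof.
apply: opE => x; apply: ip_ext => z.
by rewrite -ostarP' !op_linE ipDl ipZl ipDr ipZr !ostarP'.
Qed.

Lemma ostarM S T : ostar (omul S T) = omul (ostar T) (ostar S).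
Proof.
by apply: opE => x; apply: ip_ext => z; rewrite -ostarP' !omulE !ostarP'.
Qed.

(** Both [u n] and their adjoints converge pointwise, and continuity of the inner product keeps the
    two limits adjoint to each other. *)
Lemma opn_complete (u : nat -> op) : fundamental opn u -> exists l, tends opn u l.
Proof.
move=> hu.
have opnN T : opn (- T) = opn T.
  by rewrite -scaleN1r opnZ normrN1 mul1r.
have sn : seminorm opn.
  split=> //; first exact: opnD.
  apply/eqP; rewrite eq_le opn_ge0 andbT; apply: opn_le => // x.
  by rewrite op0E /hn ip0r nrm0 sqrtr0 mul0r.
have hux x : fundamental hn (fun n => opf (u n) x).
  move=> e e0; have x0 := hn_ge0 x.
  have /hu[M hM] : 0 < e / (hn x + 1) by rewrite divr_gt0 //; lra.
  exists M => j k hj hk; rewrite -opBE; apply: le_lt_trans (opnP _ _) _.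
  apply: (@le_lt_trans _ _ (opn (u j - u k) * (hn x + 1))).
    by apply: ler_wpM2l; [exact: opn_ge0|lra].
  by rewrite -ltr_pdivlMr; [exact: hM|lra].
have [L hL] := choice (fun x => hm_complete (hux x)).
have hsu : fundamental opn (fun n => ostar (u n)).
  move=> e /hu[M hM]; exists M => j k hj hk; apply: le_lt_trans (hM j k hj hk).
  have -> : ostar (u j) - ostar (u k) = ostar (u j - u k).
    by rewrite [u j - u k]addrC -[- u k]scaleN1r ostar_lin rmorphN1 scaleN1r addrC.
  exact: opn_star_le.
have hsx x : fundamental hn (fun n => opf (ostar (u n)) x).
  move=> e e0; have x0 := hn_ge0 x.
  have /hsu[M hM] : 0 < e / (hn x + 1) by rewrite divr_gt0 //; lra.
  exists M => j k hj hk; rewrite -opBE; apply: le_lt_trans (opnP _ _) _.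
  apply: (@le_lt_trans _ _ (opn (ostar (u j) - ostar (u k)) * (hn x + 1))).
    by apply: ler_wpM2l; [exact: opn_ge0|lra].
  by rewrite -ltr_pdivlMr; [exact: hM|lra].
have [L' hL'] := choice (fun x => hm_complete (hsx x)).
have hcst x : tends hn (fun=> x) x by apply: tends_cst; exact: hn_seminorm.
have adjL : is_adj L L'.
  move=> x y; apply: (tends_uniq (tends_ip (hL x) (hcst y))).
  by apply: (tends_ext _ (tends_ip (hcst x) (hL' y))) => n; rewrite ostarP'.
have [C hC] := fundamental_bounded sn hu.
have C0 : 0 <= C by apply: le_trans (hC 0%N); exact: opn_ge0.
have bL : op_bound L C.
  split=> // x; apply: (tends_norm_le (hn_seminorm N) (hL x)) => n.
  by apply: le_trans (opnP _ _) _; apply: ler_wpM2r; rewrite ?hn_ge0.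
have aL : adjointable (L : fnN) by split; [exists L'|exists C].
exists (mksubl (aL : op_submod _)) => e e0.
have e2 : 0 < e / 2 by lra.
have [M hM] := hu _ e2; exists M => k hk.
apply: (@le_lt_trans _ _ (e / 2)); last lra.
apply: opn_le; first exact: ltW.
move=> x; rewrite opBE.
have h : tends hn (fun n => opf (u k) x - opf (u n) x) (opf (u k) x - L x).
  by apply: tendsB; [exact: hn_seminorm|exact: hcst|exact: hL].
apply: (tends_norm_le (hn_seminorm N) (tends_tail M h)) => n.
rewrite -opBE; apply: le_trans (opnP _ _) _.
apply: ler_wpM2r; first exact: hn_ge0.
by apply: ltW; apply: hM => //; rewrite leq_addl.
Qed.

Definition op_data : cstar_data R.
Proof.
refine (@CstarData R op omul ostar oone opn opnD opnZ opn_eq0 opn_complete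
  _ _ _ ostarK ostar_lin ostarM opnM opn_star _ _).
- by move=> S T U; apply: opE.
- by move=> T k S S'; apply: opE.
- by move=> T k S S'; apply: opE => x; rewrite op_linE !omulE op_linE opfD opfZ.
- by move=> T; apply: opE.
- by move=> T; apply: opE.
Defined.

Definition opC : unitalCstarAlgType R := calgU op_data.

End AdjointableOperators.

Section FormPositivity.
Variables (R : realType) (B : unitalCstarAlgType R) (N : hmod B).

Lemma opC_cmul (S T : opC N) x : opf (S ** T) x = opf S (opf T x).
Proof. by []. Qed.

Lemma opC_star' (T : opC N) x y : pm_ip (opf T x) y = pm_ip x (opf (cstar T) y).
Proof. exact: ostarP'. Qed.

Lemma form_pos (T : opC N) : pos T -> forall x, pos (pm_ip x (opf T x)).
Proof.
move=> [h sh ->] x; rewrite opC_cmul -{1}sh -opC_star'.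
exact: pm_pos.
Qed.

(** Write [T = p - n] and test the form at [n x]: it gives [- <x, n^3 x> >= 0] while [n^3 >= 0], so
    [n^3 = 0]. *)
Lemma pos_form (T : opC N) : sa T -> (forall x, pos (pm_ip x (opf T x))) -> pos T.
Proof.
move=> sT hT; have [p [n [pp pn e pn0 np0]]] := sa_jordan sT.
have sn := pos_sa pn.
have h : pos (- (n ** n ** n)) -> pos T.
  move=> hn; have n3 : n ** n ** n = 0.
    apply: pos_anti => //; rewrite -{1}sn; exact: pos_conj.
  have n0 : n = 0.
    by apply: sa_sq_eq0 => //; apply: (sa_sq_eq0 (sa_sq sn)); rewrite cmulA n3 cmul0x.
  by rewrite e n0 subr0.
have pn3 : pos (n ** n ** n) by rewrite -{1}sn; exact: pos_conj.
suff n30 : n ** n ** n = 0 by apply: h; rewrite n30 oppr0; exact: pos0.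
have [g [sg eg _ _]] := pos_sqrt pn3.
suff g0 : g = 0 by rewrite -eg g0; exact: cmul0x.
apply: opE => x; rewrite op0E; apply: pm_def; apply: pos_anti; first exact: pm_pos.
rewrite opC_star' sg -opC_cmul eg.
have := hT (opf n x); rewrite opC_star' sn -!opC_cmul e.
have -> : n ** (p - n) ** n = - (n ** n ** n).
  by rewrite cmulBr np0 sub0r cmulNl.
by rewrite opNE ipNr.
Qed.

End FormPositivity.

(** * The column module and positive matrices *)

Section ColumnModule.
Variables (R : realType) (B : unitalCstarAlgType R) (n : nat).

Let car : lmodType R[i] := ('I_n -> B : Type).

Definition col_ip (x y : car) : B := \sum_i cstar (x i) ** y i.

Lemma col_linear x : linear (col_ip x).
Proof.
move=> k y z; rewrite /col_ip scaler_sumr -big_split; apply: eq_bigr => i _ /=.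
by rewrite cmulDr cmulZr.
Qed.

Lemma col_star x y : cstar (col_ip x y) = col_ip y x.
Proof.
by rewrite /col_ip cstar_sum; apply: eq_bigr => i _; rewrite cstarM cstarK.
Qed.

Lemma col_ipM x y b : col_ip x (fun i => y i ** b : B) = col_ip x y ** b.
Proof. by rewrite /col_ip cmul_suml; apply: eq_bigr => i _; rewrite cmulA. Qed.

Lemma col_pos x : pos (col_ip x x).
Proof. by apply: pos_sum => i _; exact: pos_xx. Qed.

Lemma col_coord x i : nrm (x i) ^+ 2 <= nrm (col_ip x x).
Proof.
rewrite -nrm_cstar_cmul; apply: pos_nrm_mono; first exact: pos_xx.
rewrite /col_ip (bigD1 i) //= addrAC subrr add0r.
by apply: pos_sum => j _; exact: pos_xx.
Qed.

Lemma col_def x : col_ip x x = 0 -> x = 0.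
Proof.
move=> h; apply/funext => i; apply: nrm0_eq0; apply/eqP; rewrite -sqrf_eq0.
by apply/eqP/le_anti; rewrite sqr_ge0 andbT; have := col_coord x i; rewrite h nrm0.
Qed.

Definition col_pre : premod B :=
  PreMod col_linear col_star col_ipM col_pos col_def.

Lemma col_coord_hn (x : col_pre) i : nrm (x i) <= hn x.
Proof.
rewrite -[leLHS](ger0_norm (nrm_ge0 _)) -sqrtr_sqr.
by apply: ler_wsqrtr; exact: col_coord.
Qed.

Lemma col_hn_sum (x : col_pre) : hn x <= \sum_i nrm (x i).
Proof.
have s0 : 0 <= \sum_i nrm (x i) by apply: sumr_ge0 => i _; exact: nrm_ge0.
apply: hn_le => //; apply: le_trans (nrm_sum _ _ _) _.
rewrite expr2 mulr_suml; apply: ler_sum => i _.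
apply: le_trans (nrm_cmul _ _) _; rewrite nrm_cstar; apply: ler_wpM2l.
  exact: nrm_ge0.
rewrite (bigD1 i) //= lerDl; apply: sumr_ge0 => j _; exact: nrm_ge0.
Qed.

Lemma col_complete (u : nat -> col_pre) : fundamental (@hn R B col_pre) u ->
  exists l, tends (@hn R B col_pre) u l.
Proof.
move=> hu.
have hui i : fundamental (@nrm R B) (fun k => u k i).
  move=> e /hu[M hM]; exists M => j k hj hk.
  exact: le_lt_trans (col_coord_hn (u j - u k) i) (hM _ _ hj hk).
have [l hl] := choice (fun i => complete_tends (hui i)).
exists l => e e0; have n0 : (0 : R) < n.+1%:R by rewrite ltr0n.
have /choice[M hM] : forall i, exists N, forall k, (N <= k)%N ->
    nrm (u k i - l i) < e / n.+1%:R.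
  by move=> i; apply: hl; rewrite divr_gt0.
exists (\max_i M i)%N => k hk; apply: le_lt_trans (col_hn_sum _) _.
apply: (@le_lt_trans _ _ (\sum_(i < n) e / n.+1%:R)).
  apply: ler_sum => i _; apply: ltW; apply: hM.
  by apply: leq_trans hk; apply: leq_bigmax.
rewrite sumr_const card_ord -[_ *+ n]mulr_natr mulrAC ltr_pdivrMr //.
by rewrite ltr_pM2l // ltr_nat.
Qed.

Definition colmod : hmod B := HMod col_complete.

Section MatrixOperator.
Variable X : 'M[B]_n.

Definition mx_fun (x : colmod) : colmod := fun i => \sum_j X i j ** x j.

Hypothesis Xsa : forall i j, cstar (X i j) = X j i.

Lemma mx_fun_adj : is_adj mx_fun mx_fun.
Proof.
move=> x y; rewrite /= /col_ip /mx_fun.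
under eq_bigr do rewrite cstar_sum cmul_suml.
rewrite exchange_big; apply: eq_bigr => i _; rewrite cmul_sumr.
by apply: eq_bigr => j _; rewrite cstarM Xsa cmulA.
Qed.

Lemma mx_fun_adjointable : op_submod colmod mx_fun.
Proof.
split; first by exists mx_fun; exact: mx_fun_adj.
exists (\sum_i \sum_j nrm (X i j)); split.
  by apply: sumr_ge0 => i _; apply: sumr_ge0 => j _; exact: nrm_ge0.
move=> x; apply: le_trans (col_hn_sum _) _.
rewrite mulr_suml; apply: ler_sum => i _; rewrite mulr_suml.
apply: le_trans (nrm_sum _ _ _) _; apply: ler_sum => j _.
apply: le_trans (nrm_cmul _ _) _; apply: ler_wpM2l; first exact: nrm_ge0.
exact: col_coord_hn.
Qed.

Definition mx_op : opC colmod := mksubl mx_fun_adjointable.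

Lemma mx_op_sa : sa mx_op.
Proof.
apply: opE => x; apply: ip_ext => z.
by rewrite -opC_star'; exact: mx_fun_adj.
Qed.

Let delta (i : 'I_n) : colmod := fun j => if j == i then cone else 0.

Lemma col_ip_delta i (x : colmod) : pm_ip (delta i) x = x i.
Proof.
rewrite /= /col_ip (bigD1 i) //= /delta eqxx cstar1 cmul1x big1 ?addr0 //.
by move=> j /negPf ->; rewrite cstar0 cmul0x.
Qed.

Lemma form_mx_pos :
  (forall b : 'I_n -> B, pos (\sum_i \sum_j cstar (b i) ** X i j ** b j)) ->
  mx_pos X.
Proof.
move=> hX; have [|h [sh eh _ _]] := @pos_sqrt _ _ mx_op.
  apply: pos_form; first exact: mx_op_sa.
  move=> x; have := hX x; congr pos; rewrite /= /col_ip; apply: eq_bigr => i _.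
  by rewrite /mx_fun cmul_sumr; apply: eq_bigr => j _; rewrite cmulA.
exists (\matrix_(k, j) opf h (delta j) k) => i j.
have -> : X i j = opf mx_op (delta j) i.
  rewrite /= /mx_fun (bigD1 j) //= /delta eqxx cmulx1 big1 ?addr0 //.
  by move=> k /negPf ->; rewrite cmulx0.
rewrite -[LHS]col_ip_delta -eh opC_cmul -{1}sh -opC_star' /= /col_ip.
by apply: eq_bigr => k _; rewrite !mxE.
Qed.

End MatrixOperator.

Lemma mx_pos_form (X : 'M[B]_n) (b : 'I_n -> B) : mx_pos X ->
  pos (\sum_i \sum_j cstar (b i) ** X i j ** b j).
Proof.
move=> [Y hY].
have -> : \sum_i \sum_j cstar (b i) ** X i j ** b j =
  \sum_k cstar (\sum_i Y k i ** b i) ** (\sum_j Y k j ** b j).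
  under [RHS]eq_bigr do rewrite cstar_sum cmul_suml.
  rewrite [RHS]exchange_big; apply: eq_bigr => i _.
  under [RHS]eq_bigr do rewrite cmul_sumr.
  rewrite [RHS]exchange_big; apply: eq_bigr => j _.
  rewrite hY cmul_sumr cmul_suml; apply: eq_bigr => k _.
  by rewrite cstarM !cmulA.
by apply: pos_sum => k _; exact: pos_xx.
Qed.

Lemma mx_pos_sa (X : 'M[B]_n) : mx_pos X -> forall i j, cstar (X i j) = X j i.
Proof.
move=> [Y hY] i j; rewrite !hY cstar_sum; apply: eq_bigr => k _.
by rewrite cstarM cstarK.
Qed.

End ColumnModule.

(** Cayley-Hamilton gives [A^n = 0]. This is used for the faithfulness of the trace, where all
    eigenvalues turn out to be zero. *)
Lemma iter_mulmx_nil (F : fieldType) n (A : 'M[F]_n) (v : 'rV_n) :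
  char_poly A = 'X^n -> iter n (fun u => u *m A) v = 0.
Proof.
case: n A v => [|n] A v hA; first by rewrite thinmx0.
have e m : iter m (fun u => u *m A) v = v *m A ^+ m.
  by elim: m => [|m /= ->]; rewrite ?expr0 ?mulmx1 // exprSr mulmxA.
have h : A ^+ n.+1 = 0.
  by have := Cayley_Hamilton A; rewrite hA rmorphXn /= horner_mx_X.
by rewrite e h mulmx0.
Qed.

(** If [a^(n+2) = 0] then [(a^(n+1))^2 = 0], and a self-adjoint element of square zero vanishes; the
    exponent goes down to 1. *)
Lemma sa_nilpotent (R : realType) (A : unitalCstarAlgType R) (a : A) n :
  sa a -> iter n (cmul a) cone = 0 -> a = 0.
Proof.
move=> sA; pose w k := iter k (cmul a) cone.
have wS k : w k.+1 = a ** w k by [].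
have wD j k : w (j + k)%N = w j ** w k.
  by elim: j => [|j IH]; rewrite ?cmul1x // addSn !wS IH cmulA.
have sw k : sa (w k).
  elim: k => [|k IH]; first exact: sa1.
  have aw : a ** w k = w k ** a.
    by have := wD k 1%N; rewrite addn1 wS => ->; rewrite /w /= cmulx1.
  by rewrite wS; apply: saM.
elim: n => [|n IH].
  by rewrite /= => e; rewrite -[a]cmulx1 e cmulx0.
case: n IH => [|n] IH; first by rewrite /= cmulx1.
rewrite -/(w n.+2) => h; apply: IH; apply: (sa_sq_eq0 (sw n.+1)).
by rewrite -wD addSnnS wD h cmulx0.
Qed.

(** * Finite-dimensional C*-algebras and tensor products *)

Section FiniteDimension.
Variables (R : realType) (P : unitalCstarAlgType R).
Implicit Types (p q x y z : P).

Definition spans n (b : 'I_n -> P) := forall p, exists c : 'I_n -> R[i],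
  p = \sum_i c i *: b i.

Lemma finite_dim_spans : finite_dim P -> exists n (b : 'I_n -> P), spans b.
Proof.
move=> [n [b hb]]; exists n, b => p.
have : lin_span (range b) p by rewrite hb.
move=> [m [c [x [hx ->]]]].
have /choice[g hg] : forall i, exists j, b j = x i by move=> i; have [j _ <-] := hx i; exists j.
exists (fun j => \sum_(i | g i == j) c i).
under [RHS]eq_bigr do rewrite scaler_suml.
rewrite (exchange_big_dep xpredT) //=; apply: eq_bigr => i _.
by rewrite (big_pred1 (g i)) ?hg.
Qed.

(** A spanning family of least size is independent: a relation would express one member through the
    others. *)
Lemma finite_dim_basis : finite_dim P ->
  exists n (b : 'I_n -> P), spans b /\ lin_indep b.
Proof.
move=> /finite_dim_spans h.
have hex : exists n, `[< exists b : 'I_n -> P, spans b >].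
  by case: h => n [b hb]; exists n; apply/asboolP; exists b.
case: (ex_minnP hex) => n /asboolP[b hb] hmin; exists n, b; split=> // c c0 i.
apply/eqP; apply/negP => /negP ci.
case: n b hb hmin c c0 i ci => [|n] b hb hmin c c0 i ci; first by case: i {ci}.
suff /hmin : `[< exists b' : 'I_n -> P, spans b' >] by rewrite ltnn.
apply/asboolP; exists (fun j => b (lift i j)) => p.
have [d ->] := hb p.
have bi : b i = \sum_(j < n) (- ((c i)^-1 * c (lift i j))) *: b (lift i j).
  have := congr1 (fun z => (c i)^-1 *: z) c0.
  rewrite scaler0 (bigD1_ord i) //= scalerDr scalerA mulVf // scale1r => /eqP.
  rewrite addr_eq0 => /eqP ->; rewrite scaler_sumr -sumrN.
  by apply: eq_bigr => j _; rewrite scalerA scaleNr.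
exists (fun j => d (lift i j) - d i * ((c i)^-1 * c (lift i j))).
rewrite (bigD1_ord i) //= bi scaler_sumr -big_split /=.
apply: eq_bigr => j _; rewrite scalerA -scalerDl; congr (_ *: _).
by rewrite mulrN addrC.
Qed.

Section Trace.
Variables (n : nat) (b : 'I_n -> P).
Hypotheses (b_spans : spans b) (b_indep : lin_indep b).

Definition coord p : 'I_n -> R[i] := projT1 (cid (b_spans p)).

Lemma coordE p : p = \sum_i coord p i *: b i.
Proof. by rewrite /coord; case: cid. Qed.

Lemma coord_uniq p (c : 'I_n -> R[i]) : p = \sum_i c i *: b i -> forall i, coord p i = c i.
Proof.
move=> e i; apply/eqP; rewrite -subr_eq0; apply/eqP.
apply: (b_indep (c := fun i => coord p i - c i)).
under eq_bigr do rewrite scalerBl.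
by rewrite sumrB -coordE -e subrr.
Qed.

Lemma coord_linear k p q i : coord (k *: p + q) i = k * coord p i + coord q i.
Proof.
apply: (coord_uniq (c := fun i => k * coord p i + coord q i)).
rewrite {1}(coordE p) {1}(coordE q) scaler_sumr -big_split.
by apply: eq_bigr => j _; rewrite /= scalerDl scalerA.
Qed.

Lemma coord0 i : coord 0 i = 0.
Proof.
by apply: (coord_uniq (c := fun=> 0)); rewrite big1 // => j _; rewrite scale0r.
Qed.

Lemma coord_sum (I : finType) (k : I -> R[i]) (F : I -> P) i :
  coord (\sum_j k j *: F j) i = \sum_j k j * coord (F j) i.
Proof.
elim: (index_enum I) => [|j r IH]; rewrite ?big_nil ?coord0 //.
by rewrite !big_cons coord_linear IH.
Qed.

(** Trace of the operator of left multiplication by [p]. *)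
Definition trp p : R[i] := \sum_i coord (p ** b i) i.

Lemma trp_linear k p q : trp (k *: p + q) = k * trp p + trp q.
Proof.
rewrite /trp mulr_sumr -big_split; apply: eq_bigr => i _ /=.
by rewrite cmulDl cmulZl coord_linear.
Qed.

Lemma trpC p q : trp (p ** q) = trp (q ** p).
Proof.
have e x y : trp (x ** y) = \sum_i \sum_j coord (y ** b i) j * coord (x ** b j) i.
  apply: eq_bigr => i _; rewrite -cmulA {1}(coordE (y ** b i)) cmul_sumr.
  rewrite -coord_sum; congr coord; apply: eq_bigr => j _.
  by rewrite cmulZr.
rewrite !e exchange_big; apply: eq_bigr => i _; apply: eq_bigr => j _.
by rewrite mulrC.
Qed.

Let A p : 'M[R[i]]_n := \matrix_(k, l) coord (p ** b k) l.
Let vec (v : 'rV[R[i]]_n) : P := \sum_k v 0 k *: b k.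

Let vecA p v : vec (v *m A p) = p ** vec v.
Proof.
rewrite /vec [in RHS]cmul_sumr.
under [LHS]eq_bigr do rewrite mxE scaler_suml.
rewrite exchange_big; apply: eq_bigr => k _ /=.
rewrite cmulZr {1}(coordE (p ** b k)) scaler_sumr; apply: eq_bigr => l _.
by rewrite mxE scalerA.
Qed.

Let vec_inj v : vec v = 0 -> v = 0.
Proof. by move=> /b_indep h; apply/rowP => k; rewrite h mxE. Qed.

Let trpE p : trp p = \tr (A p).
Proof. by apply: eq_bigr => i _; rewrite mxE. Qed.

(** An eigenvector [y] of left multiplication by [x^* x] gives [(x y)^* (x y) = z y^* y], with both
    squares positive and [y^* y] nonzero. *)
Let eigen_ge0 x (z : R[i]) : eigenvalue (A (cstar x ** x)) z -> 0 <= z.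
Proof.
move=> /eigenvalueP[v va v0]; pose y := vec v.
have y0 : y <> 0 by move=> /vec_inj /eqP; rewrite (negPf v0).
have ey : cstar x ** x ** y = z *: y.
  by rewrite -vecA va /y /vec scaler_sumr; apply: eq_bigr => k _; rewrite mxE scalerA.
pose q := cstar y ** y; pose s := cstar (x ** y) ** (x ** y).
have es : s = z *: q by rewrite /s /q -cmulZr -ey cstarM !cmulA.
have q0 : q <> 0 by move=> /cstar_cmul_eq0.
have zr : Num.conj z = z.
  have : (Num.conj z - z) *: q = 0.
    rewrite scalerBl -es; have := sa_xx (x ** y); rewrite -/s /sa es cstarZ.
    by rewrite (sa_xx y) -/q => ->; rewrite subrr.
  by move=> /eqP; rewrite scaler_eq0 subr_eq0 => /orP[/eqP //|/eqP].
have zE : z = (complex.Re z)%:C.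
  case: (z) zr => u w [] /= h; congr (_ +i* _).
  by apply/eqP; move: h => /eqP; rewrite eq_sym -subr_eq0 opprK -mulr2n mulrn_eq0.
rewrite zE ler0c leNgt; apply/negP => t0.
have ps : pos s by exact: pos_xx.
have s0 : s = 0.
  apply: pos_anti => //; rewrite es zE -scaleNr -rmorphN.
  by apply: posZ; [lra|exact: pos_xx].
move: es; rewrite s0 => /esym/eqP; rewrite scaler_eq0 => /orP[/eqP z0|/eqP //].
by move: t0; rewrite z0 ltxx.
Qed.

(** The trace is the sum of the roots of the characteristic polynomial, all nonnegative. If it is
    zero, that polynomial is ['X^n], so [x^* x] is nilpotent and hence zero. *)
Lemma trp_pos x : 0 <= trp (cstar x ** x) /\ (trp (cstar x ** x) = 0 -> x = 0).
Proof.
have [n0|n0] := posnP n.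
  have z0 : x = 0.
    rewrite (coordE x) big1 // => i _.
    by have := ltn_ord i; rewrite {2}n0.
  split=> //; rewrite /trp big1 // => i _.
  by have := ltn_ord i; rewrite {2}n0.
have [rs hrs] := closed_field_poly_normal (char_poly (A (cstar x ** x))).
rewrite (monicP (char_poly_monic _)) scale1r in hrs.
have hz (z : R[i]) : z \in rs -> 0 <= z.
  move=> zr; apply: (@eigen_ge0 x); rewrite eigenvalue_root_char hrs.
  by rewrite root_prod_XsubC.
have srs : size rs = n.
  by have := size_char_poly (A (cstar x ** x)); rewrite hrs size_prod_XsubC => -[].
have tE : trp (cstar x ** x) = \sum_(z <- rs) z.
  apply: oppr_inj; rewrite trpE -char_poly_trace // hrs -{1}srs coefPn_prod_XsubC //.
  by rewrite srs -lt0n.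
rewrite tE; split.
  by rewrite big_seq; apply: sumr_ge0 => z; exact: hz.
move=> /eqP; rewrite big_seq psumr_eq0 => [/allP h|z]; last exact: hz.
have hc : char_poly (A (cstar x ** x)) = 'X^n.
  rewrite hrs -srs; elim: (rs) h => [|z s IH] h; first by rewrite big_nil expr0.
  rewrite big_cons IH => [|y ys]; last first.
    by have := h y; rewrite inE ys orbT => /(_ isT).
  have := h z; rewrite inE eqxx /= => /(_ isT)/eqP ->.
  by rewrite subr0 exprS.
have hx : iter n (cmul (cstar x ** x)) cone = 0.
  pose v := \row_k coord cone k.
  have -> : (cone : P) = vec v.
    by rewrite {1}(coordE cone); apply: eq_bigr => k _; rewrite mxE.
  have -> m : iter m (cmul (cstar x ** x)) (vec v) =
      vec (iter m (fun u => u *m A (cstar x ** x)) v).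
    by elim: m => //= m ->; rewrite vecA.
  rewrite iter_mulmx_nil // /vec big1 // => k _; by rewrite mxE scale0r.
by have /(cstar_cmul_eq0) := sa_nilpotent (sa_xx x) hx.
Qed.

End Trace.
End FiniteDimension.

(* [tb_sum] holds for the trace of left multiplication on [P], and fixes the
   normalization of [tb_tr]. *)
Record trace_basis (R : realType) (P : unitalCstarAlgType R) := TraceBasis {
  tb_n : nat;
  tb_e : 'I_tb_n -> P;
  tb_tr : P -> R[i];
  tb_linear : forall (k : R[i]) x y, tb_tr (k *: x + y) = k * tb_tr x + tb_tr y;
  tb_star : forall x, tb_tr (cstar x) = Num.conj (tb_tr x);
  tb_comm : forall x y, tb_tr (x ** y) = tb_tr (y ** x);
  tb_orth : forall i j, tb_tr (cstar (tb_e i) ** tb_e j) = (i == j)%:R;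
  tb_expand : forall x, x = \sum_i tb_tr (cstar (tb_e i) ** x) *: tb_e i;
  tb_sum : \sum_i cstar (tb_e i) ** tb_e i = cone }.

Section TraceBasisExistence.
Variables (R : realType) (P : unitalCstarAlgType R) (n : nat) (b : 'I_n -> P).
Hypotheses (b_spans : spans b) (b_indep : lin_indep b).
Implicit Types (x y z f : P) (e : seq P).

Local Notation tr := (trp b_spans).

Lemma trp0 : tr 0 = 0.
Proof.
by rewrite /trp big1 // => i _; rewrite cmul0x coord0.
Qed.

Lemma trpZ k x : tr (k *: x) = k * tr x.
Proof. by rewrite -[k *: x]addr0 trp_linear // trp0 addr0. Qed.

Lemma trpD x y : tr (x + y) = tr x + tr y.
Proof. by have := trp_linear b_spans b_indep 1 x y; rewrite scale1r mul1r. Qed.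

Lemma trpN x : tr (- x) = - tr x.
Proof. by rewrite -scaleN1r trpZ mulN1r. Qed.

Lemma trp_sum (I : Type) (r : seq I) (F : I -> P) :
  tr (\sum_(i <- r) F i) = \sum_(i <- r) tr (F i).
Proof. by apply: (big_morph (trp b_spans)) => [u v|]; rewrite ?trpD ?trp0. Qed.

Lemma trp_sa x : sa x -> Num.conj (tr x) = tr x.
Proof.
move=> sx; have [p [q [[h sh ->] [k sk ->] -> _ _]]] := sa_jordan sx.
have [h0 _] := trp_pos b_spans b_indep h; have [k0 _] := trp_pos b_spans b_indep k.
rewrite sh in h0; rewrite sk in k0.
by rewrite trpD trpN rmorphB /= !conj_Creal // ger0_real.
Qed.

Lemma trp_star x : tr (cstar x) = Num.conj (tr x).
Proof.
pose u := 2^-1 *: (x + cstar x); pose v := 2^-1 *: ('i *: (cstar x - x)).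
have su : sa u by rewrite /sa cstar_half cstarD cstarK addrC.
have sv : sa v.
  by rewrite /sa cstar_half cstarZ conjCi cstarB cstarK scaleNr -scalerN opprB.
have i2 : ('i : R[i]) * 'i = -1 by rewrite -expr2 sqrCi.
have ex : x = u + 'i *: v.
  have -> : 'i *: v = (2^-1 : R[i]) *: (('i * 'i) *: (cstar x - x)).
    by rewrite /v !scalerA; congr (_ *: _); ring.
  by rewrite i2 /u; nc_ring_in R P; field.
clearbody u v.
rewrite {1}ex cstarD cstarZ su sv conjCi trpD trpZ ex trpD trpZ rmorphD rmorphM /=.
by rewrite conjCi !trp_sa.
Qed.

Fixpoint orthon e : Prop :=
  if e is f :: e' then
    [/\ tr (cstar f ** f) = 1, forall z, z \in e' -> tr (cstar z ** f) = 0 &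
     orthon e']
  else True.

Definition expands e x := x = \sum_(z <- e) tr (cstar z ** x) *: z.

Lemma trp_conj x y : tr (cstar x ** y) = Num.conj (tr (cstar y ** x)).
Proof. by rewrite -trp_star cstarM cstarK. Qed.

Lemma orthon_coef e (c : P -> R[i]) z : orthon e -> z \in e ->
  tr (cstar z ** \sum_(w <- e) c w *: w) = c z.
Proof.
elim: e => [//|f e IH] /= [f1 fe oe].
have nf w : w \in e -> w != f.
  move=> we; apply/eqP => wf; have := fe _ we; rewrite wf f1 => /eqP.
  by rewrite oner_eq0.
rewrite inE => /orP[/eqP ->|ze]; rewrite big_cons cmulDr trpD cmulZr trpZ.
  rewrite f1 mulr1 cmul_sumr trp_sum big_seq big1 ?addr0 // => w we.
  by rewrite cmulZr trpZ trp_conj (fe _ we) conjC0 mulr0.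
by rewrite (fe _ ze) mulr0 add0r IH.
Qed.

(** The conclusion is an expansion formula because vectors depending on the previous ones are
    dropped, so the lengths of [xs] and [e] may differ. *)
Lemma gram_schmidt (xs : seq P) :
  exists2 e, orthon e & forall x, x \in xs -> expands e x.
Proof.
elim: xs => [|x xs [e oe he]]; first by exists [::].
pose y := x - \sum_(z <- e) tr (cstar z ** x) *: z.
have ye z : z \in e -> tr (cstar z ** y) = 0.
  by move=> ze; rewrite cmulBr trpD trpN (orthon_coef (fun w => tr (cstar w ** x))) // subrr.
have [y0|y0] := eqVneq y 0.
  exists e => // z; rewrite inE => /orP[/eqP ->|/he //].
  by apply/eqP; rewrite -subr_eq0; apply/eqP.
have [t0 t1] := trp_pos b_spans b_indep y.
have tn0 : tr (cstar y ** y) != 0.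
  by apply/eqP => /t1 /eqP; rewrite (negPf y0).
pose c := (sqrtC (tr (cstar y ** y)))^-1.
have cr : Num.conj c = c.
  by apply: conj_Creal; rewrite ger0_real // invr_ge0 sqrtC_ge0.
have cc : c * c * tr (cstar y ** y) = 1.
  by rewrite -expr2 /c exprVn sqrtCK mulVf.
pose f := c *: y.
have fe z : z \in e -> tr (cstar z ** f) = 0.
  by move=> ze; rewrite cmulZr trpZ ye // mulr0.
have f1 : tr (cstar f ** f) = 1.
  by rewrite /f cstarZ cr cmulZl cmulZr scalerA trpZ.
exists (f :: e); first by split.
(* Orthonormality forces the coefficients, so any combination of [f :: e] will do. Coefficients are
   indexed by elements rather than positions, whence the tests [w == f] below. *)
have key w : (exists d : P -> R[i], w = \sum_(z <- f :: e) d z *: z) -> expands (f :: e) w.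
  move=> [d ew]; rewrite /expands {1}ew; apply: eq_big_seq => z zf.
  by rewrite ew (orthon_coef d).
move=> z; rewrite inE => /orP[/eqP ->|/he ez]; apply: key.
  have c0 : c != 0 by apply/eqP => c0; move: cc; rewrite c0 !mul0r => /esym/eqP; rewrite oner_eq0.
  exists (fun w => if w == f then c^-1 else tr (cstar w ** x)).
  rewrite big_cons eqxx /f scalerA mulVf // scale1r -/f.
  rewrite -[x](subrK (\sum_(z <- e) tr (cstar z ** x) *: z)) -/y; congr (_ + _).
  rewrite subrK; apply: eq_big_seq => w we; case: eqP => // wf.
  by move: (fe _ we); rewrite wf f1 => /eqP; rewrite oner_eq0.
exists (fun w => if w == f then 0 else tr (cstar w ** z)).
rewrite big_cons eqxx scale0r add0r {1}ez; apply: eq_big_seq => w we.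
case: eqP => // wf; by move: (fe _ we); rewrite wf f1 => /eqP; rewrite oner_eq0.
Qed.

Lemma orthon_nth e (i j : 'I_(size e)) : orthon e ->
  tr (cstar (tnth (in_tuple e) i) ** tnth (in_tuple e) j) = (i == j)%:R.
Proof.
move=> oe.
have oe' k l : (k < l < size e)%N -> tr (cstar (nth 0 e k) ** nth 0 e l) = 0.
  elim: e oe k l {i j} => [|f e IH] /=; first by move=> _ k l; rewrite ltn0 andbF.
  move=> [f1 fe oe] [|k] [|l] //=; rewrite !ltnS => kl.
    by rewrite trp_conj fe ?conjC0 // mem_nth.
  exact: IH.
have oe1 k : (k < size e)%N -> tr (cstar (nth 0 e k) ** nth 0 e k) = 1.
  by elim: e oe k {i j oe'} => [//|f e IH] /= [f1 fe oe] [|k] //= ke; apply: IH.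
rewrite !(tnth_nth 0) /=; have [->|ij] := eqVneq i j; first by rewrite oe1.
case: (ltngtP i j) => [lij|lij|/ord_inj e0]; last by rewrite e0 eqxx in ij.
  by apply: oe'; rewrite lij ltn_ord.
by rewrite trp_conj oe' ?conjC0 // lij ltn_ord.
Qed.

Lemma trace_basis_exists : exists tb : trace_basis P, True.
Proof.
have [e oe he] := gram_schmidt (codom b).
pose m := size e; pose E (i : 'I_m) := tnth (in_tuple e) i.
have orth i j : tr (cstar (E i) ** E j) = (i == j)%:R by exact: orthon_nth.
have expd x : x = \sum_i tr (cstar (E i) ** x) *: E i.
  have ex : expands e x.
    have hb k : expands e (b k) by apply: he; exact: codom_f.
    rewrite /expands {1}(coordE b_spans x).
    under eq_bigr do rewrite {1}hb scaler_sumr.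
    rewrite exchange_big; apply: eq_bigr => z _.
    rewrite [in RHS](coordE b_spans x) cmul_sumr trp_sum scaler_suml.
    by apply: eq_bigr => k _; rewrite cmulZr trpZ scalerA.
  by rewrite {1}ex (big_tnth _ _ e).
have trE x : tr x = \sum_i tr (cstar (E i) ** (x ** E i)).
  transitivity (\sum_i \sum_k coord b_spans (E i) k * tr (cstar (E i) ** (x ** b k))).
    rewrite /trp exchange_big; apply: eq_bigr => k _.
    rewrite {1}(expd (x ** b k)) coord_sum //.
    by apply: eq_bigr => i _; rewrite mulrC.
  apply: eq_bigr => i _.
  have -> : x ** E i = \sum_k coord b_spans (E i) k *: (x ** b k).
    by rewrite {1}(coordE b_spans (E i)) cmul_sumr; apply: eq_bigr => k _; rewrite cmulZr.
  by rewrite cmul_sumr trp_sum; apply: eq_bigr => k _; rewrite cmulZr trpZ.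
have faithful x : (forall y, tr (y ** x) = 0) -> x = 0.
  by move=> h; have [_ h1] := trp_pos b_spans b_indep x; apply: h1.
(* For every [y], the trace of [y \sum_i E_i E_i^*] is the sum of the traces of [E_i^* y E_i], which
   is the trace of [y] by [trE]; faithfulness concludes. *)
have s1 : \sum_i E i ** cstar (E i) = cone.
  apply/eqP; rewrite -subr_eq0; apply/eqP; apply: faithful => y.
  rewrite cmulBr cmulx1 trpD trpN [tr y]trE cmul_sumr trp_sum -sumrB big1 // => i _.
  by rewrite cmulA trpC // subrr.
(* Expanding the starred factor in the basis turns both sums into the same double sum, since the
   trace of [E_i^* E_j^*] is symmetric in [i] and [j]. *)
have s2 : \sum_i cstar (E i) ** E i = cone.
  rewrite -s1.
  under eq_bigr do rewrite {1}(expd (cstar (E _))) cmul_suml.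
  rewrite exchange_big; apply: eq_bigr => j _ /=.
  rewrite {2}(expd (cstar (E j))) cmul_sumr; apply: eq_bigr => i _.
  by rewrite cmulZl cmulZr trpC.
exists (TraceBasis (trp_linear b_spans b_indep) trp_star (trpC b_spans b_indep) orth expd s2).
by [].
Qed.

End TraceBasisExistence.

Lemma finite_dim_trace_basis (R : realType) (P : unitalCstarAlgType R) :
  finite_dim P -> exists tb : trace_basis P, True.
Proof. by move=> /finite_dim_basis[n [b [h1 h2]]]; apply: trace_basis_exists h2. Qed.

Lemma weighted_sum_small (R : realType) n (c : 'I_n -> R) (d : 'I_n -> nat -> R) :
  (forall i, 0 <= c i) ->
  (forall i (e : R), 0 < e -> exists N, forall k, (N <= k)%N -> d i k < e) ->
  forall e : R, 0 < e -> exists N, forall k, (N <= k)%N -> \sum_i c i * d i k < e.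
Proof.
move=> c0 hd e e0; pose C := \sum_i c i.
have C0 : 0 <= C by apply: sumr_ge0 => i _.
have e1 : 0 < e / (C + 1) by rewrite divr_gt0 //; lra.
have /choice[M hM] := fun i => hd i _ e1.
exists (\max_i M i)%N => k hk.
apply: (@le_lt_trans _ _ (C * (e / (C + 1)))).
  rewrite mulr_suml; apply: ler_sum => i _; apply: ler_wpM2l => //; apply: ltW.
  by apply: hM; apply: leq_trans hk; apply: leq_bigmax.
rewrite mulrA ltr_pdivrMr; last lra.
by rewrite mulrC ltr_pM2l //; lra.
Qed.

(** * A concrete model of [P (x) B] on columns *)

Section TensorWithFiniteDim.
Variables (R : realType) (P : unitalCstarAlgType R) (tb : trace_basis P).
Local Notation n := (tb_n tb).
Local Notation e := (@tb_e R P tb).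
Local Notation tr := (@tb_tr R P tb).

Lemma tr0 : tr 0 = 0.
Proof.
have := tb_linear tb 1 0 0; rewrite scaler0 addr0 mul1r => h.
by apply: (addrI (tr 0)); rewrite -h addr0.
Qed.

Lemma trZ k x : tr (k *: x) = k * tr x.
Proof. by rewrite -[k *: x]addr0 tb_linear tr0 addr0. Qed.

Lemma trD x y : tr (x + y) = tr x + tr y.
Proof. by have := tb_linear tb 1 x y; rewrite scale1r mul1r. Qed.

Lemma tr_sum (I : finType) (F : I -> P) : tr (\sum_i F i) = \sum_i tr (F i).
Proof. by apply: (big_morph tr) => [u v|]; rewrite ?trD ?tr0. Qed.

Lemma tr_contract x y : \sum_j tr (x ** e j) * tr (cstar (e j) ** y) = tr (x ** y).
Proof.
rewrite [in RHS](tb_expand tb y) cmul_sumr tr_sum; apply: eq_bigr => j _.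
by rewrite cmulZr trZ mulrC.
Qed.

Section OneAlgebra.
Variable B : unitalCstarAlgType R.
Local Notation col := (colmod B n).
Implicit Types (p q : P) (b c : B) (x y : col).

(** The operator [p (x) b] on [P (x) B], where [P] is the Hilbert space of its trace with
    orthonormal basis [e]; the scalars are the matrix of left multiplication by [p]. *)
Definition lten_fun p b (x : col) : col :=
  fun k => \sum_j tr (cstar (e k) ** p ** e j) *: (b ** x j).

Lemma lten_adj p b : is_adj (lten_fun p b) (lten_fun (cstar p) (cstar b)).
Proof.
move=> x y; rewrite /= /col_ip /lten_fun.
under eq_bigr do rewrite cstar_sum cmul_suml.
rewrite exchange_big; apply: eq_bigr => j _; rewrite cmul_sumr.
apply: eq_bigr => k _.
by rewrite cstarZ -tb_star !cstarM cstarK cmulZl cmulZr !cmulA.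
Qed.

Lemma lten_adjointable p b : op_submod col (lten_fun p b).
Proof.
split; first by exists (lten_fun (cstar p) (cstar b)); exact: lten_adj.
pose c k j := complex.Re `|tr (cstar (e k) ** p ** e j)| * nrm b.
have c0 k j : 0 <= c k j by rewrite mulr_ge0 ?nrm_ge0 ?Re_norm_ge0.
exists (\sum_k \sum_j c k j); split.
  by apply: sumr_ge0 => i _; apply: sumr_ge0.
move=> x; apply: le_trans (col_hn_sum _) _.
rewrite mulr_suml; apply: ler_sum => k _; rewrite mulr_suml.
apply: le_trans (nrm_sum _ _ _) _; apply: ler_sum => j _.
rewrite nrmZ /c -mulrA; apply: ler_wpM2l; first exact: Re_norm_ge0.
apply: le_trans (nrm_cmul _ _) _; apply: ler_wpM2l; first exact: nrm_ge0.
exact: col_coord_hn.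
Qed.

Definition lten p b : opC col := mksubl (lten_adjointable p b).

Lemma lten_star p b : cstar (lten p b) = lten (cstar p) (cstar b).
Proof.
apply: opE => x; apply: ip_ext => z; rewrite -opC_star'.
exact: lten_adj.
Qed.

Lemma lten_mul p b q c : lten p b ** lten q c = lten (p ** q) (b ** c).
Proof.
apply: opE => x; apply/funext => k; rewrite opC_cmul /= /lten_fun.
under eq_bigr do rewrite cmul_sumr scaler_sumr.
rewrite exchange_big; apply: eq_bigr => l _ /=.
under eq_bigr do rewrite cmulZr scalerA cmulA.
rewrite -scaler_suml; congr (_ *: _).
have := tr_contract (cstar (e k) ** p) (q ** e l); rewrite !cmulA => <-.
by apply: eq_bigr => j _; rewrite cmulA.
Qed.

Lemma lten_linearl b k p q : lten (k *: p + q) b = k *: lten p b + lten q b.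
Proof.
apply: opE => x; apply/funext => l.
transitivity (k *: lten_fun p b x l + lten_fun q b x l) => //.
rewrite /= /lten_fun scaler_sumr -big_split; apply: eq_bigr => j _ /=.
by rewrite cmulDr cmulDl cmulZr cmulZl tb_linear scalerDl scalerA.
Qed.

Lemma lten_linearr p k b c : lten p (k *: b + c) = k *: lten p b + lten p c.
Proof.
apply: opE => x; apply/funext => l.
transitivity (k *: lten_fun p b x l + lten_fun p c x l) => //.
rewrite /= /lten_fun scaler_sumr -big_split; apply: eq_bigr => j _ /=.
by rewrite cmulDl cmulZl scalerDr !scalerA mulrC.
Qed.

Lemma lten0r p : lten p 0 = 0.
Proof. by have := lten_linearr p (-1) 0 0; rewrite scaleN1r oppr0 addr0 scaleN1r addNr. Qed.

Lemma ltenDr p b c : lten p (b + c) = lten p b + lten p c.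
Proof. by have := lten_linearr p 1 b c; rewrite !scale1r. Qed.

Lemma ltenZr p k b : lten p (k *: b) = k *: lten p b.
Proof. by have := lten_linearr p k b 0; rewrite lten0r !addr0. Qed.

Lemma lten0l b : lten 0 b = 0.
Proof. by have := lten_linearl b (-1) 0 0; rewrite scaleN1r oppr0 addr0 scaleN1r addNr. Qed.

Lemma ltenDl p q b : lten (p + q) b = lten p b + lten q b.
Proof. by have := lten_linearl b 1 p q; rewrite !scale1r. Qed.

Lemma ltenZl k p b : lten (k *: p) b = k *: lten p b.
Proof. by have := lten_linearl b k p 0; rewrite lten0l !addr0. Qed.

Lemma lten1 : lten cone cone = cone.
Proof.
apply: opE => x; apply/funext => k; rewrite /= /lten_fun (bigD1 k) //= cmulx1.
rewrite tb_orth eqxx scale1r cmul1x big1 ?addr0 // => j /negPf jk.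
by rewrite tb_orth eq_sym jk scale0r.
Qed.

(* An element of [P (x) B] is given by its coordinates in the basis [e]; [lam]
   is its left multiplication operator on [B^n], which defines the norm. *)
Let car : lmodType R[i] := ('I_n -> B : Type).

Definition tens p b : car := fun k => tr (cstar (e k) ** p) *: b.

Lemma lten_tens p b q c : opf (lten p b) (tens q c) = tens (p ** q) (b ** c).
Proof.
apply/funext => k; rewrite /= /lten_fun /tens.
under eq_bigr do rewrite cmulZr scalerA.
by rewrite -scaler_suml tr_contract cmulA.
Qed.

Lemma tens_basis (z : car) : \sum_i tens (e i) (z i) = z.
Proof.
apply/funext => k; rewrite fct_sumE (bigD1 k) //= /tens tb_orth eqxx scale1r.
by rewrite big1 ?addr0 // => j /negPf jk; rewrite tb_orth eq_sym jk scale0r.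
Qed.

Definition lam (z : car) : opC col := \sum_i lten (e i) (z i).

Lemma lam_tens p b : lam (tens p b) = lten p b.
Proof.
rewrite /lam /tens.
under eq_bigr do rewrite ltenZr -ltenZl.
rewrite [in RHS](tb_expand tb p); elim/big_rec2: _ => [|i x y _ ->]; first by rewrite lten0l.
by rewrite ltenDl.
Qed.

Lemma lam_linear k (z w : car) : lam (k *: z + w) = k *: lam z + lam w.
Proof.
rewrite /lam scaler_sumr -big_split; apply: eq_bigr => i _ /=.
exact: lten_linearr.
Qed.

(** The vector [1 (x) 1] is separating. This gives the injectivity of [lam], and in [tnorm_coord]
    the control of the coordinates by the norm. *)
Lemma lam_one z : opf (lam z) (tens cone cone) = z.
Proof.
rewrite -[RHS]tens_basis /lam.
transitivity (\sum_i opf (lten (e i) (z i)) (tens cone cone)).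
  elim: (index_enum _) => [|i r IH]; first by rewrite !big_nil op0E.
  by rewrite !big_cons opDE IH.
by apply: eq_bigr => i _; rewrite lten_tens !cmulx1.
Qed.

Lemma lam_inj z w : lam z = lam w -> z = w.
Proof. by move=> h; rewrite -(lam_one z) h lam_one. Qed.

Lemma lam0 : lam 0 = 0.
Proof. by rewrite /lam big1 // => i _; rewrite lten0r. Qed.

Lemma lamD z w : lam (z + w) = lam z + lam w.
Proof. by have := lam_linear 1 z w; rewrite !scale1r. Qed.

Lemma lamZ k z : lam (k *: z) = k *: lam z.
Proof. by have := lam_linear k z 0; rewrite lam0 !addr0. Qed.

Lemma lamN z : lam (- z) = - lam z.
Proof. by rewrite -scaleN1r lamZ scaleN1r. Qed.

Lemma lam_sum (I : finType) (F : I -> car) : lam (\sum_i F i) = \sum_i lam (F i).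
Proof. by apply: (big_morph lam) => [u v|]; rewrite ?lamD ?lam0. Qed.

Definition tmul (z w : car) : car := \sum_i \sum_j tens (e i ** e j) (z i ** w j).

Definition tstar (z : car) : car := \sum_i tens (cstar (e i)) (cstar (z i)).

Lemma lam_mul z w : lam (tmul z w) = lam z ** lam w.
Proof.
rewrite /tmul lam_sum cmul_suml; apply: eq_bigr => i _.
rewrite lam_sum cmul_sumr; apply: eq_bigr => j _.
by rewrite lam_tens lten_mul.
Qed.

Lemma lam_star z : lam (tstar z) = cstar (lam z).
Proof.
rewrite /tstar lam_sum cstar_sum; apply: eq_bigr => i _.
by rewrite lam_tens lten_star.
Qed.

Lemma lam1 : lam (tens cone cone) = cone.
Proof. by rewrite lam_tens lten1. Qed.

Definition tnorm (z : car) : R := nrm (lam z).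

Lemma lten1_hom : star_hom (lten cone).
Proof.
split=> [k b c|b c|b]; first exact: lten_linearr.
  by rewrite lten_mul cmulx1.
by rewrite lten_star cstar1.
Qed.

Lemma nrm_lten p b : nrm (lten p b) <= nrm (lten p cone) * nrm b.
Proof.
have -> : lten p b = lten p cone ** lten cone b by rewrite lten_mul cmulx1 cmul1x.
apply: le_trans (nrm_cmul _ _) _; apply: ler_wpM2l; first exact: nrm_ge0.
exact: hom_contractive lten1_hom lten1 _.
Qed.

Lemma tnorm_coord : exists2 C, 0 <= C & forall z i, nrm (z i) <= C * tnorm z.
Proof.
exists (@hn R B col (tens cone cone)); first exact: hn_ge0.
move=> z i; apply: le_trans (col_coord_hn (z : col_pre B n) i) _.
rewrite [_ * tnorm z]mulrC -{1}(lam_one z).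
exact: (@opnP R B col (lam z) (tens cone cone)).
Qed.

Lemma tnorm_sum z : tnorm z <= \sum_i nrm (lten (e i) cone) * nrm (z i).
Proof.
apply: le_trans (nrm_sum _ _ _) _; apply: ler_sum => i _.
exact: nrm_lten.
Qed.

Lemma tnorm_complete (u : nat -> car) : fundamental tnorm u ->
  exists l, tends tnorm u l.
Proof.
move=> hu; have [C C0 hC] := tnorm_coord.
have hui i : fundamental (@nrm R B) (fun k => u k i).
  move=> eps eps0; have : 0 < eps / (C + 1) by rewrite divr_gt0 //; lra.
  move=> /hu[M hM]; exists M => j k hj hk.
  apply: le_lt_trans (hC (u j - u k) i) _.
  apply: (@le_lt_trans _ _ ((C + 1) * tnorm (u j - u k))).
    by apply: ler_wpM2r; [exact: nrm_ge0|lra].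
  by rewrite mulrC -ltr_pdivlMr; [exact: hM|lra].
have [l hl] := choice (fun i => complete_tends (hui i)).
exists l => eps eps0.
have [i|i|M hM] := @weighted_sum_small R n (fun i => nrm (lten (e i) cone))
  (fun i k => nrm (u k i - l i)) _ _ eps eps0.
- exact: nrm_ge0.
- exact: hl.
exists M => k /hM; apply: le_lt_trans; exact: tnorm_sum.
Qed.

(** The algebraic axioms are pulled back along the injective [lam]. Completeness is inherited from
    [B], the norm being equivalent to the norms of the coordinates. *)
Definition tens_data : cstar_data R.
Proof.
refine (@CstarData R car tmul tstar (tens cone cone) tnorm
  _ _ _ tnorm_complete _ _ _ _ _ _ _ _ _ _).
- by move=> x y; rewrite /tnorm lamD; exact: nrmD.
- by move=> k x; rewrite /tnorm lamZ; exact: nrmZ.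
- by move=> x /nrm0_eq0; rewrite -lam0 => /lam_inj.
- by move=> x y z; apply: lam_inj; rewrite !lam_mul cmulA.
- by move=> y k x z; apply: lam_inj; rewrite lam_linear !lam_mul lam_linear cmulDl cmulZl.
- by move=> y k x z; apply: lam_inj; rewrite lam_linear !lam_mul lam_linear cmulDr cmulZr.
- by move=> x; apply: lam_inj; rewrite !lam_star cstarK.
- by move=> k x y; apply: lam_inj; rewrite lam_linear !lam_star lam_linear cstar_conj_linear.
- by move=> x y; apply: lam_inj; rewrite lam_mul !lam_star lam_mul cstarM.
- by move=> x y; rewrite /tnorm lam_mul; exact: nrm_cmul.
- by move=> x; rewrite /tnorm lam_mul lam_star; exact: nrm_cstar_cmul.
- by move=> x; apply: lam_inj; rewrite lam_mul lam1 cmul1x.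
- by move=> x; apply: lam_inj; rewrite lam_mul lam1 cmulx1.
Defined.

Definition tensC : unitalCstarAlgType R := calgU tens_data.

End OneAlgebra.
End TensorWithFiniteDim.

Section Corner.
Variables (R : realType) (C : cstarAlgType R) (p : C).
Hypotheses (psa : cstar p = p) (pp : p ** p = p).

(** The corner [p C p] has unit [p] even if [C] has none, which makes the results on unital
    homomorphisms available for arbitrary tensor embeddings. *)
Definition in_corner (x : C) : Prop := p ** x = x /\ x ** p = x.

Lemma corner0 : in_corner 0.
Proof. by split; rewrite ?cmulx0 ?cmul0x. Qed.

Lemma corner_lin (k : R[i]) x y : in_corner x -> in_corner y -> in_corner (k *: x + y).
Proof.
move=> [x1 x2] [y1 y2]; split.
  by rewrite cmulDr cmulZr x1 y1.
by rewrite cmulDl cmulZl x2 y2.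
Qed.

Definition corner_submod : submod C := Submod corner0 corner_lin.
Let car := subl corner_submod.

Lemma corner_mul_proof (x y : car) : corner_submod (sl_val x ** sl_val y).
Proof.
have [x1 x2] := subl_prop x; have [y1 y2] := subl_prop y.
by split; rewrite ?cmulA ?x1 // -cmulA y2.
Qed.

Lemma corner_star_proof (x : car) : corner_submod (cstar (sl_val x)).
Proof.
have [x1 x2] := subl_prop x.
by split; rewrite -{1}psa -cstarM ?x1 ?x2.
Qed.

Lemma corner_one_proof : corner_submod p. Proof. by []. Qed.

Lemma corner_complete (u : nat -> car) :
  fundamental (fun x : car => nrm (sl_val x)) u ->
  exists l, tends (fun x : car => nrm (sl_val x)) u l.
Proof.
move=> /complete_tends[l hl].
have hp : tends (@nrm R C) (fun=> p) p by apply: tends_cst; exact: nrm_seminorm.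
have uniq (v : nat -> C) x y : tends (@nrm R C) v x -> tends (@nrm R C) v y -> x = y.
  by apply: tends_unique; [exact: nrm_seminorm|exact: nrm0_eq0].
have hlp : corner_submod l.
  split.
    apply: (uniq _ _ _ _ hl); apply: (tends_ext _ (tends_cmul hp hl)) => k.
    by case: (subl_prop (u k)).
  apply: (uniq _ _ _ _ hl); apply: (tends_ext _ (tends_cmul hl hp)) => k.
  by case: (subl_prop (u k)).
by exists (mksubl hlp).
Qed.

Definition corner_data : cstar_data R.
Proof.
refine (@CstarData R car
  (fun x y => mksubl (corner_mul_proof x y)) (fun x => mksubl (corner_star_proof x))
  (mksubl corner_one_proof) (fun x => nrm (sl_val x))
  _ _ _ corner_complete _ _ _ _ _ _ _ _ _ _).
- by move=> x y; exact: nrmD.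
- by move=> k x; exact: nrmZ.
- by move=> x /nrm0_eq0 h; apply: subl_inj.
- by move=> x y z; apply: subl_inj; exact: cmulA.
- by move=> y k x z; apply: subl_inj; exact: cmul_linearl.
- by move=> y k x z; apply: subl_inj; exact: cmul_linearr.
- by move=> x; apply: subl_inj; exact: cstarK.
- by move=> k x y; apply: subl_inj; exact: cstar_conj_linear.
- by move=> x y; apply: subl_inj; exact: cstarM.
- by move=> x y; exact: nrm_cmul.
- by move=> x; exact: nrm_cstar_cmul.
- by move=> x; apply: subl_inj; case: (subl_prop x).
- by move=> x; apply: subl_inj; case: (subl_prop x).
Defined.

End Corner.

(* The image of the unit is a projection, whose corner is a unital C*-algebra. *)
Lemma inj_hom_nrm_le (R : realType) (A : unitalCstarAlgType R) (C : cstarAlgType R)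
    (f : A -> C) : star_hom f -> (forall x, f x = 0 -> x = 0) ->
  forall x, nrm x <= nrm (f x).
Proof.
move=> hf inj x; have [fl fm fs] := hf.
have psa : cstar (f cone) = f cone by rewrite -fs cstar1.
have pp : f cone ** f cone = f cone by rewrite -fm cmul1x.
have hc y : corner_submod (f cone) (f y) by split; rewrite -fm ?cmul1x ?cmulx1.
pose g (y : A) : calgU (corner_data psa pp) := mksubl (hc y).
have g1 : g cone = cone by apply: subl_inj.
have hg : star_hom g.
  split.
  - by move=> k y z; apply: subl_inj; exact: fl.
  - by move=> y z; apply: subl_inj; exact: fm.
  - by move=> y; apply: subl_inj; exact: fs.
rewrite -(hom_isometric hg g1); first exact: lexx.
by move=> y /(congr1 (@sl_val _ _ _)) /inj.
Qed.

Section MinTensor.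
Variables (R : realType) (P : unitalCstarAlgType R) (tb : trace_basis P).
Local Notation n := (tb_n tb).
Local Notation e := (@tb_e R P tb).
Local Notation tr := (@tb_tr R P tb).

Lemma tb_indep : lin_indep e.
Proof.
move=> c h k; have := congr1 (fun z => tr (cstar (e k) ** z)) h.
rewrite cmul_sumr tr_sum cmulx0 tr0 (bigD1 k) //= cmulZr trZ tb_orth eqxx mulr1.
by rewrite big1 ?addr0 // => j /negPf jk; rewrite cmulZr trZ tb_orth eq_sym jk mulr0.
Qed.

Section One.
Variable B : unitalCstarAlgType R.
Local Notation T := (tensC tb B).
Local Notation tn := (@tens R P tb B : P -> B -> T).
Implicit Types (z w : T) (p q : P) (b c : B).

Lemma tensC_lamM z w : lam (z ** w) = lam z ** lam w.
Proof. exact: lam_mul. Qed.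

Lemma tensC_lamS z : lam (cstar z) = cstar (lam z).
Proof. exact: lam_star. Qed.

Lemma tensM p q b c : tn p b ** tn q c = tn (p ** q) (b ** c).
Proof. by apply: lam_inj; rewrite tensC_lamM !lam_tens lten_mul. Qed.

Lemma tens_star p b : cstar (tn p b) = tn (cstar p) (cstar b).
Proof. by apply: lam_inj; rewrite tensC_lamS !lam_tens lten_star. Qed.

Lemma tens_linearl b : linear (fun p => tn p b).
Proof. by move=> k p q; apply: lam_inj; rewrite lam_linear !lam_tens lten_linearl. Qed.

Lemma tens_linearr p : linear (tn p).
Proof. by move=> k b c; apply: lam_inj; rewrite lam_linear !lam_tens lten_linearr. Qed.

Lemma tens1 : tn cone cone = cone. Proof. by []. Qed.

Lemma tensE z : z = \sum_i tn (e i) (z i).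
Proof. exact: (esym (tens_basis (z : 'I_n -> B))). Qed.

Lemma tens_nrm z : nrm z = nrm (lam z). Proof. by []. Qed.

Lemma tens_sum_coord m (a : 'I_m -> P) (b : 'I_m -> B) k :
  (\sum_i tn (a i) (b i)) k = \sum_i tr (cstar (e k) ** a i) *: b i.
Proof. by elim/big_ind2: _ => // [x y z w <- <-]. Qed.

(** The matrix of coordinates of an independent family is row free, and [g] is read from a right
    inverse of it. *)
Lemma lin_indep_left_inverse m (a : 'I_m -> P) : lin_indep a ->
  exists g : 'I_m -> 'I_n -> R[i], forall i j,
    \sum_k g i k * tr (cstar (e k) ** a j) = (i == j)%:R.
Proof.
move=> ha; pose M : 'M[R[i]]_(m, n) := \matrix_(j, k) tr (cstar (e k) ** a j).
have fM : row_free M.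
  apply/row_freeP; apply/row_freeP; rewrite -kermx_eq0; apply/eqP/row_matrixP => i.
  rewrite row0; set v := row i _; have hv : v *m M = 0.
    by apply/sub_kermxP; exact: row_sub.
  clearbody v.
  apply/rowP => j; rewrite [RHS]mxE; apply: (ha (fun j => v 0 j)).
  rewrite (tb_expand tb (\sum_i0 _)) big1 // => k _.
  have -> : tr (cstar (e k) ** \sum_j0 v 0 j0 *: a j0) = 0; last by rewrite scale0r.
  have := congr1 (fun N : 'rV_n => N 0 k) hv; rewrite !mxE => <-.
  rewrite cmul_sumr tr_sum; apply: eq_bigr => l _.
  by rewrite [in RHS]mxE cmulZr trZ.
have [G hG] := row_freeP fM.
exists (fun i k => G k i) => i j.
have := congr1 (fun N : 'M[R[i]]_m => N j i) hG; rewrite !mxE eq_sym => <-.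
by apply: eq_bigr => k _; rewrite mxE mulrC.
Qed.

Lemma tens_alg : alg_tensor_embedding tn.
Proof.
split.
- exact: tens_linearl.
- exact: tens_linearr.
- by move=> *; rewrite tensM.
- by move=> *; rewrite tens_star.
move=> m a b /lin_indep_left_inverse[g hg] h i.
have hk k : \sum_j tr (cstar (e k) ** a j) *: b j = 0.
  by rewrite -tens_sum_coord h.
have : \sum_k g i k *: \sum_j tr (cstar (e k) ** a j) *: b j = 0.
  by rewrite big1 // => k _; rewrite hk scaler0.
under eq_bigr do rewrite scaler_sumr.
rewrite exchange_big /= (bigD1 i) //=.
under eq_bigr do rewrite scalerA.
rewrite -scaler_suml hg eqxx scale1r big1 ?addr0 // => j /negPf ij.
under eq_bigr do rewrite scalerA.
by rewrite -scaler_suml hg eq_sym ij scale0r.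
Qed.

Section FromEmbedding.
Variables (E : cstarAlgType R) (t : P -> B -> E).
Hypothesis ht : alg_tensor_embedding t.

Definition tens_lift (z : T) : E := \sum_i t (e i) (z i).

Lemma emb0l b : t 0 b = 0.
Proof. by have := ten_linearl ht b (-1) 0 0; rewrite scaleN1r oppr0 addr0 scaleN1r addNr. Qed.

Lemma emb0r p : t p 0 = 0.
Proof. by have := ten_linearr ht p (-1) 0 0; rewrite scaleN1r oppr0 addr0 scaleN1r addNr. Qed.

Lemma embZl k p b : t (k *: p) b = k *: t p b.
Proof. by have := ten_linearl ht b k p 0; rewrite emb0l !addr0. Qed.

Lemma embZr k p b : t p (k *: b) = k *: t p b.
Proof. by have := ten_linearr ht p k b 0; rewrite emb0r !addr0. Qed.

Lemma emb_suml (I : finType) (F : I -> P) b : t (\sum_i F i) b = \sum_i t (F i) b.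
Proof.
apply: (big_morph (fun p => t p b)) => [x y|]; last exact: emb0l.
by have := ten_linearl ht b 1 x y; rewrite !scale1r.
Qed.

Lemma tens_lift_linear : linear tens_lift.
Proof.
move=> k z w; rewrite /tens_lift scaler_sumr -big_split; apply: eq_bigr => i _ /=.
by rewrite (ten_linearr ht).
Qed.

Lemma tens_lift_tens p b : tens_lift (tn p b) = t p b.
Proof.
rewrite [in RHS](tb_expand tb p) emb_suml; apply: eq_bigr => i _.
by rewrite embZl -embZr.
Qed.

Lemma tens_lift_sum (I : finType) (F : I -> T) :
  tens_lift (\sum_i F i) = \sum_i tens_lift (F i).
Proof.
apply: (big_morph tens_lift) => [x y|].
  by have := tens_lift_linear 1 x y; rewrite !scale1r.
by rewrite /tens_lift big1 // => i _; rewrite emb0r.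
Qed.

Lemma tens_lift_hom : star_hom tens_lift.
Proof.
split=> [|z w|z]; first exact: tens_lift_linear.
  rewrite {1}(tensE z) {1}(tensE w) cmul_suml tens_lift_sum [in RHS]/tens_lift cmul_suml.
  apply: eq_bigr => i _; rewrite !cmul_sumr tens_lift_sum; apply: eq_bigr => j _.
  by rewrite tensM tens_lift_tens (ten_mul ht).
rewrite {1}(tensE z) cstar_sum tens_lift_sum cstar_sum; apply: eq_bigr => i _.
by rewrite tens_star tens_lift_tens (ten_star ht).
Qed.

Lemma tens_lift_inj z : tens_lift z = 0 -> z = 0.
Proof. by move=> h; apply/funext => i; rewrite (ten_inj ht tb_indep h i). Qed.

Lemma tens_lift_nrm z : nrm z <= nrm (tens_lift z).
Proof. exact: inj_hom_nrm_le tens_lift_hom tens_lift_inj z. Qed.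

End FromEmbedding.

(** As [P] is finite-dimensional, the algebraic tensor product is already complete. An injective
    star-homomorphism out of it does not decrease the norm, so its norm is below that of every other
    embedding. *)
Lemma tens_min : is_min_tensor tn.
Proof.
split; first exact: tens_alg.
- apply/seteqP; split=> // z _; apply: subset_closure.
  exists n, (fun=> 1), (fun i => tn (e i) (z i)); split.
    by move=> i; exists (e i), (z i).
  by rewrite {1}(tensE z); apply: eq_bigr => i _; rewrite scale1r.
move=> E t ht m a b.
have -> : \sum_i t (a i) (b i) = tens_lift t (\sum_i tn (a i) (b i)).
  by rewrite tens_lift_sum //; apply: eq_bigr => i _; rewrite tens_lift_tens.
by rewrite !normE lecR; exact: tens_lift_nrm.
Qed.

(** A square root of [lam z] is not known to come from [P (x) B]; but [lam] is isometric and unital,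
    so the norm criterion for positivity reads the same on both sides. *)
Lemma tens_pos z : sa z -> (forall x, pos (col_ip x (opf (lam z) x))) -> pos z.
Proof.
move=> sz h; have plz : pos (lam z).
  by apply: pos_form => //; rewrite /sa -tensC_lamS sz.
apply: (@nrm_pos _ _ z (nrm z)) => //.
have -> : nrm (rone T (nrm z) - z) = nrm (rone (opC (colmod B n)) (nrm z) - lam z).
  rewrite tens_nrm; congr nrm; rewrite -[rone T _ - z]/(_ + _) lamD lamN lamZ lam1.
  by [].
exact: pos_nrm.
Qed.

End One.
End MinTensor.

(** * States *)

Section States.
Variables (R : realType) (O : unitalCstarAlgType R).
Hypothesis O_neq0 : (cone : O) <> 0.
Implicit Types (x y : O) (q : O -> R).

(** Hahn-Banach is reached through minimal sublinear functionals on [O] as a real space: Zorn's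
    lemma gives one, and minimality makes it additive. *)
Record sublinear q : Prop := Sublinear {
  sub_add : forall x y, q (x + y) <= q x + q y;
  sub_hom : forall (t : R) x, 0 < t -> q (t%:C *: x) = t * q x;
  sub_0 : q 0 = 0 }.

Lemma sub_neg q x : sublinear q -> - q (- x) <= q x.
Proof. by move=> h; have := sub_add h x (- x); rewrite subrr sub_0 //; lra. Qed.

Lemma sublinear_hom_le q : q 0 = 0 ->
  (forall (t : R) x, 0 < t -> q (t%:C *: x) <= t * q x) ->
  forall (t : R) x, 0 < t -> q (t%:C *: x) = t * q x.
Proof.
move=> q0 h t x t0; apply/eqP; rewrite eq_le h //=.
have tV : 0 < t^-1 by rewrite invr_gt0.
have := h _ (t%:C *: x) tV; rewrite scalerA -rmorphM mulVf ?gt_eqF // scale1r.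
by rewrite ler_pdivlMl.
Qed.

(** Covers the two infima needed: over a chain in Zorn's lemma, and over [t >= 0] in the proof of
    additivity. *)
Lemma inf_sublinear (I : Type) (i0 : I) (g : I -> O -> R) (b : O -> R) :
  (forall i x, b x <= g i x) ->
  (forall i j x y, exists k, g k (x + y) <= g i x + g j y) ->
  (forall (t : R) x i, 0 < t -> exists k, g k (t%:C *: x) <= t * g i x) ->
  (forall i, 0 <= g i 0) -> (exists i, g i 0 <= 0) ->
  sublinear (fun x => inf (range (g^~ x))).
Proof.
move=> hb hadd hhom h0 [i1 hi1].
have hi x : has_inf (range (g^~ x)).
  by split; [exists (g i0 x), i0|exists (b x) => _ [i _ <-]].
have le_inf i x : inf (range (g^~ x)) <= g i x.
  by apply: ge_inf; [case: (hi x)|exists i].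
have q0 : inf (range (g^~ 0)) = 0.
  apply/eqP; rewrite eq_le (le_trans (le_inf i1 0)) //=.
  by apply: lb_le_inf; [case: (hi 0)|move=> _ [i _ <-]].
split=> // [x y|].
  rewrite -lerBlDr; apply: lb_le_inf; first by case: (hi x).
  move=> _ [i _ <-]; rewrite lerBlDr [_ + inf _]addrC -lerBlDr.
  apply: lb_le_inf; first by case: (hi y).
  move=> _ [j _ <-]; rewrite lerBlDr [_ + g i x]addrC.
  by have [k] := hadd i j x y; apply: le_trans.
apply: sublinear_hom_le => // t x t0.
rewrite -ler_pdivrMl //; apply: lb_le_inf; first by case: (hi x).
move=> _ [i _ <-]; rewrite ler_pdivrMl //.
by have [k] := hhom t x i t0; apply: le_trans.
Qed.

Definition bounded_sub (p : O -> R) := {q : O -> R | sublinear q /\ forall x, q x <= p x}.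

Definition mk_bounded_sub p q (h : sublinear q) (hp : forall x, q x <= p x) :
  bounded_sub p := exist (fun q => sublinear q /\ forall x, q x <= p x) q (conj h hp).

Lemma minimal_sublinear p : sublinear p -> exists2 q, sublinear q /\ (forall x, q x <= p x) &
  forall r, sublinear r -> (forall x, r x <= q x) -> r = q.
Proof.
move=> sp.
pose rel (q r : bounded_sub p) := `[< forall x, sval r x <= sval q x >].
have inj (q r : bounded_sub p) : sval q = sval r -> q = r.
  by case: q r => q hq [r hr] /= e; subst r; congr exist; exact: Prop_irrelevance.
have low (q : bounded_sub p) x : - p (- x) <= sval q x.
  have [sq hq] := svalP q; have := sub_neg x sq; have := hq (- x); lra.
have [||||q hmin] := @Zorn (bounded_sub p) rel.
- by move=> q; apply/asboolP.
- move=> q r s /asboolP h1 /asboolP h2; apply/asboolP => x.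
  exact: le_trans (h2 x) (h1 x).
- move=> q r /asboolP h1 /asboolP h2; apply: inj; apply/funext => x.
  by apply/eqP; rewrite eq_le h1 h2.
- move=> A tA; have [->|/set0P[a0 Aa0]] := eqVneq A set0.
    exists (mk_bounded_sub sp (fun x => lexx (p x))) => s [].
  pose I := {q : bounded_sub p | A q}.
  pose g (i : I) := sval (sval i).
  pose i0 : I := exist _ a0 Aa0.
  have hinf x : has_inf (range (g^~ x)).
    by split; [exists (g i0 x), i0|exists (- p (- x)) => _ [i _ <-]; exact: low].
  have sg i : sublinear (g i) by case: (svalP (sval i)).
  have sI : sublinear (fun x => inf (range (g^~ x))).
    apply: (@inf_sublinear _ i0 g (fun x => - p (- x))).
    + by move=> i x; exact: low.
    + move=> i j x y; have := tA _ _ (svalP i) (svalP j).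
      move=> [/asboolP h|/asboolP h].
        by exists j; apply: le_trans (sub_add (sg j) x y) _; rewrite lerD2r; exact: h.
      by exists i; apply: le_trans (sub_add (sg i) x y) _; rewrite lerD2l; exact: h.
    + by move=> t x i t0; exists i; rewrite (sub_hom (sg i)).
    + by move=> i; rewrite (sub_0 (sg i)).
    + by exists i0; rewrite (sub_0 (sg i0)).
  have hI x : inf (range (g^~ x)) <= p x.
    have [_ h] := svalP (sval i0); apply: le_trans (h x).
    by apply: ge_inf; [case: (hinf x)|exists i0].
  exists (mk_bounded_sub sI hI) => s As; apply/asboolP => x /=.
  by apply: ge_inf; [case: (hinf x)|exists (exist _ s As)].
exists (sval q); first by have [h1 h2] := svalP q.
move=> r sr hr; have hrp x : r x <= p x.
  by have [_ h] := svalP q; apply: le_trans (hr x) (h x).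
have h : rel q (mk_bounded_sub sr hrp) by apply/asboolP.
by have /(congr1 sval) := hmin _ h.
Qed.

(** The infimum over [t >= 0] of [q (x + t y) - t q y] is sublinear and below [q], hence equal to
    [q]; its term at [t = 1] is the missing inequality. *)
Lemma minimal_sublinear_additive q : sublinear q ->
  (forall r, sublinear r -> (forall x, r x <= q x) -> r = q) ->
  forall x y, q (x + y) = q x + q y.
Proof.
move=> sq hmin x y; apply/eqP; rewrite eq_le (sub_add sq) /=.
pose I := {t : R | 0 <= t}.
pose mkI (t : R) (h : 0 <= t) : I := exist (fun t : R => is_true (0 <= t)) t h.
pose i0 := mkI 0 (lexx 0).
pose g (i : I) x := q (x + (sval i)%:C *: y) - sval i * q y.
have hq (t : R) z : 0 <= t -> q (t%:C *: z) = t * q z.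
  rewrite le_eqVlt => /orP[/eqP <-|]; last exact: sub_hom.
  by rewrite scale0r mul0r sub_0.
have low i z : - q (- z) <= g i z.
  rewrite /g -hq; last exact: (svalP i).
  have := sub_add sq (z + (sval i)%:C *: y) (- z).
  by rewrite addrAC subrr add0r; lra.
have hinf z : has_inf (range (g^~ z)).
  by split; [exists (g i0 z), i0|exists (- q (- z)) => _ [i _ <-]; exact: low].
have sI : sublinear (fun x => inf (range (g^~ x))).
  apply: (@inf_sublinear _ i0 g (fun z => - q (- z))) => //.
  - move=> i j u v; have ij : 0 <= sval i + sval j.
      by apply: addr_ge0; [exact: (svalP i)|exact: (svalP j)].
    exists (mkI _ ij); rewrite /g /= rmorphD scalerDl addrACA.
    have := sub_add sq (u + (sval i)%:C *: y) (v + (sval j)%:C *: y); lra.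
  - move=> t u i t0; have ti : 0 <= t * sval i.
      by apply: mulr_ge0; [exact: ltW|exact: (svalP i)].
    exists (mkI _ ti); rewrite /g /= rmorphM -scalerA -scalerDr sub_hom //.
    by rewrite mulrBr mulrA.
  - by move=> i; rewrite /g add0r hq ?subrr //; exact: (svalP i).
  by exists i0; rewrite /g /= scale0r addr0 sub_0 // mul0r subrr.
have /(congr1 (@^~ x)) /= e : (fun z => inf (range (g^~ z))) = q.
  apply: hmin => // z; apply: (@le_trans _ _ (g i0 z)).
    by apply: ge_inf; [case: (hinf z)|exists i0].
  by rewrite /g /= scale0r addr0 mul0r subr0.
have : inf (range (g^~ x)) <= g (mkI 1 ler01) x.
  by apply: ge_inf; [case: (hinf x)|exists (mkI 1 ler01)].
rewrite e /g /= scale1r mul1r; lra.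
Qed.

Definition re x : O := 2^-1 *: (x + cstar x).

Lemma re_sa x : sa (re x).
Proof. by rewrite /sa cstar_half cstarD cstarK addrC. Qed.

Lemma reD x y : re (x + y) = re x + re y.
Proof. by rewrite /re cstarD addrACA scalerDr. Qed.

Lemma reZ (t : R) x : re (t%:C *: x) = t%:C *: re x.
Proof. by rewrite /re cstarZr -scalerDr !scalerA mulrC. Qed.

Lemma re_of_sa x : sa x -> re x = x.
Proof. by rewrite /re => ->; nc_ring_in R O; field. Qed.

Lemma re_of_skew x : sa x -> re ('i *: x) = 0.
Proof. by rewrite /re cstarZ conjCi => ->; rewrite scaleNr subrr scaler0. Qed.

Definition upper_set x : set R := [set t | pos (rone O t - re x)].

Lemma pos_rone_ge0 t : pos (rone O t) -> 0 <= t.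
Proof.
move=> pt; rewrite leNgt; apply/negP => t0; apply: O_neq0.
have /eqP : rone O t = 0.
  by apply: pos_anti => //; rewrite /rone -scaleNr -rmorphN; apply: pos_rone; lra.
rewrite scaler_eq0 => /orP[|/eqP //].
by rewrite eq_complex /= eqxx andbT => /eqP t1; move: t0; rewrite t1 ltxx.
Qed.

Lemma upper_set_low x t : upper_set x t -> - nrm (re x) <= t.
Proof.
move=> ht; have sx := saN (re_sa x).
have := pos_rone_nrm sx (lexx _); rewrite nrmN opprK => h.
have := posD ht h.
have -> : rone O t - re x + (rone O (nrm (re x)) + re x) = rone O (t + nrm (re x)).
  by rewrite /rone; nc_ring_in R O; ring.
by move=> /pos_rone_ge0; lra.
Qed.

Lemma upper_set_has_inf x : has_inf (upper_set x).
Proof.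
split; last by exists (- nrm (re x)) => t; exact: upper_set_low.
by exists (nrm (re x)); apply: pos_rone_nrm => //; exact: re_sa.
Qed.

(** The top of the spectrum of [re x]. *)
Definition upper x : R := inf (upper_set x).

Lemma upper_le x t : upper_set x t -> upper x <= t.
Proof. by move=> h; apply: ge_inf => //; case: (upper_set_has_inf x). Qed.

Lemma upper_sublinear : sublinear upper.
Proof.
have u0 : upper 0 = 0.
  have re0 : re 0 = 0 by rewrite /re cstar0 addr0 scaler0.
  apply/eqP; rewrite eq_le upper_le /=; last first.
    by rewrite /upper_set /= re0 subr0; apply: pos_rone.
  apply: lb_le_inf; first by case: (upper_set_has_inf 0).
  by move=> t; rewrite /upper_set /= re0 subr0; exact: pos_rone_ge0.
split=> // [x y|].
  rewrite -lerBlDr; apply: lb_le_inf; first by case: (upper_set_has_inf x).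
  move=> s hs; rewrite lerBlDr [s + _]addrC -lerBlDr.
  apply: lb_le_inf; first by case: (upper_set_has_inf y).
  move=> t ht; rewrite lerBlDr [t + s]addrC; apply: upper_le; rewrite /upper_set /=.
  have -> : rone O (s + t) - re (x + y) = (rone O s - re x) + (rone O t - re y).
    by rewrite reD /rone; nc_ring_in R O; ring.
  exact: posD.
apply: sublinear_hom_le => // t x t0.
rewrite -ler_pdivrMl //; apply: lb_le_inf; first by case: (upper_set_has_inf x).
move=> s hs; rewrite ler_pdivrMl //; apply: upper_le; rewrite /upper_set /=.
have -> : rone O (t * s) - re (t%:C *: x) = t%:C *: (rone O s - re x).
  by rewrite reZ scalerBr /rone [_ *: (_ *: cone)]scalerA -rmorphM.
by apply: posZ => //; exact: ltW.
Qed.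

Record state := State {
  st_fun :> O -> R[i];
  st_linear : forall (k : R[i]) x y, st_fun (k *: x + y) = k * st_fun x + st_fun y;
  st_star : forall x, st_fun (cstar x) = Num.conj (st_fun x);
  st_pos : forall x, 0 <= st_fun (cstar x ** x);
  st_one : st_fun cone = 1 }.

(** A real-linear [f] dominated by [upper] is nonnegative on positive elements, takes the value 1 at
    the unit, and vanishes on ['i *: x] for [x] self-adjoint; it is the real part of a state. *)
Lemma state_exists : exists s : state, True.
Proof.
have [f [sf hf] hmin] := minimal_sublinear upper_sublinear.
have fD := minimal_sublinear_additive sf hmin.
have f0 := sub_0 sf.
have fN x : f (- x) = - f x.
  by apply/eqP; rewrite -subr_eq0 opprK -fD addNr f0.
have fZ (t : R) x : f (t%:C *: x) = t * f x.
  have [t0|t0|<-] := ltgtP 0 t; last by rewrite scale0r mul0r f0.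
    exact: sub_hom.
  have := sub_hom sf x (_ : 0 < - t); rewrite rmorphN scaleNr fN mulNr => h.
  by apply: oppr_inj; apply: h; lra.
have fpos a : pos a -> 0 <= f a.
  move=> pa; have := hf (- a); rewrite fN => h.
  have : upper (- a) <= 0.
    apply: upper_le; rewrite /upper_set /= re_of_sa; last exact: (saN (pos_sa pa)).
    by rewrite /rone scale0r sub0r opprK.
  lra.
have f1 : f cone = 1.
  apply/eqP; rewrite eq_le; apply/andP; split.
    apply: le_trans (hf _) _; apply: upper_le; rewrite /upper_set /=.
    by rewrite re_of_sa /rone ?scale1r ?subrr; [exact: pos0|exact: sa1].
  have : f (- cone) <= - 1.
    apply: le_trans (hf _) _; apply: upper_le; rewrite /upper_set /=.
    rewrite re_of_sa; last exact: (saN (sa1 O)).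
    by rewrite /rone rmorphN scaleNr scale1r subrr; exact: pos0.
  by rewrite fN; lra.
have fskew x : sa x -> f ('i *: x) = 0.
  move=> sx.
  have le y : sa y -> f ('i *: y) <= 0.
    move=> sy; apply: le_trans (hf _) _; apply: upper_le; rewrite /upper_set /=.
    by rewrite re_of_skew // /rone scale0r subr0; exact: pos0.
  apply/eqP; rewrite eq_le le //=; have := le _ (saN sx).
  by rewrite scalerN fN; lra.
have fstar x : f (cstar x) = f x.
  have i2 : ('i : R[i]) * 'i = -1 by rewrite -expr2 sqrCi.
  have e : x - cstar x = - ('i *: ('i *: (x - cstar x))).
    by rewrite scalerA i2 scaleN1r opprK.
  have : f (x - cstar x) = 0.
    rewrite e fN fskew ?oppr0 //.
    by rewrite /sa cstarZ conjCi cstarB cstarK scaleNr -scalerN opprB.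
  by rewrite fD fN; lra.
(* A complex-linear functional is recovered from its real part [f]. *)
pose w x : R[i] := (f x)%:C - 'i * (f ('i *: x))%:C.
have i2 : ('i : R[i]) * 'i = -1 by rewrite -expr2 sqrCi.
have wD x y : w (x + y) = w x + w y.
  by rewrite /w scalerDr !fD 2!(rmorphD (real_complex R)) mulrDr opprD addrACA.
have wR (t : R) x : w (t%:C *: x) = t%:C * w x.
  by rewrite /w scalerA ['i * t%:C]mulrC -scalerA !fZ 2!(rmorphM (real_complex R)) mulrCA -mulrBr.
have wI x : w ('i *: x) = 'i * w x.
  by rewrite /w scalerA i2 scaleN1r fN (rmorphN (real_complex R)) mulrBr mulrA i2 mulN1r mulrN !opprK addrC.
have kE (k : R[i]) : k = (complex.Re k)%:C + (complex.Im k)%:C * 'i.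
  by rewrite {1}[k]complexE mulrC.
refine (ex_intro _ (@State w _ _ _ _) Logic.I).
- move=> k x y; rewrite wD; congr (_ + _).
  by rewrite {1}(kE k) scalerDl wD -scalerA !wR wI [in RHS](kE k) mulrDl mulrA.
- move=> x; have e : 'i *: cstar x = - cstar ('i *: x).
    by rewrite cstarZ conjCi scaleNr opprK.
  by rewrite /w e fN !fstar (rmorphN (real_complex R)) rmorphB rmorphM /= conjCi !conj_realC mulrN mulNr.
- move=> x; rewrite /w fskew; last exact: sa_xx.
  by rewrite mulr0 subr0 ler0c; apply: fpos; exact: pos_xx.
by rewrite /w f1 fskew ?mulr0 ?subr0 //; exact: sa1.
Qed.

End States.

(** * Completion and dilation of kernels *)

Section Completion.
Variables (R : realType) (B : unitalCstarAlgType R) (N : premod B).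
Local Notation ip := (@pm_ip R B N).
Local Notation hN := (@hn R B N).
Local Notation nB := (@nrm R B).
Implicit Types (x y z : N) (u v : nat -> N) (b : B).

Let fnB : lmodType R[i] := (N -> B : Type).

(* A point of the completion is the functional [x |-> lim <x, u n>], which
   avoids quotienting the Cauchy sequences. *)
Definition represents u (phi : fnB) : Prop :=
  fundamental hN u /\ forall x, tends nB (fun n => ip x (u n)) (phi x).

Definition in_completion (phi : fnB) : Prop := exists u, represents u phi.

Lemma fundamental_lin (k : R[i]) u v : fundamental hN u -> fundamental hN v ->
  fundamental hN (fun n => k *: u n + v n).
Proof.
move=> hu hv e e0; have k0 := Re_norm_ge0 k.
have e1 : 0 < e / 2 / (complex.Re `|k| + 1) by rewrite !divr_gt0 //; lra.
have e2 : 0 < e / 2 by lra.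
have [M hM] := hu _ e1; have [K hK] := hv _ e2.
exists (maxn M K) => i j; rewrite !geq_max => /andP[i1 i2] /andP[j1 j2].
have -> : k *: u i + v i - (k *: u j + v j) = k *: (u i - u j) + (v i - v j).
  by rewrite opprD addrACA scalerBr.
apply: (le_lt_trans (seminormD (hn_seminorm N) _ _)).
rewrite (splitr e); apply: ler_ltD; last exact: hK.
rewrite hnZ; apply: (@le_trans _ _ ((complex.Re `|k| + 1) * hN (u i - u j))).
  by apply: ler_wpM2r; [exact: hn_ge0|lra].
rewrite mulrC -ler_pdivlMr; last lra.
by apply: ltW; exact: hM.
Qed.

Lemma represents_lin (k : R[i]) u v (phi psi : fnB) : represents u phi ->
  represents v psi -> represents (fun n => k *: u n + v n) (k *: phi + psi).
Proof.
move=> [hu hphi] [hv hpsi]; split; first exact: fundamental_lin.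
move=> x; apply: (@tends_ext _ _ _ (fun n => k *: ip x (u n) + ip x (v n))).
  by move=> n; rewrite ipDr ipZr.
apply: tendsD; [exact: nrm_seminorm|exact: tendsZ (hphi x)|exact: hpsi].
Qed.

Lemma represents_cst y : represents (fun=> y) (fun x => ip x y).
Proof.
split; last by move=> x; apply: tends_cst; exact: nrm_seminorm.
by move=> e e0; exists 0%N => j k _ _; rewrite subrr (seminorm0 (hn_seminorm N)).
Qed.

Lemma in_completion0 : in_completion 0.
Proof.
exists (fun=> 0); have := represents_cst 0; congr represents.
by apply/funext => x; rewrite ip0r.
Qed.

Lemma in_completion_lin (k : R[i]) (phi psi : fnB) : in_completion phi ->
  in_completion psi -> in_completion (k *: phi + psi).
Proof.
by move=> [u hu] [v hv]; exists (fun n => k *: u n + v n); exact: represents_lin.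
Qed.

Definition compl_submod : submod fnB := Submod in_completion0 in_completion_lin.
Definition compl : lmodType R[i] := subl compl_submod.
Implicit Types (phi psi chi : compl).

Lemma repr_ex phi : {u | represents u (sl_val phi)}.
Proof. exact: cid (subl_prop phi). Qed.

Definition reps phi := projT1 (repr_ex phi).
Lemma repsP phi : represents (reps phi) (sl_val phi).
Proof. exact: projT2 (repr_ex phi). Qed.

Lemma compl_ext phi psi : (forall x, sl_val phi x = sl_val psi x) -> phi = psi.
Proof. by move=> h; apply: subl_inj; apply/funext. Qed.

(** For a Cauchy sequence weak convergence to zero is strong: split [<u k, u k>] as
    [<u M, u k> + <u k - u M, u k>]. So a functional determines its representing sequence up to a
    null sequence. *)
Lemma null_sequence u : fundamental hN u ->
  (forall x, tends nB (fun n => ip x (u n)) 0) -> tends hN u 0.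
Proof.
move=> hu h0 e e0; have [C hC] := fundamental_bounded (hn_seminorm N) hu.
have C0 : 0 <= C by apply: le_trans (hC 0%N); exact: hn_ge0.
have d0 : 0 < e ^+ 2 / 2 / (C + 1) by rewrite !divr_gt0 ?exprn_gt0 //; lra.
have [M hM] := hu _ d0.
have d1 : 0 < e ^+ 2 / 2 by rewrite divr_gt0 ?exprn_gt0.
have [K hK] := h0 (u M) _ d1.
exists (maxn M K) => k; rewrite geq_max => /andP[k1 k2]; rewrite subr0.
rewrite -(@ltr_pXn2r _ 2) ?nnegrE ?hn_ge0 ?ltW // hn_sqr.
have -> : ip (u k) (u k) = ip (u M) (u k) + ip (u k - u M) (u k).
  by rewrite ipBl addrCA subrr addr0.
apply: (le_lt_trans (nrmD _ _)); rewrite (splitr (e ^+ 2)); apply: ltr_leD.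
  by have := hK _ k2; rewrite subr0.
apply: (le_trans (cauchy_schwarz _ _)).
apply: (@le_trans _ _ (hN (u k - u M) * (C + 1))).
  by apply: ler_wpM2l; [exact: hn_ge0|have := hC k; lra].
by rewrite -ler_pdivlMr; [apply: ltW; exact: hM|lra].
Qed.

Lemma fundamental_ip u v : fundamental hN u -> fundamental hN v ->
  fundamental nB (fun n => ip (u n) (v n)).
Proof.
move=> hu hv e e0.
have [C hC] := fundamental_bounded (hn_seminorm N) hu.
have [D hD] := fundamental_bounded (hn_seminorm N) hv.
have C0 : 0 <= C by apply: le_trans (hC 0%N); exact: hn_ge0.
have D0 : 0 <= D by apply: le_trans (hD 0%N); exact: hn_ge0.
have d1 : 0 < e / 2 / (C + 1) by rewrite !divr_gt0 //; lra.
have d2 : 0 < e / 2 / (D + 1) by rewrite !divr_gt0 //; lra.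
have [M hM] := hv _ d1; have [K hK] := hu _ d2.
exists (maxn M K) => i j; rewrite !geq_max => /andP[i1 i2] /andP[j1 j2].
have -> : ip (u i) (v i) - ip (u j) (v j) = ip (u i) (v i - v j) + ip (u i - u j) (v j).
  by rewrite ipBr ipBl addrA subrK.
apply: (le_lt_trans (nrmD _ _)); rewrite (splitr e); apply: ltr_leD.
  apply: (le_lt_trans (cauchy_schwarz _ _)).
  apply: (@le_lt_trans _ _ ((C + 1) * hN (v i - v j))).
    by apply: ler_wpM2r; [exact: hn_ge0|have := hC i; lra].
  by rewrite mulrC -ltr_pdivlMr; [exact: hM|lra].
apply: (le_trans (cauchy_schwarz _ _)).
apply: (@le_trans _ _ (hN (u i - u j) * (D + 1))).
  by apply: ler_wpM2l; [exact: hn_ge0|have := hD j; lra].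
by rewrite -ler_pdivlMr; [apply: ltW; exact: hK|lra].
Qed.

Definition cip phi psi : B :=
  projT1 (cid (complete_tends (fundamental_ip (proj1 (repsP phi)) (proj1 (repsP psi))))).

Lemma cip_reps phi psi :
  tends nB (fun n => ip (reps phi n) (reps psi n)) (cip phi psi).
Proof. by rewrite /cip; case: cid. Qed.

Lemma represents_diff u v phi : represents u (sl_val phi) ->
  represents v (sl_val phi) -> tends hN (fun n => u n - v n) 0.
Proof.
move=> [hu hphi] [hv hphi']; apply: null_sequence.
  have := fundamental_lin (-1) hv hu; congr (fundamental hN).
  by apply/funext => n; rewrite scaleN1r addrC.
move=> x; rewrite -(subrr (sl_val phi x)).
apply: (@tends_ext _ _ _ (fun n => ip x (u n) - ip x (v n))).
  by move=> n; rewrite ipBr.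
by apply: tendsB; [exact: nrm_seminorm|exact: hphi|exact: hphi'].
Qed.

Lemma tends_ip_null u v : fundamental hN u -> tends hN v 0 ->
  tends nB (fun n => ip (u n) (v n)) 0.
Proof.
move=> hu hv e e0; have [C hC] := fundamental_bounded (hn_seminorm N) hu.
have C0 : 0 <= C by apply: le_trans (hC 0%N); exact: hn_ge0.
have d : 0 < e / (C + 1) by rewrite divr_gt0 //; lra.
have [M hM] := hv _ d; exists M => k /hM; rewrite !subr0 => h.
apply: (le_lt_trans (cauchy_schwarz _ _)).
apply: (@le_lt_trans _ _ ((C + 1) * hN (v k))).
  by apply: ler_wpM2r; [exact: hn_ge0|have := hC k; lra].
by rewrite mulrC -ltr_pdivlMr //; lra.
Qed.

(** The inner product does not depend on the representatives chosen in [reps]; all later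
    computations go through this. *)
Lemma cip_lim u v phi psi : represents u (sl_val phi) -> represents v (sl_val psi) ->
  tends nB (fun n => ip (u n) (v n)) (cip phi psi).
Proof.
move=> hu hv; have [fu _] := hu; have [fv _] := hv.
have [fp _] := repsP phi; have [fq _] := repsP psi.
have h1 := tends_ip_null fu (represents_diff hv (repsP psi)).
have h2 := tends_ip_null fq (represents_diff hu (repsP phi)).
have h2' : tends nB (fun n => ip (u n - reps phi n) (reps psi n)) 0.
  move=> e /h2[M hM]; exists M => k /hM; rewrite !subr0.
  by rewrite -[ip (u k - _) _]pm_star nrm_cstar.
have := tendsD (nrm_seminorm B) (tendsD (nrm_seminorm B) h1 h2') (cip_reps phi psi).
rewrite addr0 add0r; apply: tends_ext => n.
by rewrite ipBr ipBl addrA !subrK.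
Qed.

Lemma cip_uniq u v phi psi c : represents u (sl_val phi) -> represents v (sl_val psi) ->
  tends nB (fun n => ip (u n) (v n)) c -> cip phi psi = c.
Proof. by move=> hu hv hc; apply: (tends_uniq (cip_lim hu hv) hc). Qed.

Lemma cip_linear phi : linear (cip phi).
Proof.
move=> k psi chi; apply: (cip_uniq (repsP phi)
  (represents_lin k (repsP psi) (repsP chi) : represents _ (sl_val (k *: psi + chi)))).
apply: (@tends_ext _ _ _ (fun n => k *: ip (reps phi n) (reps psi n)
   + ip (reps phi n) (reps chi n))) => [n|]; first by rewrite ipDr ipZr.
apply: tendsD; [exact: nrm_seminorm|apply: tendsZ; exact: cip_reps|exact: cip_reps].
Qed.

Lemma cip_star phi psi : cstar (cip phi psi) = cip psi phi.
Proof.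
apply/esym; apply: (cip_uniq (repsP psi) (repsP phi)).
by apply: (tends_ext _ (tends_cstar (cip_reps phi psi))) => n; rewrite pm_star.
Qed.

Lemma represents_act u (phi : fnB) b : represents u phi ->
  represents (fun n => pm_act (u n) b) ((fun x => phi x ** b) : fnB).
Proof.
have cst : tends nB (fun=> b) b by apply: tends_cst; exact: nrm_seminorm.
move=> [hu hphi]; split; last first.
  move=> x; apply: (tends_ext _ (tends_cmul (hphi x) cst)) => n.
  by rewrite pm_ipM.
move=> e e0; have b0 : 0 <= nrm b by exact: nrm_ge0.
have [|M hM] := hu (e / (nrm b + 1)); first by rewrite divr_gt0 //; lra.
exists M => j k hj hk.
have -> : pm_act (u j) b - pm_act (u k) b = pm_act (u j - u k) b.
  by apply: ip_ext => z; rewrite ipBr !pm_ipM ipBr cmulBl.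
apply: (le_lt_trans (hn_act _ _)).
apply: (@le_lt_trans _ _ ((nrm b + 1) * hN (u j - u k))).
  by apply: ler_wpM2r; [exact: hn_ge0|lra].
by rewrite mulrC -ltr_pdivlMr; [exact: hM|lra].
Qed.

Lemma compl_act_proof phi b : compl_submod (fun x => sl_val phi x ** b).
Proof.
by exists (fun n => pm_act (reps phi n) b); apply: represents_act; exact: repsP.
Qed.

Definition compl_act phi b : compl := mksubl (compl_act_proof phi b).

Lemma cip_act phi psi b : cip phi (compl_act psi b) = cip phi psi ** b.
Proof.
apply: (cip_uniq (repsP phi)
  (represents_act b (repsP psi) : represents _ (sl_val (compl_act psi b)))).
have cst : tends nB (fun=> b) b by apply: tends_cst; exact: nrm_seminorm.
apply: (tends_ext _ (tends_cmul (cip_reps phi psi) cst)) => n.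
by rewrite pm_ipM.
Qed.

Lemma cip_pos phi : pos (cip phi phi).
Proof. by apply: (pos_tends _ (cip_reps phi phi)) => n; exact: pm_pos. Qed.

Lemma cip_def phi : cip phi phi = 0 -> phi = 0.
Proof.
move=> h; have := cip_reps phi phi; rewrite h => h0.
have hu : tends hN (reps phi) 0.
  move=> e e0; have [|M hM] := h0 (e ^+ 2); first by rewrite exprn_gt0.
  exists M => k /hM; rewrite !subr0 -hn_sqr => h1.
  by rewrite -(@ltr_pXn2r _ 2) ?nnegrE ?hn_ge0 ?ltW.
apply: compl_ext => x; have [_ hx] := repsP phi.
apply: (tends_uniq (hx x)).
have [fx _] := represents_cst x.
exact: tends_ip_null fx hu.
Qed.

Definition compl_pre : premod B :=
  PreMod cip_linear cip_star cip_act cip_pos cip_def.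

Lemma compl_emb_proof y : compl_submod (fun x => ip x y).
Proof. by exists (fun=> y); exact: represents_cst. Qed.

Definition emb y : compl_pre := mksubl (compl_emb_proof y).

Lemma cip_emb x y : cip (emb x) (emb y) = ip x y.
Proof.
apply: (cip_uniq (represents_cst x : represents _ (sl_val (emb x)))
  (represents_cst y : represents _ (sl_val (emb y)))).
by apply: tends_cst; exact: nrm_seminorm.
Qed.

Lemma emb_lin (k : R[i]) x y : emb (k *: x + y) = k *: emb x + emb y.
Proof. by apply: compl_ext => z; rewrite /= ipDr ipZr. Qed.

Lemma embB x y : emb (x - y) = emb x - emb y.
Proof. by apply: compl_ext => z; rewrite /= ipBr. Qed.

Lemma hn_cip phi : @hn R B compl_pre phi = Num.sqrt (nrm (cip phi phi)).
Proof. by []. Qed.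

Lemma hn_emb x : @hn R B compl_pre (emb x) = hN x.
Proof. by rewrite hn_cip cip_emb. Qed.

Lemma represents_tends u phi : represents u (sl_val phi) ->
  tends (@hn R B compl_pre) (fun n => emb (u n)) phi.
Proof.
move=> [hu hphi] e e0; have e2 : 0 < e / 2 by lra.
have [M hM] := hu _ e2; exists M => k hk.
apply: (@le_lt_trans _ _ (e / 2)); last lra.
apply: hn_le; first exact: ltW.
have hr : represents (fun n => u (n + M)%N) (sl_val phi).
  split; last by move=> x; apply: (tends_tail M (hphi x)).
  move=> d /hu[K hK]; exists K => i j hi hj.
  by apply: hK; rewrite (leq_trans _ (leq_addr _ _)).
have hd : represents (fun n => u k - u (n + M)%N) (sl_val (emb (u k) - phi)).
  have := represents_lin (-1) hr (represents_cst (u k)).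
  rewrite (_ : (fun n => _) = (fun n => u k - u (n + M)%N)); last first.
    by apply/funext => n; rewrite scaleN1r addrC.
  by congr represents; apply/funext => x; rewrite /= addrC scaleN1r.
apply: (tends_norm_le (nrm_seminorm B) (cip_lim hd hd)) => n.
rewrite -hn_sqr ler_sqr ?nnegrE ?hn_ge0 ?ltW //.
by apply: hM => //; rewrite leq_addl.
Qed.

Lemma compl_complete (u : nat -> compl_pre) : fundamental (@hn R B compl_pre) u ->
  exists l, tends (@hn R B compl_pre) u l.
Proof.
move=> hu; have sn := hn_seminorm compl_pre.
have /choice[w hw] : forall n, exists x, hn (u n - emb x) < n.+1%:R^-1.
  move=> n; have [|M hM] := represents_tends (repsP (u n)) (_ : 0 < n.+1%:R^-1).
    by rewrite invr_gt0 ltr0n.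
  by exists (reps (u n) M); rewrite (seminorm_dist sn); exact: hM.
have fw : fundamental hN w.
  move=> e e0; have e3 : 0 < e / 3 by lra.
  have [M hM] := hu _ e3; have [K hK] := inv_lt_eventually e3.
  exists (maxn M K) => i j; rewrite !geq_max => /andP[i1 i2] /andP[j1 j2].
  rewrite -hn_emb embB.
  have h3 := lt_trans (hw i) (hK _ i2); have h4 := lt_trans (hw j) (hK _ j2).
  have -> : e = e / 3 + (e / 3 + e / 3) by field.
  apply: (le_lt_trans (seminorm_triangle sn (u i) (emb (w i)) (emb (w j)))).
  apply: ltrD; first by rewrite (seminorm_dist sn).
  apply: (le_lt_trans (seminorm_triangle sn (u j) (u i) (emb (w j)))).
  by apply: ltrD => //; exact: hM.
have hx x : fundamental nB (fun n => ip x (w n)).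
  by apply: fundamental_ip => //; have [] := represents_cst x.
have /choice[l hl] := fun x => complete_tends (hx x).
have pl : compl_submod l by exists w.
have hrl : represents w (sl_val (mksubl pl : compl)) by split.
exists (mksubl pl) => e e0; have e2 : 0 < e / 2 by lra.
have [M hM] := represents_tends hrl e2; have [K hK] := inv_lt_eventually e2.
exists (maxn M K) => k; rewrite geq_max => /andP[k1 k2].
apply: (le_lt_trans (seminorm_triangle sn (emb (w k)) (u k) (mksubl pl : compl))).
rewrite (splitr e); apply: ltrD; last exact: hM.
exact: lt_trans (hw k) (hK _ k2).
Qed.

Definition complmod : hmod B := HMod compl_complete.

Lemma cip_emb_l x phi : cip (emb x) phi = sl_val phi x.
Proof.
have [_ hx] := repsP phi.
exact: (cip_uniq (represents_cst x : represents _ (sl_val (emb x))) (repsP phi) (hx x)).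
Qed.

Section Extension.
Variables (T T' : N -> N) (C : R).
Hypotheses (adjT : forall x y, ip (T x) y = ip x (T' y)) (C0 : 0 <= C)
  (bT : forall x, hN (T x) <= C * hN x).

Let adjT' x y : ip (T' x) y = ip x (T y).
Proof. by rewrite -[LHS]pm_star -adjT pm_star. Qed.

Lemma represents_ext u (phi : fnB) : represents u phi ->
  represents (fun n => T (u n)) (phi \o T').
Proof.
move=> [hu hphi]; split; last first.
  by move=> x; apply: (tends_ext _ (hphi (T' x))) => n; rewrite adjT'.
have TB x y : T x - T y = T (x - y).
  by apply: ip_ext => z; rewrite ipBr -!adjT' ipBr.
have C1 : 0 < C + 1 by rewrite ltr_wpDl.
move=> e e0; have [|M hM] := hu (e / (C + 1)); first by rewrite divr_gt0.
exists M => j k hj hk; rewrite TB; apply: (le_lt_trans (bT _)).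
apply: (@le_lt_trans _ _ ((C + 1) * hN (u j - u k))).
  by apply: ler_wpM2r; [exact: hn_ge0|rewrite lerDl].
by rewrite mulrC -ltr_pdivlMr //; exact: hM.
Qed.

Lemma ext_proof phi : compl_submod (sl_val phi \o T').
Proof. by exists (fun n => T (reps phi n)); apply: represents_ext; exact: repsP. Qed.

(** Since [<x, T u> = <T' x, u>], the extension of [T] acts on functionals by precomposition with
    the adjoint. *)
Definition ext (phi : complmod) : complmod := mksubl (ext_proof phi).

Lemma ext_bound phi : @hn R B complmod (ext phi) <= C * @hn R B complmod phi.
Proof.
apply: hn_le; first by rewrite mulr_ge0 ?hn_ge0.
have hr := represents_ext (repsP phi).
have sB := nrm_seminorm B.
rewrite exprMn hn_sqr; apply/ler_addgt0Pl => e e0.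
have e1 : 0 < e / 2 by rewrite divr_gt0.
have C1 : 0 < C ^+ 2 + 1 by rewrite ltr_wpDl // sqr_ge0.
have e2 : 0 < e / 2 / (C ^+ 2 + 1) by rewrite !divr_gt0.
have [M hM] := @cip_lim _ _ (ext phi) (ext phi) hr hr _ e1.
have [K hK] := cip_reps phi phi e2.
have := hM _ (leq_maxl M K); have := hK _ (leq_maxr M K).
set m := maxn M K; set x := reps phi m => h1 h2.
have h3 := seminorm_triangle sB (ip (T x) (T x)) (cip (ext phi) (ext phi)) 0.
have h4 := seminorm_triangle sB (cip phi phi) (ip x x) 0.
rewrite !subr0 in h3 h4; rewrite (seminorm_dist sB (cip (ext phi) _)) in h3.
have h5 : nB (ip (T x) (T x)) <= C ^+ 2 * nB (ip x x).
  by rewrite -!hn_sqr -exprMn ler_sqr ?nnegrE ?mulr_ge0 ?hn_ge0.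
have h6 : C ^+ 2 * nB (ip x x) <= C ^+ 2 * (e / 2 / (C ^+ 2 + 1) + nB (cip phi phi)).
  apply: ler_wpM2l; first exact: sqr_ge0.
  by apply: le_trans h4 _; rewrite lerD2r ltW.
have h7 : C ^+ 2 * (e / 2 / (C ^+ 2 + 1)) <= e / 2.
  rewrite mulrA ler_pdivrMr //.
  by rewrite mulrC ler_pM2l // lerDl.
apply: (le_trans h3); rewrite [in leRHS](splitr e) -addrA.
apply: lerD; first exact: ltW.
apply: le_trans h5 _; apply: le_trans h6 _; rewrite mulrDr.
by apply: lerD.
Qed.

End Extension.

Lemma ext_adj (T T' : N -> N) (C C' : R)
    (adjT : forall x y, ip (T x) y = ip x (T' y)) (C0 : 0 <= C)
    (bT : forall x, hN (T x) <= C * hN x)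
    (adjT' : forall x y, ip (T' x) y = ip x (T y)) (C0' : 0 <= C')
    (bT' : forall x, hN (T' x) <= C' * hN x) (phi psi : complmod) :
  cip (ext adjT C0 bT phi) psi = cip phi (ext adjT' C0' bT' psi).
Proof.
apply: (cip_uniq (represents_ext adjT C0 bT (repsP phi) : represents _ (sl_val (ext adjT C0 bT phi)))
  (repsP psi)).
have := cip_lim (repsP phi) (represents_ext adjT' C0' bT' (repsP psi)
   : represents _ (sl_val (ext adjT' C0' bT' psi))).
by apply: tends_ext => n; rewrite adjT.
Qed.

End Completion.

(* Stinespring-Kasparov dilation; the module is the completion of the space of
   functions spanned by [s |-> ker s t ** b]. *)
Section KernelModule.
Variables (R : realType) (O B : unitalCstarAlgType R) (J : Type).
Variable K : O -> J -> J -> B.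
Hypothesis K_linear : forall (k : R[i]) x y i j,
  K (k *: x + y) i j = k *: K x i j + K y i j.
Hypothesis K_star : forall x i j, cstar (K x i j) = K (cstar x) j i.
Hypothesis K_pos : forall l : seq (O * J * B),
  pos (\sum_(p <- l) \sum_(q <- l)
    cstar p.2 ** K (cstar p.1.1 ** q.1.1) p.1.2 q.1.2 ** q.2).

Local Notation S := (O * J)%type.
Implicit Types (s t : S) (l m : seq (S * B)) (a b : O).

Definition ker s t : B := K (cstar s.1 ** t.1) s.2 t.2.

Lemma ker_star s t : cstar (ker s t) = ker t s.
Proof. by rewrite /ker K_star cstarM cstarK. Qed.

Let fnS : lmodType R[i] := (S -> B : Type).

Definition ev l : fnS := fun s => \sum_(p <- l) ker s p.1 ** p.2.

Lemma ev_cat l m s : ev (l ++ m) s = ev l s + ev m s.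
Proof. exact: big_cat. Qed.

Definition scale_list (k : R[i]) l := [seq (p.1, k *: p.2) | p <- l].

Lemma ev_scale k l s : ev (scale_list k l) s = k *: ev l s.
Proof.
rewrite /ev big_map scaler_sumr; apply: eq_bigr => p _ /=.
by rewrite cmulZr.
Qed.

Lemma ker_mod0 : exists l, (0 : fnS) = ev l.
Proof. by exists [::]; apply/funext => s; rewrite /ev big_nil. Qed.

Lemma ker_mod_lin (k : R[i]) (x y : fnS) : (exists l, x = ev l) ->
  (exists l, y = ev l) -> exists l, k *: x + y = ev l.
Proof.
move=> [l ->] [m ->]; exists (scale_list k l ++ m).
by apply/funext => s; rewrite ev_cat ev_scale.
Qed.

Definition ker_submod : submod fnS := Submod ker_mod0 ker_mod_lin.
Definition kermod : lmodType R[i] := subl ker_submod.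
Implicit Types (x y z : kermod).

Definition klist x : seq (S * B) := projT1 (cid (subl_prop x)).

Lemma klistE x : sl_val x = ev (klist x).
Proof. by rewrite /klist; case: cid. Qed.

(** Only [x] is expanded along a chosen list, while [y] is evaluated as a function; [kip_ev2] moves
    the expansion to the other side, whence independence of the list. *)
Definition kip x y : B := \sum_(p <- klist x) cstar p.2 ** sl_val y p.1.

Lemma kip_ev2 l m : \sum_(p <- l) cstar p.2 ** ev m p.1 =
  \sum_(q <- m) cstar (ev l q.1) ** q.2.
Proof.
rewrite /ev; under eq_bigr do rewrite cmul_sumr.
rewrite exchange_big; apply: eq_bigr => q _ /=.
rewrite cstar_sum cmul_suml; apply: eq_bigr => p _.
by rewrite cstarM ker_star cmulA.
Qed.

Lemma kip_list x y l : sl_val x = ev l -> kip x y = \sum_(p <- l) cstar p.2 ** sl_val y p.1.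
Proof.
by move=> h; rewrite /kip (klistE y) !kip_ev2 -klistE h.
Qed.

Lemma kip_linear x : linear (kip x).
Proof.
move=> k y z; rewrite /kip scaler_sumr -big_split; apply: eq_bigr => p _ /=.
by rewrite cmulDr cmulZr.
Qed.

Lemma kip_star x y : cstar (kip x y) = kip y x.
Proof.
rewrite /kip (klistE y) kip_ev2 -klistE cstar_sum; apply: eq_bigr => p _.
by rewrite cstarM cstarK.
Qed.

Lemma kact_proof x (b : B) : ker_submod (fun s => sl_val x s ** b).
Proof.
exists [seq (p.1, p.2 ** b) | p <- klist x]; apply/funext => s.
rewrite klistE /ev big_map cmul_suml; apply: eq_bigr => p _ /=.
by rewrite cmulA.
Qed.

Definition kact x (b : B) : kermod := mksubl (kact_proof x b).

Lemma kip_act x y (b : B) : kip x (kact y b) = kip x y ** b.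
Proof. by rewrite /kip cmul_suml; apply: eq_bigr => p _; rewrite cmulA. Qed.

Lemma kip_pos x : pos (kip x x).
Proof.
rewrite /kip klistE; have := K_pos (klist x); congr pos.
apply: eq_bigr => p _; rewrite /ev cmul_sumr; apply: eq_bigr => q _.
by rewrite /ker cmulA.
Qed.

Lemma kv_proof s : ker_submod (fun t => ker t s).
Proof.
by exists [:: (s, cone)]; apply/funext => t; rewrite /ev big_seq1 cmulx1.
Qed.

Definition kv s : kermod := mksubl (kv_proof s).

Lemma kip_kv s x : kip (kv s) x = sl_val x s.
Proof.
rewrite (@kip_list _ _ [:: (s, cone)]) ?big_seq1 ?cstar1 ?cmul1x //.
by apply/funext => t; rewrite /ev big_seq1 cmulx1.
Qed.

(** The reproducing property [x s = <kv s, x>] and Cauchy-Schwarz make every value of [x] vanish.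
    Working with functions thus replaces the quotient by the null space. *)
Lemma kip_def x : kip x x = 0 -> x = 0.
Proof.
move=> x0; apply: subl_inj; apply/funext => s; rewrite /=.
set b := sl_val x s; have hb : b = kip (kv s) x by rewrite kip_kv.
have hb' : cstar b = kip x (kv s) by rewrite hb kip_star.
have D y z w : kip y (z + w) = kip y z + kip y w.
  by have := kip_linear y 1 z w; rewrite !scale1r.
have Z k y z : kip y (k *: z) = k *: kip y z.
  have y0 : kip y 0 = 0 by apply: (addrI (kip y 0)); rewrite -D !addr0.
  by have := kip_linear y k z 0; rewrite y0 !addr0.
have Dl y z w : kip (y + z) w = kip y w + kip z w.
  by rewrite -kip_star D cstarD !kip_star.
have Zl k y z : kip (k *: y) z = Num.conj k *: kip y z.
  by rewrite -kip_star Z cstarZ kip_star.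
have Al y z c : kip (kact y c) z = cstar c ** kip y z.
  by rewrite -kip_star kip_act cstarM kip_star.
suff : nrm b ^+ 2 <= nrm (kip (kv s) (kv s)) * nrm (kip x x).
  by rewrite x0 nrm0 mulr0 => h; apply: nrm0_eq0; apply/eqP; rewrite -sqrf_eq0 eq_le h sqr_ge0.
apply: pos_cauchy_schwarz; [exact: kip_pos|exact: kip_pos|].
move=> T T0; have := kip_pos (T%:C *: x + (- 1) *: kact (kv s) b).
rewrite Dl !D !Zl !Z conj_realC !kip_act !Al -hb -hb'.
have -> : Num.conj (- 1 : R[i]) = - 1 by rewrite rmorphN1.
set u := kip x x; set v := kip (kv s) (kv s).
congr pos; nc_ring_in R B; ring.
Qed.

Definition ker_pre : premod B := PreMod kip_linear kip_star kip_act kip_pos kip_def.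

Definition left s a : S := (a ** s.1, s.2).

Lemma ker_left a s t : ker (left s (cstar a)) t = ker s (left t a).
Proof. by rewrite /ker /left /= cstarM cstarK cmulA. Qed.

Lemma krep_proof a x : ker_submod (fun s => sl_val x (left s (cstar a))).
Proof.
exists [seq (left p.1 a, p.2) | p <- klist x]; apply/funext => s.
rewrite klistE /ev big_map; apply: eq_bigr => p _ /=.
by rewrite ker_left.
Qed.

(** On kernel vectors this is [kv s |-> kv (left s a)]; on functions it is precomposition with the
    action of [a^*]. *)
Definition krep a (x : ker_pre) : ker_pre := mksubl (krep_proof a x).

Lemma krep_list a x : sl_val (krep a x) = ev [seq (left p.1 a, p.2) | p <- klist x].
Proof.
apply/funext => s; rewrite /= klistE /ev big_map; apply: eq_bigr => p _ /=.
by rewrite ker_left.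
Qed.

Lemma krep_adj a (x y : ker_pre) : pm_ip (krep a x) y = pm_ip x (krep (cstar a) y).
Proof.
rewrite /= (kip_list y (krep_list a x)) big_map /kip; apply: eq_bigr => p _ /=.
by rewrite cstarK.
Qed.

Lemma krep_mul a b x : krep (a ** b) x = krep a (krep b x).
Proof.
by apply: subl_inj; apply/funext => s; rewrite /= cstarM /left /= cmulA.
Qed.

Lemma kfun_conj x (k : R[i]) (u v : O) j :
  sl_val x (k *: u + v, j) = Num.conj k *: sl_val x (u, j) + sl_val x (v, j).
Proof.
rewrite klistE /ev scaler_sumr -big_split; apply: eq_bigr => p _ /=.
rewrite /ker /= cstarD cstarZ cmulDl cmulZl K_linear cmulDl cmulZl.
by [].
Qed.

Lemma krep_lin (k : R[i]) a b x : krep (k *: a + b) x = k *: krep a x + krep b x.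
Proof.
apply: subl_inj; apply/funext => s.
rewrite /= /left cstarD cstarZ cmulDl cmulZl kfun_conj.
by rewrite conjCK.
Qed.

Lemma krep1 x : krep cone x = x.
Proof.
by apply: subl_inj; apply/funext => -[u j]; rewrite /= /left cstar1 cmul1x.
Qed.

Lemma krep0 x : krep 0 x = 0.
Proof.
apply: (addrI (krep 0 x)); rewrite addr0.
by rewrite -{1}[krep 0 x]scale1r -krep_lin scaler0 addr0.
Qed.

(** Write [nrm a ^ 2 - a^* a] as [h^2]; the bound is the positivity of the inner product of
    [krep h x] with itself. *)
Lemma krep_bound a (x : ker_pre) : hn (krep a x) <= nrm a * hn x.
Proof.
apply: hn_le; first by rewrite mulr_ge0 ?nrm_ge0 ?hn_ge0.
rewrite exprMn hn_sqr.
have [h sh eh] : pos (rone O (nrm a ^+ 2) - cstar a ** a).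
  by apply: pos_rone_nrm; [exact: sa_xx|rewrite nrm_cstar_cmul].
have e : pm_ip (krep h x) (krep h x) =
    (nrm a ^+ 2)%:C *: pm_ip x x - pm_ip (krep a x) (krep a x).
  rewrite !krep_adj -!krep_mul sh -eh.
  have -> : rone O (nrm a ^+ 2) - cstar a ** a =
      (nrm a ^+ 2)%:C *: cone + ((-1) *: (cstar a ** a) + 0).
    by rewrite addr0 scaleN1r.
  by rewrite !krep_lin krep0 krep1 addr0 scaleN1r ipDr ipZr ipNr.
have := pm_pos (krep h x); rewrite e => /(pos_nrm_mono (pm_pos (krep a x))) h1.
by apply: le_trans h1 _; rewrite nrmZr ger0_norm ?sqr_ge0.
Qed.

Let N := complmod ker_pre.

Definition kext a : N -> N :=
  ext (krep_adj a) (nrm_ge0 a) (krep_bound a).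

Lemma kext_adj a : is_adj (kext a) (kext (cstar a)).
Proof.
have h (x y : ker_pre) : pm_ip (krep (cstar a) x) y = pm_ip x (krep a y).
  by rewrite krep_adj cstarK.
move=> x y; rewrite /= /kext.
rewrite (ext_adj (krep_adj a) (nrm_ge0 a) (krep_bound a) h (nrm_ge0 (cstar a)) (krep_bound (cstar a))).
by congr (cip _ _); apply: compl_ext => z; rewrite /= cstarK.
Qed.

Lemma kext_adjointable a : op_submod N (kext a).
Proof.
split; first by exists (kext (cstar a)); exact: kext_adj.
by exists (nrm a); split; [exact: nrm_ge0|exact: ext_bound].
Qed.

Definition krho a : opC N := mksubl (kext_adjointable a).

Lemma compl_conj (phi : N) (k : R[i]) (x y : ker_pre) :
  sl_val phi (k *: x + y) = Num.conj k *: sl_val phi x + sl_val phi y.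
Proof.
rewrite -!cip_emb_l emb_lin.
transitivity (pm_ip (k *: (emb x : N) + emb y) phi) => //.
by rewrite ipDl ipZl.
Qed.

Lemma krho_hom : star_hom krho.
Proof.
split.
- move=> k a b; apply: opE => phi; apply: compl_ext => x.
  transitivity (sl_val phi (krep (cstar (k *: a + b)) x)) => //.
  rewrite cstarD cstarZ krep_lin compl_conj conjCK.
  by [].
- move=> a b; apply: opE => phi; apply: compl_ext => x.
  transitivity (sl_val phi (krep (cstar (a ** b)) x)) => //.
  by rewrite cstarM krep_mul.
move=> a; apply: opE => x; apply: ip_ext => z; rewrite -opC_star'.
exact: (esym (kext_adj a z x)).
Qed.

Lemma krho1 : krho cone = cone.
Proof.
apply: opE => phi; apply: compl_ext => x.
transitivity (sl_val phi (krep (cstar cone) x)) => //.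
by rewrite cstar1 krep1.
Qed.

Lemma krho_vec a i j :
  pm_ip (emb (kv (cone, i) : ker_pre) : N) (opf (krho a) (emb (kv (cone, j) : ker_pre))) = K a i j.
Proof.
rewrite [LHS]cip_emb_l.
transitivity (pm_ip (krep (cstar a) (kv (cone, i))) (kv (cone, j) : ker_pre)) => //.
rewrite (krep_adj (cstar a)) cstarK [LHS]kip_kv.
transitivity (ker (left (cone, i) (cstar a)) (cone, j)) => //.
by rewrite ker_left /ker /left /= cstar1 cmul1x cmulx1.
Qed.

End KernelModule.

(** With a single index this dilates a completely positive map [O -> B]; with several, one
    representation dilates a whole matrix of maps, with one vector for each index. *)
Theorem kernel_dilation (R : realType) (O B : unitalCstarAlgType R) (J : Type)
    (K : O -> J -> J -> B) :
  (forall (k : R[i]) x y i j, K (k *: x + y) i j = k *: K x i j + K y i j) ->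
  (forall x i j, cstar (K x i j) = K (cstar x) j i) ->
  (forall l : seq (O * J * B), pos (\sum_(p <- l) \sum_(q <- l)
    cstar p.2 ** K (cstar p.1.1 ** q.1.1) p.1.2 q.1.2 ** q.2)) ->
  exists (N : hmod B) (rho : O -> opC N) (vec : J -> N),
    [/\ star_hom rho, rho cone = cone &
      forall a i j, pm_ip (vec i) (opf (rho a) (vec j)) = K a i j].
Proof.
move=> K_linear K_star K_pos.
exists (complmod (ker_pre K_star K_pos)), (krho K_linear K_star K_pos).
exists (fun j => emb (kv K (cone, j) : ker_pre K_star K_pos)).
split; [exact: krho_hom|exact: krho1|].
exact: krho_vec.
Qed.

(** * Completely positive maps *)

Section CompletelyPositive.
Variables (R : realType) (A B : unitalCstarAlgType R).

Lemma gram_mx_pos n (a : 'I_n -> A) : mx_pos (\matrix_(i, j) (cstar (a i) ** a j)).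
Proof.
case: n a => [|n] a.
  by exists (\matrix_(k, j) 0) => -[].
exists (\matrix_(k, j) if k == ord0 then a j else 0) => i j.
rewrite mxE big_ord_recl /= !mxE eqxx big1 ?addr0 // => k _.
by rewrite !mxE /= cmulx0.
Qed.

Variable f : A -> B.
Hypothesis f_cp : cp_on setT f.

Lemma cp_linear : linear f.
Proof. by move=> k x y; case: f_cp => h _; exact: h. Qed.

Lemma cpD x y : f (x + y) = f x + f y.
Proof. by have := cp_linear 1 x y; rewrite !scale1r. Qed.

Lemma cp0 : f 0 = 0.
Proof. by apply: (addrI (f 0)); rewrite -cpD !addr0. Qed.

Lemma cpZ k x : f (k *: x) = k *: f x.
Proof. by have := cp_linear k x 0; rewrite cp0 !addr0. Qed.

Lemma cpN x : f (- x) = - f x.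
Proof. by rewrite -scaleN1r cpZ scaleN1r. Qed.

Lemma cp_form_ord n (a : 'I_n -> A) (d : 'I_n -> B) :
  pos (\sum_i \sum_j cstar (d i) ** f (cstar (a i) ** a j) ** d j).
Proof.
have [_ h] := f_cp; have := h _ _ (fun _ _ => Logic.I) (gram_mx_pos a).
move=> /(mx_pos_form d); congr pos; apply: eq_bigr => i _; apply: eq_bigr => j _.
by rewrite !mxE.
Qed.

Lemma cp_form (l : seq (A * B)) :
  pos (\sum_(p <- l) \sum_(q <- l) cstar p.2 ** f (cstar p.1 ** q.1) ** q.2).
Proof.
have := cp_form_ord (fun i : 'I_(size l) => (tnth (in_tuple l) i).1)
  (fun i => (tnth (in_tuple l) i).2).
congr pos; rewrite [RHS](big_tnth _ _ l); apply: eq_bigr => i _.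
by rewrite [RHS](big_tnth _ _ l).
Qed.

Lemma cp_pos a : pos a -> pos (f a).
Proof.
move=> /posP[x ->]; have := cp_form [:: (x, cone)].
by rewrite !big_seq1 /= cstar1 cmul1x cmulx1.
Qed.

Lemma cp_sa a : sa a -> sa (f a).
Proof.
move=> /sa_jordan[p [n [pp pn -> _ _]]]; rewrite cpD cpN.
by apply: saD; [|apply: saN]; apply: pos_sa; exact: cp_pos.
Qed.

Lemma cp_star x : f (cstar x) = cstar (f x).
Proof.
pose u := 2^-1 *: (x + cstar x); pose v := 2^-1 *: ('i *: (cstar x - x)).
have su : sa u by rewrite /sa cstar_half cstarD cstarK addrC.
have sv : sa v.
  by rewrite /sa cstar_half cstarZ conjCi cstarB cstarK scaleNr -scalerN opprB.
have i2 : ('i : R[i]) * 'i = -1 by rewrite -expr2 sqrCi.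
have ex : x = u + 'i *: v.
  have -> : 'i *: v = (2^-1 : R[i]) *: (('i * 'i) *: (cstar x - x)).
    by rewrite /v !scalerA; congr (_ *: _); ring.
  by rewrite i2 /u; nc_ring_in R A; field.
clearbody u v; rewrite ex cstarD cstarZ su sv conjCi.
by rewrite !cpD !cpZ cstarD cstarZ conjCi (cp_sa su) (cp_sa sv).
Qed.

End CompletelyPositive.

Section RankOne.
Variables (R : realType) (B : unitalCstarAlgType R) (N : hmod B).
Implicit Types (x y z w : N) (b c : B) (T : opC N).
Local Notation ip := (@pm_ip R B N).
Local Notation act := (@pm_act R B N).

Lemma act0 x : act x 0 = 0.
Proof. by apply: ip_ext => z; rewrite pm_ipM cmulx0 ip0r. Qed.

Lemma act1 x : act x cone = x.
Proof. by apply: ip_ext => z; rewrite pm_ipM cmulx1. Qed.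

Lemma act_lin x (k : R[i]) b c : act x (k *: b + c) = k *: act x b + act x c.
Proof. by apply: ip_ext => z; rewrite ipDr ipZr !pm_ipM cmulDr cmulZr. Qed.

Lemma opf_act T x b : opf T (act x b) = act (opf T x) b.
Proof. by apply: ip_ext => z; rewrite pm_ipM -!adjP' pm_ipM. Qed.

Lemma rank1_proof x y : op_submod N (fun z => act x (ip y z)).
Proof.
split.
  by exists (fun z => act y (ip x z)) => z w; rewrite ipMl pm_ipM pm_star.
exists (hn y * hn x); split; first by rewrite mulr_ge0 ?hn_ge0.
move=> z; apply: le_trans (hn_act _ _) _; rewrite mulrAC.
by apply: ler_wpM2r; [exact: hn_ge0|exact: cauchy_schwarz].
Qed.

Definition rank1 x y : opC N := mksubl (rank1_proof x y).

Lemma rank1_star x y : cstar (rank1 x y) = rank1 y x.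
Proof.
apply: opE => z; apply: ip_ext => w; rewrite -opC_star' /=.
by rewrite ipMl pm_ipM pm_star.
Qed.

Lemma rank1_mull T x y : T ** rank1 x y = rank1 (opf T x) y.
Proof. by apply: opE => z; rewrite opC_cmul /= opf_act. Qed.

Lemma rank1M x y z w : rank1 x y ** rank1 z w = rank1 (act x (ip y z)) w.
Proof. by rewrite rank1_mull. Qed.

Lemma rank10 y : rank1 0 y = 0.
Proof.
by apply: opE => z; apply: ip_ext => w; rewrite /= pm_ipM !ip0r cmul0x.
Qed.

Lemma rank1_lin (k : R[i]) x y z : rank1 (k *: x + y) z = k *: rank1 x z + rank1 y z.
Proof.
apply: opE => w; apply: ip_ext => v.
by rewrite op_linE ipDr ipZr /= !pm_ipM ipDr ipZr cmulDl cmulZl.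
Qed.

End RankOne.

(** Since [v^2 = 0], the initial and final projections of [v] are orthogonal; [u] exchanges them
    through [v] and [v^*] and is the identity on the complement. *)
Lemma partial_isometry_unitary (R : realType) (A : unitalCstarAlgType R) (v : A) :
  v ** v = 0 -> v ** (cstar v ** v) = v ->
  exists u, [/\ cstar u = u, u ** u = cone & (cstar v ** v) ** u = cstar v].
Proof.
move=> vv vwv; set w := cstar v.
have r1 : v ** v = 0 by [].
have r2 : w ** w = 0 by rewrite -cstarM vv cstar0.
have r3 : v ** w ** v - v = 0 by rewrite -cmulA vwv subrr.
have r4 : w ** v ** w - w = 0.
  have := congr1 cstar vwv; rewrite !cstarM cstarK -/w => e.
  by rewrite e subrr.
exists (v + w + cone - v ** w - w ** v); split.
- by rewrite !(cstarB, cstarD) !cstarM cstar1 cstarK -/w [w + v]addrC.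
- have -> : (v + w + cone - v ** w - w ** v) ** (v + w + cone - v ** w - w ** v) =
    cone + v ** v - (v ** v) ** w + w ** w - (w ** w) ** v
    - (2 : R[i]) *: (v ** w ** v - v) - (2 : R[i]) *: (w ** v ** w - w)
    + (v ** w ** v - v) ** w + (w ** v ** w - w) ** v
    + v ** (w ** w) ** v - v ** (w ** w) - w ** (v ** v) + w ** (v ** v) ** w.
    by nc_ring_in R A.
  by rewrite r1 r2 r3 r4 !(cmul0x, cmulx0, scaler0, subr0, addr0).
have -> : w ** v ** (v + w + cone - v ** w - w ** v) =
   w + w ** (v ** v) + (w ** v ** w - w) - w ** (v ** v) ** w
   - (w ** v ** w - w) ** v by nc_ring_in R A.
by rewrite r1 r4 !(cmul0x, cmulx0, scaler0, subr0, addr0).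
Qed.

Section TensorMap.
Variables (R : realType) (P : unitalCstarAlgType R) (tb : trace_basis P).
Local Notation e := (@tb_e R P tb).
Local Notation tr := (@tb_tr R P tb).

(** The map [id (x) g]. *)
Definition tmap (B C : unitalCstarAlgType R) (g : B -> C) (z : tensC tb B) :
  tensC tb C := fun i => g (z i).

Lemma tmap_tens (B C : unitalCstarAlgType R) (g : B -> C) p b :
  (forall (k : R[i]) x, g (k *: x) = k *: g x) ->
  tmap g (@tens R P tb _ p b) = @tens R P tb _ p (g b) :> tensC tb C.
Proof. by move=> gZ; apply/funext => i; rewrite /tmap /tens gZ. Qed.

Lemma tmap_sum (B C : unitalCstarAlgType R) (g : B -> C) (I : finType)
    (F : I -> tensC tb B) : linear g ->
  tmap g (\sum_i F i) = \sum_i tmap g (F i).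
Proof.
move=> gl; have gD x y : g (x + y) = g x + g y by have := gl 1 x y; rewrite !scale1r.
have g0 : g 0 = 0 by apply: (addrI (g 0)); rewrite -gD !addr0.
apply: (big_morph (tmap g)) => [x y|]; apply/funext => i; first exact: gD.
exact: g0.
Qed.

Variable B : unitalCstarAlgType R.
Local Notation T := (tensC tb B).
Local Notation tn := (@tens R P tb B : P -> B -> T).

(** The map [tr (x) id]. *)
Definition etr (z : T) : B := \sum_l tr (e l) *: z l.

Lemma lam_pos (z : T) : pos z -> pos (lam z).
Proof.
move=> [h sh ->]; exists (lam h); last exact: tensC_lamM.
by rewrite /sa -tensC_lamS sh.
Qed.

(** [etr z] is the value of the form of [lam z] at the vector [1 (x) 1]. *)
Lemma etr_pos z : pos z -> pos (etr z).
Proof.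
move=> /lam_pos /form_pos /(_ (@tens R P tb _ cone cone)); rewrite lam_one.
congr pos; rewrite /= /col_ip /etr; apply: eq_bigr => l _.
rewrite /tens cstarZ cstar1 cmulZl cmul1x -tb_star cmulx1 cstarK.
by [].
Qed.

Lemma etr_lin (k : R[i]) z w : etr (k *: z + w) = k *: etr z + etr w.
Proof.
rewrite /etr scaler_sumr -big_split; apply: eq_bigr => l _ /=.
transitivity (tr (e l) *: (k *: z l + w l)) => //.
by rewrite scalerDr !scalerA mulrC.
Qed.

Lemma etr_sum (I : Type) (r : seq I) (F : I -> T) :
  etr (\sum_(i <- r) F i) = \sum_(i <- r) etr (F i).
Proof.
apply: (big_morph etr) => [x y|].
  by have := etr_lin 1 x y; rewrite !scale1r.
by rewrite /etr big1 // => l _; rewrite scaler0.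
Qed.

Lemma etr_tens p b : etr (tn p b) = tr p *: b.
Proof.
rewrite /etr /tens; under eq_bigr do rewrite scalerA -[e _]cmul1x.
rewrite -scaler_suml; congr (_ *: _).
rewrite -[p in RHS]cmul1x -(tr_contract tb cone p).
by apply: eq_bigr => l _; rewrite !cmul1x.
Qed.

Lemma tens_sandwich p q b c (z : T) :
  tn p b ** z ** tn q c = \sum_l tn (p ** e l ** q) (b ** z l ** c).
Proof.
rewrite {1}(tensE z) cmul_sumr cmul_suml; apply: eq_bigr => l _.
by rewrite !tensM.
Qed.

Lemma etr_sandwich p q b c (z : T) :
  etr (tn p b ** z ** tn q c) = b ** (\sum_l tr (p ** e l ** q) *: z l) ** c.
Proof.
rewrite tens_sandwich etr_sum cmul_sumr cmul_suml; apply: eq_bigr => l _.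
by rewrite etr_tens cmulZr cmulZl.
Qed.

(** An element is recovered from the [B]-valued blocks [etr ((e_i (x) 1) z (e_j^* (x) 1))]: summing
    over [j] expands [e_i e_l] in the basis, and [tb_sum] removes the [e_i]. *)
Lemma trace_reconstruct (z : T) :
  \sum_i \sum_j tn (cstar (e i) ** e j) (\sum_l tr (e i ** e l ** cstar (e j)) *: z l) = z.
Proof.
rewrite [RHS]tensE.
have tnZ p k b : tn p (k *: b) = tn (k *: p) b.
  apply: lam_inj; rewrite !lam_tens.
  by rewrite ltenZr ltenZl.
have tn_sumr p (I : finType) (F : I -> B) : tn p (\sum_i F i) = \sum_i tn p (F i).
  apply: lam_inj; rewrite lam_sum lam_tens.
  under [RHS]eq_bigr do rewrite lam_tens.
  by apply: (big_morph (@lten R P tb _ p)) => [x y|]; [exact: ltenDr|exact: lten0r].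
have tn_suml b (I : finType) (F : I -> P) : tn (\sum_i F i) b = \sum_i tn (F i) b.
  apply: lam_inj; rewrite lam_sum lam_tens.
  under [RHS]eq_bigr do rewrite lam_tens.
  by apply: (big_morph (fun p => @lten R P tb _ p b)) => [x y|]; [exact: ltenDl|exact: lten0l].
under eq_bigr => i _ do under eq_bigr => j _ do rewrite tn_sumr.
under eq_bigr => i _ do rewrite exchange_big.
rewrite exchange_big; apply: eq_bigr => l _ /=.
under eq_bigr => i _ do under eq_bigr => j _ do rewrite tnZ.
under eq_bigr => i _ do rewrite -tn_suml.
rewrite -tn_suml; congr (@tens R P tb _ _ _).
transitivity (\sum_i cstar (e i) ** (e i ** e l)).
  apply: eq_bigr => i _; rewrite [in RHS](tb_expand tb (e i ** e l)) cmul_sumr.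
  by apply: eq_bigr => j _; rewrite cmulZr tb_comm.
by under eq_bigr do rewrite cmulA; rewrite -cmul_suml tb_sum cmul1x.
Qed.

End TensorMap.

Section StateGram.
Local Open Scope sesquilinear_scope.
Variables (R : realType) (O D : unitalCstarAlgType R) (w : state O).

Lemma state0 : w 0 = 0.
Proof.
have := st_linear w 1 0 0; rewrite scaler0 addr0 mul1r => h.
by apply: (addrI (w 0)); rewrite -h addr0.
Qed.

Lemma stateZ k x : w (k *: x) = k * w x.
Proof. by rewrite -[k *: x]addr0 st_linear state0 addr0. Qed.

Lemma stateD x y : w (x + y) = w x + w y.
Proof. by have := st_linear w 1 x y; rewrite scale1r mul1r. Qed.

Lemma state_sum (I : finType) (F : I -> O) : w (\sum_i F i) = \sum_i w (F i).
Proof. by apply: (big_morph w) => [u v|]; rewrite ?stateD ?state0. Qed.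

(** Complete positivity of [a |-> w a *: 1]. Diagonalizing the scalar Gram matrix turns the form
    into a nonnegative combination of elements [y^* y]. *)
Lemma state_gram n (a : 'I_n -> O) (x : 'I_n -> D) :
  pos (\sum_i \sum_j w (cstar (a i) ** a j) *: (cstar (x i) ** x j)).
Proof.
pose G : 'M[R[i]]_n := \matrix_(i, j) w (cstar (a i) ** a j).
have hG : G \is hermsymmx.
  apply/is_hermitianmxP; rewrite expr0 scale1r; apply/matrixP => i j.
  by rewrite !mxE -[in RHS]st_star cstarM cstarK.
have /orthomx_spectralP := hermitian_normalmx hG.
set Q := spectralmx G; set d := spectral_diag G.
have uQ : Q \is unitarymx by exact: spectral_unitarymx.
rewrite invmx_unitary // => eG.
have QV : Q *m Q ^t* = 1%:M by apply/unitarymxP.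
have hd k : 0 <= d 0 k.
  (* The eigenvalue [d 0 k] is the value of the state at [z^* z]. *)
  pose z := \sum_j Num.conj (Q k j) *: a j.
  suff -> : d 0 k = w (cstar z ** z) by exact: st_pos.
  have ed : diag_mx d = Q *m G *m Q ^t*.
    by rewrite eG !mulmxA QV mul1mx -mulmxA QV mulmx1.
  have := congr1 (fun M : 'M[R[i]]_n => M k k) ed; rewrite !mxE eqxx mulr1n => ->.
  rewrite /z cmul_sumr state_sum; apply: eq_bigr => j _.
  rewrite cmulZr stateZ cstar_sum cmul_suml state_sum !mxE mulrC; congr (_ * _).
  by apply: eq_bigr => i _; rewrite mxE cstarZ conjCK cmulZl stateZ.
have -> : \sum_i \sum_j w (cstar (a i) ** a j) *: (cstar (x i) ** x j) =
    \sum_k d 0 k *: (cstar (\sum_i Q k i *: x i) ** (\sum_j Q k j *: x j)).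
  transitivity (\sum_i \sum_j \sum_k (Num.conj (Q k i) * d 0 k * Q k j) *: (cstar (x i) ** x j)).
    apply: eq_bigr => i _; apply: eq_bigr => j _; rewrite -scaler_suml.
    congr (_ *: _); have := congr1 (fun M : 'M[R[i]]_n => M i j) eG.
    rewrite [LHS]mxE => ->; rewrite mul_mx_diag mxE.
    by apply: eq_bigr => k _; rewrite !mxE.
  under eq_bigr do rewrite exchange_big.
  rewrite exchange_big; apply: eq_bigr => k _ /=.
  rewrite cstar_sum cmul_suml scaler_sumr; apply: eq_bigr => i _.
  rewrite cmul_sumr scaler_sumr; apply: eq_bigr => j _.
  rewrite cstarZ cmulZl cmulZr !scalerA; congr (_ *: _).
  by move: (Num.conj _) (d 0 k) (Q k j) => u v t; ring.
apply: pos_sum => k _.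
have -> : d 0 k = (complex.Re (d 0 k))%:C.
  by have := hd k; case: (d 0 k) => u v; rewrite lecE /= => /andP[/eqP -> _].
apply: posZ; last exact: pos_xx.
by have := hd k; case: (d 0 k) => u v; rewrite lecE /= => /andP[_].
Qed.

Lemma state_gram_list (l : seq (O * D)) :
  pos (\sum_(p <- l) \sum_(q <- l) w (cstar p.1 ** q.1) *: (cstar p.2 ** q.2)).
Proof.
have := state_gram (fun i : 'I_(size l) => (tnth (in_tuple l) i).1)
  (fun i => (tnth (in_tuple l) i).2).
congr pos; rewrite [RHS](big_tnth _ _ l); apply: eq_bigr => i _.
by rewrite [RHS](big_tnth _ _ l).
Qed.

End StateGram.

(** Take [Pi a = u (r a) u] with the unitary [u] attached to [v]: as [u f = v] and [f u = v^*],
    compressing by [f] gives back the compression by [v]. *)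
Lemma partial_isometry_dilation (R : realType) (O A : unitalCstarAlgType R)
    (v f : A) (r : O -> A) :
  v ** v = 0 -> v ** f = v -> cstar v ** r cone ** v = f ->
  star_hom r -> r cone = cone ->
  exists Pi : O -> A, [/\ star_hom Pi, Pi cone = cone &
    forall a, f ** Pi a ** f = cstar v ** r a ** v].
Proof.
move=> vv vf svv [rl rm rs] r1; rewrite r1 cmulx1 in svv.
have vsv : v ** (cstar v ** v) = v by rewrite svv.
have [u [su uu fu]] := partial_isometry_unitary vv vsv.
have sf : cstar f = f by rewrite -svv cstarM cstarK.
rewrite svv in fu.
have uf : u ** f = v by rewrite -[RHS]cstarK -fu cstarM su sf.
exists (fun a => u ** r a ** u); split; first split.
- by move=> k a b; rewrite rl cmulDr cmulDl cmulZr cmulZl.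
- move=> a b; rewrite rm -!cmulA; congr (_ ** (_ ** _)).
  by rewrite !cmulA uu cmul1x.
- by move=> a; rewrite !cstarM su cmulA rs.
- by rewrite r1 cmulx1.
by move=> a; rewrite !cmulA fu -cmulA uf.
Qed.

Section Dilation.
Variables (R : realType) (P : unitalCstarAlgType R) (tb : trace_basis P).
Variables (O B : unitalCstarAlgType R).
Local Notation n := (tb_n tb).
Local Notation e := (@tb_e R P tb).
Local Notation tr := (@tb_tr R P tb).
Local Notation tnB := (@tens R P tb B : P -> B -> tensC tb B).
Variables (Theta : O -> tensC tb B) (w : state O).
Hypotheses (Theta_cp : cp_on setT Theta) (Theta1 : Theta cone = cone).

(* The block [Some i, Some j] is [(tr (x) id) (e_i Theta(x) f_j)] with [f_j] the
   adjoint of [e_j]; the block of the state provides a unit vector orthogonal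
   to the other one. *)
Let K (x : O) (i j : option 'I_n) : B :=
  match i, j with
  | Some i, Some j => \sum_l tr (e i ** e l ** cstar (e j)) *: Theta x l
  | None, None => w x *: cone
  | _, _ => 0
  end.

Let K_linear (k : R[i]) x y i j : K (k *: x + y) i j = k *: K x i j + K y i j.
Proof.
case: i j => [i|] [j|] /=; rewrite ?scaler0 ?addr0 //.
  rewrite scaler_sumr -big_split; apply: eq_bigr => l _ /=.
  rewrite (cp_linear Theta_cp).
  transitivity (tr (e i ** e l ** cstar (e j)) *: (k *: Theta x l + Theta y l)) => //.
  by rewrite scalerDr !scalerA mulrC.
by rewrite st_linear scalerDl scalerA.
Qed.

Let K_star x i j : cstar (K x i j) = K (cstar x) j i.
Proof.
case: i j => [i|] [j|] /=; rewrite ?cstar0 //; last first.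
  by rewrite cstarZ cstar1 st_star.
have key (z : tensC tb B) i1 j1 :
    \sum_l tr (e i1 ** e l ** cstar (e j1)) *: z l =
    etr (tnB (e i1) cone ** z ** tnB (cstar (e j1)) cone).
  by rewrite etr_sandwich cmul1x cmulx1.
have etr_star (z : tensC tb B) : cstar (etr z) = etr (cstar z).
  rewrite [in LHS]/etr cstar_sum [in RHS](tensE z) cstar_sum etr_sum.
  by apply: eq_bigr => l _; rewrite tens_star etr_tens cstarZ tb_star.
rewrite !key etr_star !cstarM !tens_star !cstarK cstar1 (cp_star Theta_cp).
by rewrite cmulA.
Qed.

Let K_pos (l : seq (O * option 'I_n * B)) :
  pos (\sum_(p <- l) \sum_(q <- l)
    cstar p.2 ** K (cstar p.1.1 ** q.1.1) p.1.2 q.1.2 ** q.2).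
Proof.
(* Each entry is sent to [e_i^* (x) b] or to the part of the state, the other component being 0, so
   the form is the sum of one for [Theta] and one for [w]. *)
pose d (p : O * option 'I_n * B) : tensC tb B :=
  if p.1.2 is Some i then @tens R P tb B (cstar (e i)) p.2 else 0.
pose c (p : O * option 'I_n * B) : B := if p.1.2 is Some _ then 0 else p.2.
have h1 := etr_pos (cp_form Theta_cp [seq (p.1.1, d p) | p <- l]).
have h2 := state_gram_list w [seq (p.1.1, c p) | p <- l].
have := posD h1 h2; congr pos; rewrite !big_map etr_sum -big_split.
apply: eq_bigr => p _ /=; rewrite !big_map etr_sum -big_split.
apply: eq_bigr => q _ /=; case: p q => [[a i] x] [[b j] y]; rewrite /d /c /=.
case: i j => [i|] [j|] /=.
- by rewrite cstar0 cmul0x scaler0 addr0 tens_star cstarK etr_sandwich.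
- rewrite cstar0 cmul0x scaler0 addr0 !cmulx0 cmul0x.
  by rewrite /etr big1 // => k _; exact: scaler0.
- rewrite cstar0 !cmul0x !cmulx0 cmul0x scaler0 addr0.
  by rewrite /etr big1 // => k _; exact: scaler0.
rewrite cstar0 !cmul0x cmulZr cmulZl cmulx1.
by rewrite /etr big1 ?add0r // => k _; exact: scaler0.
Qed.

(** The universal property requires the first leg of [Pi] to be [P] itself, so the dilation is
    performed over [B], on the blocks of [Theta], and reassembled in [P (x) L(N)]. *)
Lemma ucp_tensor_dilation :
  exists (N : hmod B) (Pi : O -> tensC tb (opC N)) (eta : N),
    [/\ star_hom Pi, Pi cone = cone, pm_ip eta eta = cone &
      forall a i, pm_ip eta (opf (Pi a i) eta) = Theta a i].
Proof.
have [N [rho [vec [hrho rho1 hvec]]]] := kernel_dilation K_linear K_star K_pos.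
pose eta := vec None; pose zeta i := vec (Some i).
have ip_vec i j : pm_ip (vec i) (vec j) = K cone i j.
  by rewrite -hvec rho1.
have ee : pm_ip eta eta = cone by rewrite ip_vec /= st_one scale1r.
have ez i : pm_ip eta (zeta i) = 0 by rewrite ip_vec.
pose X := opC N.
pose tn p (T : X) : tensC tb X := @tens R P tb X p T.
(* [Lam] embeds [B] as the rank one operators [|eta b><eta|], and [ex] inverts it because
   [<eta, eta> = 1]. *)
pose Lam (b : B) : X := rank1 (pm_act eta b) eta.
pose ex (T : X) : B := pm_ip eta (opf T eta).
have Lam_lin : linear Lam.
  by move=> k b c; rewrite /Lam act_lin rank1_lin.
have exLam b : ex (Lam b) = b.
  by rewrite /ex /Lam /= !pm_ipM ee cmulx1 cmul1x.
have tnM p q (S T : X) : tn p S ** tn q T = tn (p ** q) (S ** T) by exact: tensM.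
(* [V^* (1 (x) rho a) V] is [Theta a] compressed to [eta]; since [V^2 = 0], the
   partial isometry [V] extends to a self-adjoint unitary. *)
pose V := \sum_i tn (e i) (rank1 (zeta i) eta).
have sV : cstar V = \sum_i tn (cstar (e i)) (rank1 eta (zeta i)).
  by rewrite cstar_sum; apply: eq_bigr => i _; rewrite tens_star rank1_star.
have LamZ (k : R[i]) b : Lam (k *: b) = k *: Lam b.
  have L0 : Lam 0 = 0.
    by rewrite /Lam act0 rank10.
  by have := Lam_lin k b 0; rewrite L0 !addr0.
have tn1 : tn cone (cone : X) = cone by [].
have VrV a : cstar V ** tn cone (rho a) ** V = tmap Lam (Theta a) :> tensC tb X.
  rewrite -[in RHS](trace_reconstruct (Theta a)) tmap_sum // sV.
  rewrite [X in X ** V]cmul_suml cmul_suml.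
  apply: eq_bigr => i _; rewrite tmap_sum // cmul_sumr; apply: eq_bigr => j _.
  rewrite tmap_tens //.
  rewrite !tnM cmulx1 -cmulA rank1_mull rank1M.
  by rewrite /zeta hvec.
have VV : V ** V = 0.
  rewrite cmul_suml big1 // => i _; rewrite cmul_sumr big1 // => j _.
  rewrite tnM rank1M ez act0 rank10.
  by apply: lam_inj; rewrite lam_tens lten0r lam0.
pose f := tn cone (rank1 eta eta).
have Vff : V ** f = V.
  rewrite /f cmul_suml; apply: eq_bigr => i _.
  by rewrite tnM cmulx1 rank1M ee act1.
have Lam1 : tmap Lam (cone : tensC tb B) = f.
  rewrite -[cone in LHS](tens1 tb B) tmap_tens //.
  by rewrite /Lam act1.
have sf : cstar f = f by rewrite tens_star cstar1 rank1_star.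
have ef : f = tn cone (rank1 eta eta) by [].
clearbody V f.
pose rh a := tn cone (rho a).
have [rl rm rs] := hrho.
have hrh : star_hom rh.
  split.
  - by move=> k a b; rewrite /rh rl; exact: tens_linearr.
  - by move=> a b; rewrite /rh rm tnM cmul1x.
  by move=> a; rewrite /rh tens_star cstar1 rs.
have rh1 : rh cone = cone by rewrite /rh rho1.
have sVf : cstar V ** rh cone ** V = f by rewrite VrV Theta1.
have [Pi [hPi Pi1 fPif]] := partial_isometry_dilation VV Vff sVf hrh rh1.
have hsand (T S : X) (z : tensC tb X) :
    tn cone T ** z ** tn cone S = tmap (fun x => T ** x ** S) z.
  rewrite [in RHS](tensE z) tmap_sum; last first.
    by move=> k x y; rewrite cmulDr cmulDl cmulZr cmulZl.
  rewrite tens_sandwich; apply: eq_bigr => l _.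
  rewrite tmap_tens ?cmul1x ?cmulx1 // => k x.
  by rewrite cmulZr cmulZl.
have ff (T : X) : rank1 eta eta ** T ** rank1 eta eta = Lam (ex T).
  by rewrite -cmulA rank1_mull rank1M.
exists N, Pi, eta; split=> //.
move=> a i; rewrite -[LHS]/(ex (Pi a i)).
have : f ** Pi a ** f = tmap Lam (Theta a) by rewrite fPif; exact: VrV.
have -> : f ** Pi a ** f = tmap Lam (tmap ex (Pi a)).
  rewrite ef hsand; apply/funext => j; exact: ff.
by move=> /(congr1 (fun z : tensC tb X => ex (z i))); rewrite /tmap !exLam.
Qed.

End Dilation.

Section CpOn.
Variables (R : realType) (A B : unitalCstarAlgType R) (S : set A) (f : A -> B).

Lemma cp_on_of_forms : linear_on S f ->
  (forall x, S x -> cstar (f x) = f (cstar x)) ->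
  (forall m (X Y : 'M[A]_m) (b : 'I_m -> B), (forall i j, S (X i j)) ->
    (forall i j, X i j = \sum_k cstar (Y k i) ** Y k j) ->
    pos (\sum_i \sum_j cstar (b i) ** f (X i j) ** b j)) ->
  cp_on S f.
Proof.
move=> fl fs fp; split=> // m X XS [Y XY]; apply: form_mx_pos => [i j|b].
  rewrite !mxE fs // !XY cstar_sum; congr f; apply: eq_bigr => k _.
  by rewrite cstarM cstarK.
have := fp _ _ _ b XS XY; congr pos.
by apply: eq_bigr => i _; apply: eq_bigr => j _; rewrite mxE.
Qed.

Hypothesis f_cp : cp_on S f.

(** Complete positivity over any finite index type; [tmap_hom_cp] applies it to pairs of indices. *)
Lemma cp_on_form (I : finType) (X Y : I -> I -> A) (x : I -> B) :
  (forall i j, S (X i j)) ->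
  (forall i j, X i j = \sum_k cstar (Y k i) ** Y k j) ->
  pos (\sum_i \sum_j cstar (x i) ** f (X i j) ** x j).
Proof.
move=> XS XY; have [_ h] := f_cp.
pose X' : 'M[A]_#|I| := \matrix_(i, j) X (enum_val i) (enum_val j).
have X'S i j : S (X' i j) by rewrite mxE.
have X'p : mx_pos X'.
  exists (\matrix_(i, j) Y (enum_val i) (enum_val j)) => i j.
  rewrite mxE XY (reindex (@enum_val I predT)) /=; last first.
    by exists enum_rank => k _; [exact: enum_valK|exact: enum_rankK].
  by apply: eq_bigr => k _; rewrite !mxE.
have := mx_pos_form (fun i => x (enum_val i)) (h _ _ X'S X'p); congr pos.
have bij : {on predT, bijective (@enum_val I predT)}.
  by exists enum_rank => k _; [exact: enum_valK|exact: enum_rankK].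
rewrite [RHS](reindex (@enum_val I predT)) //=; apply: eq_bigr => i _.
rewrite [RHS](reindex (@enum_val I predT)) //=; apply: eq_bigr => j _.
by rewrite !mxE.
Qed.

Hypotheses (f1 : f cone = cone) (S1 : S cone).
Hypotheses (S_star : forall x, S x -> S (cstar x)).
Hypotheses (SZ : forall (k : R[i]) x, S x -> S (k *: x)).

(* Apply [f] to [[r^2, r x], [r x^*, r^2]], which is [Y^* Y] for
   [Y = [[r, x], [0, h]]] with [h^2 = r^2 - x^* x]. *)
Let ucp_pair x (r : R) : S x -> 0 < r -> nrm x <= r ->
  cstar (f x) = f (cstar x) /\ nrm (f x) <= r.
Proof.
move=> Sx r0 xr; have Sx' := S_star Sx.
have f0 : f 0 = 0.
  have [fl _] := f_cp; have := fl (- 1) x x Sx Sx.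
  by rewrite !scaleN1r !addNr.
have S0 : S 0 by rewrite -(scale0r x); exact: SZ.
have fZ (k : R[i]) y : S y -> f (k *: y) = k *: f y.
  by move=> Sy; have [fl _] := f_cp; have := fl k y 0 Sy S0; rewrite f0 !addr0.
have xxr : nrm (cstar x ** x) <= r ^+ 2.
  by rewrite nrm_cstar_cmul ler_sqr ?nnegrE ?nrm_ge0 ?(ltW r0).
have [h sh hh] := pos_rone_nrm (sa_xx x) xxr.
pose X : 'M[A]_2 := \matrix_(i, j)
  if i == 0 then (if j == 0 then rone A (r ^+ 2) else r%:C *: x)
  else (if j == 0 then r%:C *: cstar x else rone A (r ^+ 2)).
pose Y : 'M[A]_2 := \matrix_(i, j)
  if i == 0 then (if j == 0 then rone A r else x) else (if j == 0 then 0 else h).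
have XS i j : S (X i j) by rewrite mxE; do 2!case: ifP => _; exact: SZ.
have r2 : (r ^+ 2)%:C = r%:C * r%:C :> R[i] by rewrite -rmorphM expr2.
have Xp : mx_pos X.
  exists Y => i j; rewrite !big_ord_recl big_ord0 addr0 !mxE /=.
  case: i => [[|[|i]] //= ilt]; case: j => [[|[|j]] //= jlt];
    rewrite ?cstar0 ?cmul0x ?cmulx0 ?addr0 /rone ?cstarZ ?conj_realC ?cstar1
      ?cmulZl ?cmulZr ?cmul1x ?cmulx1 ?scalerA -?r2 //.
  by rewrite sh -hh /rone addrC subrK.
have [_ fpos] := f_cp; have fXp := fpos _ _ XS Xp.
have fsx : cstar (f x) = f (cstar x).
  have := mx_pos_sa fXp 0 1; rewrite !mxE /= !fZ // cstarZ conj_realC => h1.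
  apply: (scalerI (a := r%:C)) => //.
  by rewrite (fmorph_eq0 (real_complex R)) gt_eqF.
(* At the column [(- y, r)] with [y = f x], the form is [r^2 (r^2 - y^* y)]. *)
split=> //; pose b (i : 'I_2) : B := if i == 0 then - f x else rone B r.
have := mx_pos_form b fXp.
rewrite !big_ord_recl !big_ord0 !mxE /= /b /= !addr0 /rone !fZ // f1 -fsx.
set y := f x.
rewrite !(cstarN, cstarZ, cstar1, conj_realC).
have -> : - cstar y ** ((r ^+ 2)%:C *: cone) ** - y +
   - cstar y ** (r%:C *: y) ** (r%:C *: cone) +
   (r%:C *: cone ** (r%:C *: cstar y) ** - y +
    r%:C *: cone ** ((r ^+ 2)%:C *: cone) ** (r%:C *: cone)) =
   (r ^+ 2)%:C *: (rone B (r ^+ 2) - cstar y ** y).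
  by rewrite /rone r2; nc_ring_in R B; ring.
move=> /(posZ (t := (r ^+ 2)^-1)); rewrite scalerA -rmorphM mulVf ?scale1r; last first.
  by rewrite expf_neq0 ?gt_eqF.
have r20 : 0 <= (r ^+ 2)^-1 by rewrite invr_ge0 sqr_ge0.
move=> /(_ r20) /(pos_le_nrm (sqr_ge0 r) (pos_xx y)).
by rewrite nrm_cstar_cmul ler_sqr ?nnegrE ?nrm_ge0 ?(ltW r0).
Qed.

Lemma ucp_on_star x : S x -> f (cstar x) = cstar (f x).
Proof.
move=> Sx; have r0 : 0 < nrm x + 1 by rewrite ltr_wpDl ?nrm_ge0.
by have [|->] := ucp_pair Sx r0; rewrite ?lerDl.
Qed.

Lemma ucp_on_contractive x : S x -> nrm (f x) <= nrm x.
Proof.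
move=> Sx; apply/ler_addgt0Pl => e e0.
have r0 : 0 < e + nrm x by rewrite ltr_pwDl ?nrm_ge0.
by have [|_] := ucp_pair Sx r0; rewrite // lerDr (ltW e0).
Qed.

End CpOn.

Lemma hom_sum (R : realType) (A C : unitalCstarAlgType R) (h : A -> C)
    (I : finType) (F : I -> A) :
  star_hom h -> h (\sum_i F i) = \sum_i h (F i).
Proof.
move=> hh; apply: (big_morph h) => [x y|]; [exact: homD hh x y|exact: hom0 hh].
Qed.

Section Kernels.
Variables (R : realType) (A C : unitalCstarAlgType R) (q : A -> C).
Hypotheses (hq : star_hom q) (q1 : q cone = cone).

Lemma ker_closed_ideal : closed_ideal [set x | q x = 0].
Proof.
have [ql qm _] := hq; split.
- apply/closure_id; apply/seteqP; split; first exact: subset_closure.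
  move=> x /closureP_nrm hx; apply: nrm0_eq0; apply/eqP.
  rewrite eq_le nrm_ge0 andbT; apply/ler_addgt0Pl => e e0; rewrite addr0.
  have [y /= qy /ltW xy] := hx e e0.
  rewrite -[q x]subr0 -qy -(homB hq).
  exact: le_trans (hom_contractive hq q1 _) xy.
- exact: hom0 hq.
- by move=> k x y /= qx qy; rewrite ql qx qy scaler0 addr0.
by move=> b x /= qx; rewrite !qm qx cmul0x cmulx0.
Qed.

(** For the quotient norm, contractivity gives one inequality, and [hom_lift] provides a kernel
    element at which the infimum is attained. *)
Lemma ker_quotient : set_surj setT setT q -> is_quotient [set x | q x = 0] q.
Proof.
move=> qs; split=> // b r; split=> [rb j /= qj|h].
  apply: le_trans rb _; rewrite !normE lecR.
  rewrite -[q b]addr0 -qj -(homD hq); exact: hom_contractive hq q1 _.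
have [qb0|qb0] := eqVneq (nrm (q b)) 0.
  have := h (- b); rewrite subrr normr0 normE qb0; apply=> /=.
  by rewrite (homN hq) (nrm0_eq0 qb0) oppr0.
have qbp : 0 < nrm (q b) by rewrite lt_neqAle eq_sym qb0 nrm_ge0.
have [j qj jle] := hom_lift hq q1 qbp (lexx _).
by apply: le_trans (h j qj) _; rewrite !normE lecR.
Qed.

End Kernels.

Lemma quotient_one (R : realType) (B Q : unitalCstarAlgType R) (q : B -> Q) :
  star_hom q -> set_surj setT setT q -> q cone = cone.
Proof.
move=> [_ qm _] qs; have [b _ qb] := qs cone Logic.I.
by rewrite -[LHS]cmulx1 -[in LHS]qb -qm cmul1x.
Qed.

(* With X unital, M(X) = X: a morphism acts by left multiplication. *)
Lemma mor_unital (R : realType) (A : cstarAlgType R) (X : unitalCstarAlgType R)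
    (F : A -> X -> X) : is_mor F ->
  exists h : A -> X, star_hom h /\ forall a x, F a x = h a ** x.
Proof.
move=> [Fl Fm Fs _]; exists (fun a => F a cone).
have Fx a x : F a x = F a cone ** x.
  have e y : F a y = cstar (F (cstar a) cone) ** y.
    by have := Fs (cstar a) cone y; rewrite cstar1 cmul1x cstarK => ->.
  by rewrite (e cone) cmulx1.
split=> //; split; first exact: Fl.
  by move=> a b; rewrite Fm Fx.
move=> a; have := Fs a cone cone.
by rewrite cstar1 cmul1x cmulx1.
Qed.

Lemma hom_mor (R : realType) (A X : unitalCstarAlgType R) (h : A -> X) :
  star_hom h -> h cone = cone -> is_mor (fun a x => h a ** x).
Proof.
move=> [hl hm hs] h1; split=> [b k x y|a a' b|a x y|].
- by rewrite hl cmulDl cmulZl.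
- by rewrite hm cmulA.
- by rewrite cstarM hs cmulA.
apply/seteqP; split=> // z _; apply: subset_closure.
exists 1, (fun=> 1), (fun=> z); split; last by rewrite big_ord1 scale1r.
by move=> _; exists cone, z; rewrite h1 cmul1x.
Qed.

(** [h 1] fixes every [F a x] on the left; these span a dense subspace by nondegeneracy, so [h 1]
    fixes the unit. *)
Lemma mor_unital_one (R : realType) (A X : unitalCstarAlgType R)
    (F : A -> X -> X) (h : A -> X) : is_mor F ->
  (forall a x, F a x = h a ** x) -> h cone = cone.
Proof.
move=> [Fl Fm _ Fn] Fh.
pose Z : set X := [set z | h cone ** z - z = 0].
have hhone a x : h cone ** (h a ** x) = h a ** x.
  by rewrite -!Fh -Fm cmul1x.
suff /eqP : h cone ** cone - cone = 0 by rewrite subr_eq0 cmulx1 => /eqP.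
have : closure (lin_span [set y | exists a b, y = F a b]) cone by rewrite Fn.
move=> /closure_tends[u hu ul].
apply: (@tends_uniq R X (fun k => h cone ** u k - u k)).
  apply: (tendsB (nrm_seminorm X)) => //; apply: tends_cmul => //.
  exact: (tends_cst (nrm_seminorm X)).
apply: (tends_ext (u := fun=> 0)); last exact: (tends_cst (nrm_seminorm X)).
move=> k; have [m [c [x [hx ->]]]] := hu k.
rewrite cmul_sumr -sumrB big1 // => i _.
by have [a [b ->]] := hx i; rewrite cmulZr Fh hhone subrr.
Qed.

Lemma bounded_linear_continuous_nrm (R : realType) (V W : normedModType R[i])
    (f : V -> W) (C : R) : linear f -> (forall x, nrm (f x) <= C * nrm x) ->
  continuous f.
Proof.
move=> fl fb x; apply/cvgrPdist_lt => e e0.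
have [-> eR] := complex_gt0 e0.
have C1 : 0 < `|C| + 1 by rewrite ltr_pwDr.
near=> y.
have fB : f x - f y = f (x - y).
  have -> : x - y = (-1) *: y + x by rewrite scaleN1r addrC.
  by rewrite fl scaleN1r addrC.
rewrite fB nrm_lt; apply: le_lt_trans (fb _) _.
apply: (@le_lt_trans _ _ ((`|C| + 1) * nrm (x - y))).
  apply: ler_wpM2r; first exact: nrm_ge0.
  by rewrite (le_trans (ler_norm C)) // lerDl.
rewrite -ltr_pdivlMl // -nrm_lt.
near: y; apply: (@cvgr_dist_lt _ _ _ (nbhs x) _ id x) => //.
by rewrite ltcR mulr_gt0 ?invr_gt0.
Unshelve. all: by end_near.
Qed.

Lemma linear_on_sum (R : realType) (A B : cstarAlgType R) (S : set A) (f : A -> B)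
    (I : Type) (r : seq I) (c : I -> R[i]) (x : I -> A) :
  linear_on S f -> S 0 ->
  (forall (k : R[i]) y z, S y -> S z -> S (k *: y + z)) -> (forall i, S (x i)) ->
  S (\sum_(i <- r) c i *: x i) /\
  f (\sum_(i <- r) c i *: x i) = \sum_(i <- r) c i *: f (x i).
Proof.
move=> fl S0 Sl Sx; elim: r => [|i r [IS If]].
  split; rewrite !big_nil //.
  by have := fl (-1) 0 0 S0 S0; rewrite scaler0 addr0 scaleN1r addNr.
by rewrite !big_cons fl // If; split=> //; exact: Sl.
Qed.

Section MatrixCoefficients.
Variables (R : realType) (P : unitalCstarAlgType R) (tb : trace_basis P).
Local Notation n := (tb_n tb).
Local Notation e := (@tb_e R P tb).
Local Notation tr := (@tb_tr R P tb).

Section One.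
Variable B : unitalCstarAlgType R.
Local Notation T := (tensC tb B).
Local Notation col := (colmod B n).
Implicit Types (z w : T) (x : col).

(** The matrix entry of [lam z] at [(k, l)], a scalar combination of the coordinates of [z]; hence
    it stays in any subspace containing them. *)
Definition coef z (k l : 'I_n) : B := \sum_j tr (cstar (e k) ** e j ** e l) *: z j.

Lemma opf_suml (N : hmod B) (I : finType) (F : I -> opC N) (x : N) :
  opf (\sum_i F i) x = \sum_i opf (F i) x.
Proof. exact: (big_morph (fun F : opC N => opf F x)). Qed.

Lemma col_sumE (I : finType) (F : I -> col) k : (\sum_i F i) k = \sum_i F i k.
Proof. exact: (big_morph (fun F : col => F k)). Qed.

Lemma opf_lam z x k : opf (lam z) x k = \sum_l coef z k l ** x l.
Proof.
rewrite opf_suml col_sumE /= /lten_fun exchange_big; apply: eq_bigr => l _ /=.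
by rewrite cmul_suml; apply: eq_bigr => j _; rewrite cmulZl.
Qed.

Definition delta (l : 'I_n) : col := fun k => if k == l then cone else 0.

Lemma coefE z k l : coef z k l = opf (lam z) (delta l) k.
Proof.
rewrite opf_lam (bigD1 l) //= /delta eqxx cmulx1 big1 ?addr0 // => j jl.
by rewrite (negbTE jl) cmulx0.
Qed.

Lemma ip_delta l (x : col) : pm_ip (delta l) x = x l.
Proof.
rewrite -[LHS]/(col_ip (delta l) x) /col_ip (bigD1 l) //= /delta eqxx.
rewrite cstar1 cmul1x big1 ?addr0 // => j jl.
by rewrite (negbTE jl) cstar0 cmul0x.
Qed.

Lemma coef_sum (I : finType) (F : I -> T) k l :
  coef (\sum_i F i) k l = \sum_i coef (F i) k l.
Proof.
apply: (big_morph (fun z : T => coef z k l)) => [z w|].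
  by rewrite /coef -big_split; apply: eq_bigr => j _; exact: scalerDr.
by rewrite /coef big1 // => j _; exact: scaler0.
Qed.

Lemma coefM z w k l : coef (z ** w) k l = \sum_j coef z k j ** coef w j l.
Proof.
rewrite coefE tensC_lamM opC_cmul opf_lam; apply: eq_bigr => j _.
by rewrite -coefE.
Qed.

Lemma coef_star z k l : coef (cstar z) k l = cstar (coef z l k).
Proof.
rewrite !coefE -!ip_delta pm_star tensC_lamS; exact/esym/opC_star'.
Qed.

End One.
End MatrixCoefficients.

Section TensorUCP.
Variables (R : realType) (P : unitalCstarAlgType R) (tb : trace_basis P).
Variables (O A B : unitalCstarAlgType R) (S : set A) (f : A -> B).
Local Notation n := (tb_n tb).
Local Notation e := (@tb_e R P tb).
Local Notation tr := (@tb_tr R P tb).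
Variable h : O -> tensC tb A.
Hypotheses (hh : star_hom h) (h1 : h cone = cone) (Sh : forall a i, S (h a i)).
Hypotheses (S0 : S 0) (Sl : forall (k : R[i]) x y, S x -> S y -> S (k *: x + y)).
Hypotheses (S_star : forall x, S x -> S (cstar x)).
Hypotheses (f_cp : cp_on S f) (f1 : f cone = cone).

(** The index [k] witnesses [P <> 0]: some coordinate of [1] in [P] is nonzero, and the same
    coordinate of [h 1 = 1 (x) 1] is a nonzero multiple of the unit. *)
Lemma tensor_basis_one (k : 'I_n) : S cone.
Proof.
have : exists i, tr (cstar (e i)) != 0.
  apply: contrapT => /forallNP h0.
  have e1 : (cone : P) = 0.
    rewrite [LHS](tb_expand tb) big1 // => i _; rewrite cmulx1.
    by have /negP := h0 i; rewrite negbK => /eqP ->; rewrite scale0r.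
  have := tb_orth k k; rewrite eqxx -[e k]cmulx1 e1 cmulx0 cmulx0 tr0.
  by move/eqP; rewrite eq_sym oner_eq0.
move=> [i tri]; suff -> : cone = (tr (cstar (e i)))^-1 *: h cone i + 0 by exact: Sl.
rewrite h1 -[(cone : tensC tb A) i]/(tr (cstar (e i) ** cone) *: cone) cmulx1 addr0.
by rewrite scalerA mulVf // scale1r.
Qed.

Let SZ (k : R[i]) x : S x -> S (k *: x).
Proof. by move=> Sx; rewrite -[k *: x]addr0; exact: Sl. Qed.

Let f_sum (I : Type) (r : seq I) (c : I -> R[i]) (x : I -> A) :
  (forall i, S (x i)) ->
  f (\sum_(i <- r) c i *: x i) = \sum_(i <- r) c i *: f (x i).
Proof. by have [fl _] := f_cp => Sx; have [] := linear_on_sum r c fl S0 Sl Sx. Qed.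

Let coefS z k l : (forall i, S (z i)) -> S (coef (z : tensC tb A) k l).
Proof.
have [fl _] := f_cp => Sz.
by have [] := linear_on_sum (index_enum 'I_n)
  (fun j => tr (cstar (e k) ** e j ** e l)) fl S0 Sl Sz.
Qed.

Let coef_f z k l : (forall i, S (z i)) -> f (coef (z : tensC tb A) k l) = coef (tmap f z) k l.
Proof. by move=> Sz; rewrite f_sum. Qed.

Lemma cstar_coord (C : unitalCstarAlgType R) (z : tensC tb C) k :
  cstar z k = \sum_i tr (cstar (e k) ** cstar (e i)) *: cstar (z i).
Proof. exact: tens_sum_coord. Qed.

Lemma tmap_unit : tmap f (h cone) = cone.
Proof.
rewrite h1; apply/funext => k; rewrite /tmap.
rewrite -[(cone : tensC tb A) k]/(tr (cstar (e k) ** cone) *: cone) -[RHS]/(tr (cstar (e k) ** cone) *: cone).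
have [fl _] := f_cp; have S1 := tensor_basis_one k.
rewrite -[_ *: cone]addr0 fl //.
have f0 : f 0 = 0.
  by have := fl (-1) 0 0 S0 S0; rewrite scaler0 addr0 scaleN1r addNr.
by rewrite f0 f1 addr0.
Qed.

(** Tested on a column [x], positivity of the form becomes a form of [f] indexed by pairs [(i, k)],
    whose entries are the matrix coefficients of [h (X i j)]. *)
Lemma tmap_hom_cp : cp_on setT (fun a => tmap f (h a)).
Proof.
have [hl hm hs] := hh; have [fl _] := f_cp.
have star a : cstar (tmap f (h a)) = tmap f (h (cstar a)).
  apply/funext => k; have S1 := tensor_basis_one k.
  rewrite cstar_coord hs /tmap cstar_coord f_sum => [|i]; last exact: S_star.
  by apply: eq_bigr => i _; rewrite (ucp_on_star f_cp f1 S1 S_star SZ).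
apply: cp_on_of_forms => [k x y _ _|x _|m X Y b _ XY]; last 1 first.
- pose z := \sum_i \sum_j cstar (b i) ** tmap f (h (X i j)) ** b j.
  have Xs i j : cstar (X i j) = X j i.
    by rewrite !XY cstar_sum; apply: eq_bigr => k _; rewrite cstarM cstarK.
  apply: tens_pos => [|x].
    rewrite /sa cstar_sum [RHS]exchange_big; apply: eq_bigr => i _.
    rewrite cstar_sum; apply: eq_bigr => j _.
    by rewrite !cstarM cstarK star Xs cmulA.
  pose y i : colmod B n := opf (lam (b i)) x.
  have -> : col_ip x (opf (lam z) x) =
      \sum_i \sum_j pm_ip (y i) (opf (lam (tmap f (h (X i j)))) (y j)).
    rewrite -[LHS]/(pm_ip (x : colmod B n) (opf (lam z) x)).
    rewrite /z lam_sum opf_suml ip_sumr; apply: eq_bigr => i _.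
    rewrite lam_sum opf_suml ip_sumr; apply: eq_bigr => j _.
    by rewrite !tensC_lamM tensC_lamS !opC_cmul -opC_star'.
  have XS p q : S (coef (h (X p.1 q.1)) p.2 q.2) by exact: coefS.
  (* Matrix coefficients are multiplicative and compatible with the star, so a factorization
     [X = Y^* Y] over [O] gives one over [A] indexed by pairs. *)
  have hcoef (p q : 'I_m * 'I_n) : coef (h (X p.1 q.1)) p.2 q.2 =
      \sum_c cstar (coef (h (Y c.1 p.1)) c.2 p.2) ** coef (h (Y c.1 q.1)) c.2 q.2.
    rewrite XY (hom_sum _ hh).
    rewrite -(pair_bigA _ (fun c k => cstar (coef (h (Y c p.1)) k p.2) **
      coef (h (Y c q.1)) k q.2)) /=.
    rewrite coef_sum; apply: eq_bigr => c _.
    rewrite hm hs coefM; apply: eq_bigr => k _.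
    by rewrite coef_star.
  have := cp_on_form f_cp (fun p => y p.1 p.2) XS hcoef; congr pos.
  rewrite -(pair_bigA _ (fun i k => \sum_q cstar (y i k) **
    f (coef (h (X i q.1)) k q.2) ** y q.1 q.2)) /=.
  apply: eq_bigr => i _.
  under eq_bigr do rewrite -(pair_bigA _ (fun j l => cstar (y i _) **
    f (coef (h (X i j)) _ l) ** y j l)) /=.
  rewrite exchange_big; apply: eq_bigr => j _.
  apply: eq_bigr => k _; rewrite opf_lam cmul_sumr; apply: eq_bigr => l _.
  by rewrite cmulA -coef_f.
- by rewrite hl; apply/funext => i; exact: fl.
exact: star.
Qed.

End TensorUCP.

Section TensorQuotient.
Variables (R : realType) (P : unitalCstarAlgType R) (tb : trace_basis P).
Variables (B Q : unitalCstarAlgType R) (q : B -> Q).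
Local Notation e := (@tb_e R P tb).
Local Notation tq := (@tmap R P tb B Q q : tensC tb B -> tensC tb Q).
Hypotheses (hq : star_hom q) (q1 : q cone = cone).

Lemma tmap_hom : star_hom tq.
Proof.
have [ql qm qs] := hq; have qZ := homZ hq.
split=> [k z w|z w|z]; first by apply/funext => i; exact: ql.
  rewrite {1}(tensE z) {1}(tensE w) cmul_suml tmap_sum //.
  rewrite (tensE (tq z)) (tensE (tq w)) cmul_suml; apply: eq_bigr => i _.
  rewrite !cmul_sumr tmap_sum //; apply: eq_bigr => j _.
  by rewrite !tensM tmap_tens // qm.
rewrite {1}(tensE z) (tensE (tq z)) !cstar_sum tmap_sum //; apply: eq_bigr => i _.
by rewrite !tens_star tmap_tens // qs.
Qed.

Lemma tmap_one : tq cone = cone.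
Proof. by rewrite -!tens1 tmap_tens ?q1 //; exact: homZ hq. Qed.

Lemma tmap_surj : set_surj setT setT q -> set_surj setT setT tq.
Proof.
move=> qs y _.
have /choice[x hx] : forall i, exists b, q b = y i.
  by move=> i; have [b _ <-] := qs (y i) Logic.I; exists b.
by exists (x : tensC tb B) => //; apply/funext.
Qed.

End TensorQuotient.

Section UnitalCorrection.
Variables (R : realType) (O D : unitalCstarAlgType R) (w : state O) (g : O -> D).
Hypothesis g_ccp : ccp g.

(** Contractivity of [g] gives [1 - g 1 = s^2], so the added term is the form of the state tensored
    with a positive element, positive by [state_gram]. *)
Lemma ccp_unital_correction : cp_on setT (fun a => g a + w a *: (cone - g cone)).
Proof.
have [gcp gc] := g_ccp.
have pg : pos (g cone) by apply: (cp_pos gcp); exact: pos1.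
have [s ss es] : pos (cone - g cone).
  have -> : cone - g cone = rone D 1 - g cone by rewrite /rone scale1r.
  apply: pos_rone_nrm; first exact: pos_sa.
  by apply: le_trans (nrm1_le O); rewrite -lecR -!normE; exact: gc.
apply: cp_on_of_forms => [k x y _ _|x _|m X Y b _ XY].
- rewrite (cp_linear gcp) st_linear; move: (cone - g cone) => c.
  rewrite scalerDl [in RHS]scalerDr !scalerA.
  by rewrite -!addrA; congr (_ + _); rewrite addrCA.
- rewrite cstarD (cp_star gcp) cstarZ st_star; congr (_ + _ *: _).
  by rewrite cstarB cstar1 (pos_sa pg).
have Xp : mx_pos (map_mx g X).
  by have [_ h] := gcp; apply: h => //; exists Y.
have wp : pos (\sum_k \sum_i \sum_j w (cstar (Y k i) ** Y k j) *:
    (cstar (s ** b i) ** (s ** b j))).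
  by apply: pos_sum => k _; exact: state_gram.
have := posD (mx_pos_form b Xp) wp; congr pos.
rewrite [X in _ + X = _]exchange_big -big_split; apply: eq_bigr => i _ /=.
rewrite [X in _ + X = _]exchange_big -big_split; apply: eq_bigr => j _ /=.
rewrite mxE cmulDr cmulDl; congr (_ + _).
rewrite -scaler_suml -state_sum -XY cmulZr cmulZl es; congr (_ *: _).
by rewrite cstarM ss !cmulA.
Qed.

End UnitalCorrection.

(** * Slices and the universal property *)

Section Slices.
Variables (R : realType) (P : unitalCstarAlgType R) (tb : trace_basis P).
Local Notation n := (tb_n tb).
Local Notation e := (@tb_e R P tb).
Local Notation tr := (@tb_tr R P tb).
Variables (M E : unitalCstarAlgType R) (t : P -> M -> E).
Hypothesis ht : is_min_tensor t.
Local Notation T := (tensC tb M).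
Local Notation lift := (@tens_lift R P tb M E t : T -> E).

Let htA := min_ten_alg ht.

Let nrm_lift (z : T) : nrm (lift z) = nrm z.
Proof.
apply/eqP; rewrite eq_le (tens_lift_nrm htA) andbT.
have := min_ten_norm ht (tens_alg tb M) e z.
by rewrite -(tensE z) !normE lecR.
Qed.

(** The map [lift] is isometric, as both sides carry the least norm, and its source is complete; its
    range is therefore closed as well as dense. This identifies the given [E] with the model
    [tensC tb M]. *)
Lemma tens_lift_surj x : exists z, lift z = x.
Proof.
have hl := tens_lift_hom tb htA.
have liftB z w : lift (z - w) = lift z - lift w.
  have [l _ _] := hl.
  by rewrite -[z - w]addrC -scaleN1r l scaleN1r addrC.
have : closure (lin_span [set z | exists a b, z = t a b]) x.
  by rewrite (min_ten_dense ht).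
move=> /closure_tends[u hu ux].
have hz k : exists z, lift z = u k.
  have [m [c [v [hv ->]]]] := hu k.
  have /choice[p hp] : forall i, exists p : P * M, v i = t p.1 p.2.
    by move=> i; have [a [b ->]] := hv i; exists (a, b).
  exists (\sum_i c i *: @tens R P tb M (p i).1 (p i).2).
  rewrite (tens_lift_sum htA); apply: eq_bigr => i _.
  have [l _ _] := hl; have l0 : lift 0 = 0.
    by apply: (addrI (lift 0)); rewrite -[RHS]addr0 -[lift 0 + lift 0]/(_ + _)
      -{1}[lift 0]scale1r -l scaler0 !addr0.
  by rewrite -[_ *: tens _ _]addr0 l l0 addr0 tens_lift_tens // hp.
have [z hz'] := choice hz.
have zf : fundamental (@nrm R T) z.
  move=> eps eps0; have [N hN] := tends_fundamental (nrm_seminorm E) ux eps0.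
  by exists N => j k hj hk; rewrite -nrm_lift liftB !hz'; exact: hN.
have [z0 zz0] := complete_tends zf; exists z0.
apply: (@tends_uniq R E u) => // eps eps0.
have [N hN] := zz0 eps eps0; exists N => k hk.
by rewrite -hz' -liftB nrm_lift; exact: hN.
Qed.

Definition coords (x : E) : T := projT1 (cid (tens_lift_surj x)).

Lemma coordsK x : lift (coords x) = x.
Proof. exact: projT2 (cid (tens_lift_surj x)). Qed.

Lemma coords_lift z : coords (lift z) = z.
Proof.
have [l _ _] := tens_lift_hom tb htA.
apply/eqP; rewrite -subr_eq0; apply/eqP; apply: (tens_lift_inj htA).
by rewrite -[_ - z]addrC -scaleN1r l scaleN1r coordsK addNr.
Qed.

Lemma coords_tens p m : coords (t p m) = @tens R P tb M p m.
Proof. by rewrite -[RHS]coords_lift tens_lift_tens. Qed.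

Lemma coords_hom : star_hom coords.
Proof.
have [l m s] := tens_lift_hom tb htA.
by split=> [k x y|x y|x]; rewrite -[RHS]coords_lift ?l ?m ?s !coordsK.
Qed.

Lemma coords_one : coords cone = cone.
Proof.
rewrite -(quotient_one (tens_lift_hom tb htA)) ?coords_lift // => x _.
by have [z zx] := tens_lift_surj x; exists z.
Qed.

Lemma nrm_coords x : nrm (coords x) = nrm x.
Proof. by rewrite -nrm_lift coordsK. Qed.

Lemma coord_bound : exists2 C, 0 <= C & forall x i, nrm (coords x i) <= C * nrm x.
Proof.
have [C C0 hC] := tnorm_coord tb M; exists C => // x i.
by rewrite -nrm_coords; exact: hC.
Qed.

Lemma coord_slice i : is_slice t (fun p => tr (cstar (e i) ** p)) (fun x => coords x i).
Proof.
have [l _ _] := coords_hom.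
have sl : linear (fun x => coords x i) by move=> k x y; rewrite l.
split=> // [|p m]; last by rewrite coords_tens.
have [C _ hC] := coord_bound.
by apply: (bounded_linear_continuous_nrm sl) => x; exact: hC.
Qed.

Lemma slice_coords omega s x : is_slice t omega s ->
  s x = \sum_i omega (e i) *: coords x i.
Proof.
move=> [sl _ st]; rewrite -{1}(coordsK x).
have s0 : s 0 = 0.
  have := sl (-1) 0 0; rewrite scaler0 addr0 scaleN1r => ->.
  by rewrite addNr.
have sD y z : s (y + z) = s y + s z by have := sl 1 y z; rewrite !scale1r.
rewrite (big_morph s sD s0); apply: eq_bigr => i _; exact: st.
Qed.

End Slices.

Section CoordinateFunctional.
Variables (R : realType) (P : unitalCstarAlgType R) (tb : trace_basis P).
Local Notation n := (tb_n tb).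
Local Notation e := (@tb_e R P tb).
Local Notation tr := (@tb_tr R P tb).

Lemma coord_functional_linear i : linear (fun p => tr (cstar (e i) ** p) : R[i]^o).
Proof. by move=> k p q; rewrite cmulDr cmulZr tb_linear. Qed.

(** The coordinates of [p] are read off [p (x) 1] in [P (x) D], for an auxiliary nonzero [D], where
    [tnorm_coord] bounds them; [p |-> p (x) 1] is a contraction. *)
Lemma coord_functional_continuous (D : unitalCstarAlgType R) i :
  (cone : D) <> 0 -> continuous (fun p => tr (cstar (e i) ** p) : R[i]^o).
Proof.
move=> D0; have [C C0 hC] := tnorm_coord tb D.
have d0 : 0 < nrm (cone : D).
  by rewrite lt_neqAle nrm_ge0 andbT; apply/eqP => /esym/nrm0_eq0.
apply: (@bounded_linear_continuous_nrm _ _ _ _ (C / nrm (cone : D))).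
  exact: coord_functional_linear.
move=> p; rewrite mulrAC ler_pdivlMr //.
have := hC (@tens R P tb D p cone) i; rewrite nrmZ => /le_trans; apply.
apply: ler_wpM2l => //; rewrite /tnorm lam_tens.
apply: (@hom_contractive R P (opC (colmod D n)) (fun p => @lten R P tb D p cone)).
  split=> [k x y|x y|x]; first exact: lten_linearl.
    by rewrite lten_mul cmul1x.
  by rewrite lten_star cstar1.
exact: lten1.
Qed.

End CoordinateFunctional.

Section SliceSystem.
Variables (R : realType) (P : unitalCstarAlgType R) (tb : trace_basis P).
Local Notation n := (tb_n tb).
Local Notation e := (@tb_e R P tb).
Local Notation tr := (@tb_tr R P tb).
Variables (O M E : unitalCstarAlgType R) (t : P -> M -> E) (Phi : O -> E).
Hypotheses (ht : is_min_tensor t) (hPhi : star_hom Phi) (O_neq0 : (cone : O) <> 0).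
Local Notation S := (slice_system t Phi).

Definition slices (a : O) : tensC tb M := @coords R P tb M E t ht (Phi a).
Local Notation h := slices.

(** By linearity of the coordinates a combination of slices can be gathered into one element of [O]
    for each basis vector. *)
Definition slice_span : set M := [set x | exists a : 'I_n -> O, x = \sum_i h (a i) i].

Lemma slices_hom : star_hom h.
Proof.
rewrite /slices; have [l m s] := coords_hom tb ht; have [Pl Pm Ps] := hPhi.
by split=> [k x y|x y|x]; rewrite ?Pl ?Pm ?Ps ?l ?m ?s.
Qed.

Lemma slice_span0 : slice_span 0.
Proof.
exists (fun=> 0); rewrite big1 // => i _.
by rewrite (hom0 slices_hom).
Qed.

Lemma slice_span_linear (k : R[i]) x y :
  slice_span x -> slice_span y -> slice_span (k *: x + y).
Proof.
move=> [a ->] [b ->]; exists (fun i => k *: a i + b i).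
have [l _ _] := slices_hom.
rewrite scaler_sumr -big_split; apply: eq_bigr => i _ /=.
by rewrite [X in _ = X i]l.
Qed.

Lemma slice_span_sum (I : Type) (r : seq I) (F : I -> M) :
  (forall i, slice_span (F i)) -> slice_span (\sum_(i <- r) F i).
Proof.
move=> hF; elim: r => [|i r IH]; first by rewrite big_nil; exact: slice_span0.
by rewrite big_cons -[F i]scale1r; exact: slice_span_linear.
Qed.

Lemma slice_spanZ (k : R[i]) x : slice_span x -> slice_span (k *: x).
Proof. by move=> hx; rewrite -[k *: x]addr0; apply: slice_span_linear slice_span0. Qed.

Lemma slice_span_coord a i : slice_span (h a i).
Proof.
exists (fun j => if j == i then a else 0).
rewrite (bigD1 i) //= eqxx big1 ?addr0 // => j /negbTE ->.
by rewrite (hom0 slices_hom).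
Qed.

Lemma slice_span_star x : slice_span x -> slice_span (cstar x).
Proof.
move=> [a ->]; rewrite cstar_sum; apply: slice_span_sum => i.
have [_ _ s] := slices_hom.
have -> : h (a i) i = cstar (h (cstar (a i))) i.
  by rewrite -[in LHS](cstarK (a i)) [h (cstar _)]s.
rewrite cstar_coord cstar_sum; apply: slice_span_sum => j.
by rewrite cstarZ cstarK; apply: slice_spanZ; exact: slice_span_coord.
Qed.

Lemma slice_systemE : S = closure slice_span.
Proof.
congr closure; apply/seteqP; split=> [x [m [c [y [hy ->]]]]|x [a ->]].
  apply: slice_span_sum => j; apply: slice_spanZ.
  have [omega [s [a [_ _ hs ->]]]] := hy j.
  rewrite (slice_coords tb ht _ hs); apply: slice_span_sum => i.
  by apply: slice_spanZ; exact: slice_span_coord.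
exists n, (fun=> 1), (fun i => h (a i) i); split; last first.
  by apply: eq_bigr => i _; rewrite scale1r.
move=> i; exists (fun p => tr (cstar (e i) ** p)), (fun x => @coords R P tb M E t ht x i), (a i).
split=> //; first exact: coord_functional_linear.
  exact: coord_functional_continuous O_neq0.
exact: coord_slice.
Qed.

Lemma slice_systemS x : slice_span x -> S x.
Proof. by rewrite slice_systemE; exact: subset_closure. Qed.

Lemma slice_system_linear (k : R[i]) x y : S x -> S y -> S (k *: x + y).
Proof.
rewrite slice_systemE => /closure_tends[u hu ux] /closure_tends[v hv vy].
apply/closureP_nrm => eps eps0.
have := tendsD (nrm_seminorm M) (tendsZ k ux) vy.
move=> /(_ eps eps0)[N hN]; exists (k *: u N + v N).
  exact: slice_span_linear.
by rewrite (seminorm_dist (nrm_seminorm M)); exact: hN.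
Qed.

Lemma slice_system_star x : S x -> S (cstar x).
Proof.
rewrite slice_systemE => /closureP_nrm hx; apply/closureP_nrm => eps eps0.
have [y Sy xy] := hx eps eps0; exists (cstar y); first exact: slice_span_star.
by rewrite -cstarB nrm_cstar.
Qed.

(** Into unital algebras, morphisms are left multiplications by homomorphisms; evaluating the
    universal property at units turns it into this statement about [l]. *)
Lemma universal_hom (X F : unitalCstarAlgType R) (u : P -> X -> F) (Pi : O -> F) :
  is_universal_map t Phi -> is_min_tensor u -> u cone cone = cone ->
  star_hom Pi -> Pi cone = cone ->
  exists l : M -> X, [/\ star_hom l, l cone = cone &
    forall a, Pi a = \sum_i u (e i) (l (h a i))].
Proof.
move=> [_ _ univ] hu u1 hPi Pi1; have Psi_mor := hom_mor hPi Pi1.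
have [L [[Lmor [H [Hmor HL] PsiH]] _]] := univ _ _ _ hu _ Psi_mor.
have [l [lhom Ll]] := mor_unital Lmor.
have [g [ghom Hg]] := mor_unital Hmor.
exists l; split=> //; first exact: mor_unital_one Lmor Ll.
move=> a.
have gt p m : g (t p m) = u p (l m).
  by have := HL p m cone cone; rewrite Hg Ll u1 !cmulx1.
have -> : Pi a = g (Phi a) by have := PsiH a cone; rewrite Hg !cmulx1.
have [gl _ _] := ghom.
have g0 : g 0 = 0.
  by have := gl (-1) 0 0; rewrite scaler0 addr0 scaleN1r => ->; rewrite addNr.
have gD y z : g (y + z) = g y + g z by have := gl 1 y z; rewrite !scale1r.
rewrite -{1}(coordsK tb ht (Phi a)) (big_morph g gD g0).
by apply: eq_bigr => i _; rewrite gt.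
Qed.

End SliceSystem.

Section VectorState.
Variables (R : realType) (B : unitalCstarAlgType R) (N : hmod B) (M : unitalCstarAlgType R).
Variables (l : M -> opC N) (eta : N).
Hypotheses (hl : star_hom l) (l1 : l cone = cone) (ee : pm_ip eta eta = cone).

Lemma vector_cp : cp_on setT (fun m => pm_ip eta (opf (l m) eta)).
Proof.
have [ll lm ls] := hl.
apply: cp_on_of_forms => [k x y _ _|x _|m X Y b _ XY].
- by rewrite ll -[opf _ eta]/(k *: opf (l x) eta + opf (l y) eta) ipDr ipZr.
- by rewrite pm_star ls -opC_star'.
pose z k := \sum_i opf (l (Y k i)) (pm_act eta (b i)).
have -> : \sum_i \sum_j cstar (b i) ** pm_ip eta (opf (l (X i j)) eta) ** b j =
    \sum_k pm_ip (z k) (z k).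
  transitivity (\sum_i \sum_j \sum_k pm_ip (opf (l (Y k i)) (pm_act eta (b i)))
      (opf (l (Y k j)) (pm_act eta (b j)))).
    apply: eq_bigr => i _; apply: eq_bigr => j _.
    rewrite -ipMl -pm_ipM -opf_act XY (hom_sum _ hl) opf_suml ip_sumr.
    by apply: eq_bigr => k _; rewrite lm ls opC_cmul -opC_star'.
  under eq_bigr do rewrite exchange_big.
  rewrite exchange_big; apply: eq_bigr => k _ /=.
  rewrite /z ip_suml; apply: eq_bigr => i _.
  by rewrite ip_sumr.
by apply: pos_sum => k _; exact: pm_pos.
Qed.

Lemma vector_one : pm_ip eta (opf (l cone) eta) = cone.
Proof. by rewrite l1 -ee. Qed.

End VectorState.

Theorem theorem4p3 (R : realType) (P O M E : unitalCstarAlgType R)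
  (t : P -> M -> E) (Phi : O -> E)
  (P_findim : finite_dim P)
  (O_neq0 : (cone : O) <> 0)
  (O_separable : separable O)
  (O_lifting : lifting_property O)
  (E_tensor : is_min_tensor t)
  (M_universal : is_universal_map t Phi) :
  operator_system_lifting_property (slice_system t Phi).
Proof.
have [tb _] := finite_dim_trace_basis P_findim.
have [w _] := state_exists O_neq0.
have [hPhi Phi1 _] := M_universal.
move=> B Q J q _ [hq qs _ _] f [f_cp f1].
have q1 := quotient_one hq qs.
pose S := slice_system t Phi.
pose h : O -> tensC tb M := @slices R P tb O M E t Phi E_tensor.
have hh : star_hom h := slices_hom tb E_tensor hPhi.
have h1 : h cone = cone.
  by rewrite /h /slices Phi1 coords_one.
have S_span x : slice_span tb Phi E_tensor x -> S x by exact: slice_systemS.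
have Sh a i : S (h a i) by apply: S_span; exact: slice_span_coord.
have Slin := slice_system_linear tb E_tensor hPhi O_neq0.
have S_star := slice_system_star tb E_tensor hPhi O_neq0.
have S0 : S 0 by apply: S_span; exact: slice_span0.
pose f' : O -> tensC tb Q := fun a => @tmap R P tb M Q f (h a).
have f'_cp : cp_on setT f' := tmap_hom_cp hh h1 Sh S0 Slin S_star f_cp f1.
have f'1 : f' cone = cone := tmap_unit h1 Sh S0 Slin f_cp f1.
have f'_ccp : ccp f'.
  split=> // x; rewrite !normE lecR.
  exact: (ucp_on_contractive f'_cp f'1).
have tq_hom := tmap_hom tb hq.
have tq1 := tmap_one tb hq q1.
(* The ideal of [P (x) B] is the kernel of [id (x) q], which avoids describing it in terms of
   [J]. *)
have [g [g_ccp qg]] := O_lifting _ _ _ _ (ker_closed_ideal tq_hom tq1)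
  (ker_quotient tq_hom tq1 (@tmap_surj R P tb B Q q qs)) _ f'_ccp.
(* The lift [g] is only contractive, and [g 1] may differ from the unit; the correction dies in the
   quotient since [f' 1 = 1]. *)
pose Theta a := g a + w a *: (cone - g cone).
have Theta_cp : cp_on setT Theta := ccp_unital_correction w g_ccp.
have Theta1 : Theta cone = cone by rewrite /Theta st_one scale1r addrC subrK.
have qTheta a : @tmap R P tb B Q q (Theta a) = f' a.
  rewrite /Theta (homD tq_hom) (homZ tq_hom) (homB tq_hom) !qg tq1 f'1.
  by rewrite subrr scaler0 addr0.
have [N [Pi [eta [hPi Pi1 ee PiTheta]]]] := ucp_tensor_dilation w Theta_cp Theta1.
have [l [hl l1 lh]] := universal_hom tb E_tensor M_universal (tens_min tb (opC N))
  (tens1 tb (opC N)) hPi Pi1.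
have Pi_l a i : Pi a i = l (h a i).
  by rewrite lh -(tensE ((fun i => l (h a i)) : tensC tb (opC N))).
pose psi m := pm_ip eta (opf (l m) eta).
have psi_cp : cp_on setT psi := vector_cp eta hl.
have psi1 : psi cone = cone := vector_one l1 ee.
have qpsi_span x : slice_span tb Phi E_tensor x -> q (psi x) = f x.
  move=> [a ->]; have [fl _] := f_cp.
  have [_] := linear_on_sum (index_enum 'I_(tb_n tb)) (fun=> 1) fl S0 Slin
    (fun i => Sh (a i) i).
  under eq_bigr do rewrite scale1r.
  move=> ->; rewrite (big_morph psi (cpD psi_cp) (cp0 psi_cp)) (hom_sum _ hq).
  apply: eq_bigr => i _; rewrite scale1r.
  have -> : psi (h (a i) i) = Theta (a i) i by rewrite -PiTheta Pi_l.
  exact: (congr1 (fun z : tensC tb Q => z i) (qTheta (a i))).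
exists psi; split=> [|x].
  have [pl pp] := psi_cp; split=> //; split=> [k x y _ _|m X _]; first exact: pl.
  exact: pp.
rewrite (slice_systemE tb E_tensor) // => /closureP_nrm Sx.
have psi_le y : nrm (psi y) <= nrm y by exact: (ucp_on_contractive psi_cp psi1).
have f_le y : S y -> nrm (f y) <= nrm y.
  (* Contractivity of [f] uses that the unit lies in [S], which is known when the basis of [P] is
     nonempty. Otherwise the slices are zero and [S] is reduced to 0. *)
  move=> Sy; case: (pickP (@predT 'I_(tb_n tb))) => [k _|n0].
    apply: (ucp_on_contractive f_cp f1 _ S_star) => //.
      exact: tensor_basis_one h1 Sh S0 Slin k.
    by move=> c z Sz; rewrite -[c *: z]addr0; exact: Slin.
  have -> : y = 0.
    move: Sy; rewrite /S (slice_systemE tb E_tensor) // => /closureP_nrm Sy.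
    apply: nrm0_eq0; apply/eqP; rewrite eq_le nrm_ge0 andbT.
    apply/ler_addgt0Pl => r r0; rewrite addr0.
    have [z [a ->] /ltW] := Sy r r0.
    by rewrite big1 ?subr0 // => i _; have := n0 i.
  have [fl _] := f_cp; have := fl (-1) 0 0 S0 S0.
  by rewrite scaler0 addr0 scaleN1r addNr => ->; rewrite !nrm0.
apply/eqP; rewrite -subr_eq0; apply/eqP/nrm0_eq0/eqP.
rewrite eq_le nrm_ge0 andbT; apply/ler_addgt0Pl => r r0; rewrite addr0.
have [y Sy /ltW xy] := Sx _ (divr_gt0 r0 (ltr0Sn R 1)).
have Sx' : S x by rewrite /S (slice_systemE tb E_tensor) //; apply/closureP_nrm.
have Sy' := S_span _ Sy.
have [fl _] := f_cp; have [pl _] := psi_cp.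
(* The two maps agree at [y] in the span, so only [x - y], of norm at most [r / 2], contributes to
   each. *)
have -> : q (psi x) - f x = q (psi (x - y)) - f (x - y).
  have eB : x - y = (-1) *: y + x by rewrite scaleN1r addrC.
  rewrite eB fl // pl // !scaleN1r (homD hq) (homN hq) (qpsi_span y Sy).
  move: (q (psi x)) (f x) (f y) => u v z.
  by rewrite opprD opprK addrACA addNr add0r.
apply: le_trans (nrmB _ _) _; rewrite [r]splitr; apply: lerD.
  apply: le_trans (hom_contractive hq q1 _) _.
  exact: le_trans (psi_le _) xy.
apply: le_trans (f_le _ _) xy.
by have := Slin (-1) y x Sy' Sx'; rewrite scaleN1r addrC.
Qed.
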